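(* Let $k\ge1$, $0\le s<k$, $n=2^k$, and let $\Sigma$ be a nonempty set of totally isotropic subspaces of $\mathbb{F}_2^{2k}$, all of dimension $k-s$. Let $\mathcal{D}_\Sigma=\bigcup_{S\in\Sigma}\mathcal{D}_S\subset\mathcal{G}_{2^s,2^k}$. Then: (1) $\mathcal{D}_\Sigma$ is a $2$-design; (2) for $t=2$ and $t=3$, $\mathcal{D}_\Sigma$ is a $2t$-design if and only if $$\frac{1}{|\Sigma|^2}\sum_{S,S'\in\Sigma}|S\cap S'|^{t-1}=d_{k-s,k}(t-1).$$
   Context: Let $V=\mathbb{R}^n$, $n=2^k$, with orthonormal basis $(e_u)_{u\in\mathbb{F}_2^k}$; $X(a):e_u\mapsto e_{u+a}$, $Y(b):e_u\mapsto(-1)^{b\cdot u}e_u$, and $E=\langle -I,X(a),Y(b)\rangle$. The map $\pm X(a)Y(b)\mapsto(a,b)$ identifies $E/\{\pm I\}$ with $\mathbb{F}_2^{2k}$, and $q(a,b)=a\cdot b$ (given by $g^2=(-1)^{q}I$) is a quadratic form of maximal Witt index; ''totally isotropic'' refers to $q$. For a totally isotropic $S$ of dimension $k-s$, its preimage $\tilde S\subset E$ is an elementary abelian $2$-group, and $V$ splits into $2^{k-s}$ pairwise orthogonal common eigenspaces of $\tilde S$, each of dimension $2^s$; $\mathcal{D}_S\subset\mathcal{G}_{2^s,2^k}$ is the set of these $2^{k-s}$ subspaces. $X_w$ denotes the set of all totally isotropic subspaces of dimension $w$, and $d_{w,k}(t)=\frac{1}{|X_w|^2}\sum_{S,S'\in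 X_w}|S\cap S'|^t$. Grassmannian designs: $\mathcal{G}_{m,n}$ ($m\le n/2$) is the Grassmannian with $O(\mathbb{R}^n)$-action; $L^2(\mathcal{G}_{m,n})=\bigoplus_\mu H^{2\mu}_{m,n}$ over partitions $\mu$ with at most $m$ parts, $H^{2\mu}_{m,n}$ being the multiplicity-one component isomorphic to the irreducible $O(\mathbb{R}^n)$-representation associated with $2\mu$; a finite $\mathcal{D}$ is a $2t$-design if $\sum_{x\in\mathcal{D}}f(x)=0$ for all $f\in H^{2\mu}_{m,n}$ with $1\le\sum_i\mu_i\le t$. *)

(* Defs.v *)
From HB Require Import structures.
From mathcomp Require Import all_boot all_order perm all_algebra.
From mathcomp Require Import boolp classical_sets cardinality fsbigop reals.
From mathcomp Require Import topology.

Set Implicit Arguments.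
Unset Strict Implicit.
Unset Printing Implicit Defensive.

Import GRing.Theory Num.Theory.
Import numFieldTopology.Exports.
Local Open Scope ring_scope.

Section Grassmannian.
Variables (R : realType) (n : nat).

Definition Gr (m : nat) (U : {vspace 'cV[R]_n}) : Prop := \dim U = m.

Definition orthogonal_mx (g : 'M[R]_n) : Prop := g^T *m g = 1%:M.

Definition actG (g : 'M[R]_n) (U : {vspace 'cV[R]_n}) : {vspace 'cV[R]_n} :=
  (linfun (mulmx g) @: U)%VS.

(* Gr m carries the quotient topology of O(n) under each orbit map
   g |-> g U.  A function on Gr m is represented by a total function on
   subspaces, of which only the values on Gr m matter. *)
Definition continuous_on_Gr (m : nat) (f : {vspace 'cV[R]_n} -> R) : Prop :=
  forall U, Gr m U ->
    {within [set g | orthogonal_mx g]%classic,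
      continuous (fun g : 'M[R]_n => f (actG g U))}%classic.

End Grassmannian.

(* The d-th tensor power of R^n, in coordinates. *)
Notation tensor R n d := {ffun {ffun 'I_d -> 'I_n} -> R^o}.

Section WeylModule.
Variables (R : realType) (n : nat).

Definition actT d (g : 'M[R]_n) (T : tensor R n d) : tensor R n d :=
  [ffun i : {ffun 'I_d -> 'I_n} =>
    \sum_(j : {ffun 'I_d -> 'I_n}) (\prod_(a < d) g (i a) (j a)) * T j].

Definition traceless d (T : tensor R n d) : Prop :=
  forall a b : 'I_d, a != b -> forall i : {ffun 'I_d -> 'I_n},
    \sum_(l < n) T [ffun c => if (c == a) || (c == b) then l else i c] = 0.

(* The boxes of the Young diagram of la are numbered by 'I_(sumn la) in reading
   order, so that box a lies in row [reshape_index la a] and column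
   [reshape_offset la a]. *)
Definition row_group (la : seq nat) : {set 'S_(sumn la)} :=
  [set p : 'S_(sumn la) |
    [forall a, reshape_index la (p a) == reshape_index la a]].

Definition col_group (la : seq nat) : {set 'S_(sumn la)} :=
  [set q : 'S_(sumn la) |
    [forall a, reshape_offset la (q a) == reshape_offset la a]].

Definition young_symmetrizer (la : seq nat) (T : tensor R n (sumn la)) :
    tensor R n (sumn la) :=
  [ffun i : {ffun 'I_(sumn la) -> 'I_n} =>
    \sum_(p in row_group la) \sum_(q in col_group la)
      (-1) ^+ odd_perm q * T [ffun a => i (q (p a))]].

(* Weyl's construction of the irreducible representation of O(n) attached to la
   (nonzero exactly when
   the first two columns of la have total length at most n): the traceless
   tensors in the image of the Young symmetrizer. *)
Definition weyl_module (la : seq nat) (T : tensor R n (sumn la)) : Prop :=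
  traceless T /\ exists T0, T = young_symmetrizer T0.

End WeylModule.

Section Design.
Variables (R : realType) (n : nat).

Definition is_partition (mu : seq nat) : bool := sorted geq mu && (0 \notin mu)%N.

Definition twice (mu : seq nat) : seq nat := [seq (2 * x)%N | x <- mu].

(* H^{2mu}_{m,n}: the functions lying in the image of an O(n)-equivariant linear
   map from the irreducible representation attached to 2mu to the functions on
   Gr m.  Since the multiplicity is one, this image is H^{2mu} for every nonzero
   such map.  Finite-dimensional invariant subspaces of L^2 (Gr m) consist of
   (classes of) continuous functions, hence L^2 is replaced by the space of
   continuous functions, on which evaluation at a point is meaningful. *)
Definition H2 (m : nat) (mu : seq nat) (f : {vspace 'cV[R]_n} -> R) : Prop :=
  exists Phi : tensor R n (sumn (twice mu)) -> {vspace 'cV[R]_n} -> R,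
  [/\ forall T, weyl_module T -> continuous_on_Gr m (Phi T),
      forall (c : R) T1 T2, weyl_module T1 -> weyl_module T2 ->
        forall U, Gr m U -> Phi (c *: T1 + T2) U = c * Phi T1 U + Phi T2 U,
      forall g T, orthogonal_mx g -> weyl_module T ->
        forall U, Gr m U -> Phi (actT g T) (actG g U) = Phi T U &
      exists2 T, weyl_module T & forall U, Gr m U -> f U = Phi T U].

Definition is_2t_design (m t : nat) (D : set {vspace 'cV[R]_n}) : Prop :=
  [/\ (forall U, D U -> Gr m U),
      finite_set D &
      forall (mu : seq nat) (f : {vspace 'cV[R]_n} -> R),
        is_partition mu -> (size mu <= m)%N -> (1 <= sumn mu <= t)%N ->
        H2 m mu f -> \sum_(U \in D) f U = 0].

End Design.

Section FiniteVspace.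
Variables (F : finFieldType) (vT : vectType F).
HB.instance Definition _ : isCountable {vspace vT} :=
  CanIsCountable (@VectorInternalTheory.vs2mxK F vT).
HB.instance Definition _ : isFinite {vspace vT} :=
  CanIsFinite (@VectorInternalTheory.vs2mxK F vT).
End FiniteVspace.

(* F_2^{2k}, as the space of pairs (a, b). *)
Notation F2k2 k := ('rV['F_2]_k * 'rV['F_2]_k)%type.

Section Clifford.
Variable k : nat.

Definition dotF2 (a b : 'rV['F_2]_k) : 'F_2 := \sum_(j < k) a 0 j * b 0 j.

Definition q (v : F2k2 k) : 'F_2 := dotF2 v.1 v.2.

Definition totally_isotropic (S : {vspace F2k2 k}) : bool :=
  [forall v : F2k2 k, (v \in S) ==> (q v == 0)].

Definition isotropic_subspaces (w : nat) : {set {vspace F2k2 k}} :=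
  [set S | totally_isotropic S & \dim S == w].

Definition card_capv (S S' : {vspace F2k2 k}) : nat :=
  #|[set v : F2k2 k | v \in (S :&: S')%VS]|.

Variable R : realType.

Definition intersection_moment (Sigma : {set {vspace F2k2 k}}) (t : nat) : R :=
  (#|Sigma|%:R ^+ 2)^-1 *
  \sum_(S in Sigma) \sum_(S' in Sigma) (card_capv S S')%:R ^+ t.

Definition dwk (w t : nat) : R := intersection_moment (isotropic_subspaces w) t.

(* The bijection from 'I_(2 ^ k) to F_2^k given by binary digits; it indexes the
   canonical basis of R^(2^k) by F_2^k. *)
Definition label (i : 'I_(2 ^ k)) : 'rV['F_2]_k :=
  \row_(j < k) (i %/ 2 ^ j)%:R.

Definition Xmx (a : 'rV['F_2]_k) : 'M[R]_(2 ^ k) :=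
  \matrix_(i, j) (label i == label j + a)%:R.

Definition Ymx (b : 'rV['F_2]_k) : 'M[R]_(2 ^ k) :=
  \matrix_(i, j) ((-1) ^+ (dotF2 b (label j) != 0) * (i == j)%:R).

(* Since Y(b) X(a) = (-1)^(a.b) X(a) Y(b), the group E generated by -1, the X(a)
   and the Y(b) is the set of all +-X(a)Y(b); this is the preimage in E of S under
   +-X(a)Y(b) |-> (a, b). *)
Definition preimE (S : {vspace F2k2 k}) (g : 'M[R]_(2 ^ k)) : Prop :=
  exists (c : bool) (v : F2k2 k),
    v \in S /\ g = (-1) ^+ c *: (Xmx v.1 *m Ymx v.2).

(* The (nonzero) common eigenspaces of the preimage of S; chi g is the eigenvalue
   of g. *)
Definition DS (S : {vspace F2k2 k}) : set {vspace 'cV[R]_(2 ^ k)} :=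
  [set W | W <> 0%VS /\
     exists chi : 'M[R]_(2 ^ k) -> R,
       forall v, v \in W <-> forall g, preimE S g -> g *m v = chi g *: v]%classic.

Definition DSigma (Sigma : {set {vspace F2k2 k}}) : set {vspace 'cV[R]_(2 ^ k)} :=
  [set W | exists2 S, S \in Sigma & DS S W]%classic.

End Clifford.

Arguments DSigma {k} R Sigma _.
Arguments dwk k R w t : clear implicits.

(* Main.v *)
(* For S totally isotropic, the projections onto the members of D_S are
   |S|^-1 sum_(v in S) psi(v) g_v, where g_(a,b) = X(a)Y(b) and psi is a twisted
   character of S.  Let A_t(Sigma) be the average of the t-th tensor powers of the
   projections onto the members of D_Sigma, and let X be the set of all totally
   isotropic subspaces of dimension k - s.

   Orthogonality of characters gives <A_t(Sigma), A_t(Sigma)> as a constant times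
   the moment of order t - 1 of |S :&: S'|.  By Witt's theorem A_t(X) is, for
   t <= 3, a combination of products of Kronecker deltas; so is A_1(Sigma) for
   every Sigma.  The complete contractions of A_t(Sigma) depend only on the ranks
   of the projections, hence A_t(Sigma) - A_t(X) is orthogonal to A_t(X), and the
   moments of Sigma and X agree if and only if A_t(Sigma) = A_t(X).

   If this holds, D_Sigma is a 2t-design: by the first fundamental theorem for
   O(m) x O(n - m), a function in H^(2mu) is a combination of contractions of
   tensor powers of the projection with a traceless tensor, and traceless tensors
   are orthogonal to products of deltas.  Conversely, if D_Sigma is a 2t-design,
   then by induction on t the tensor A_t(Sigma) - A_t(X) is traceless; a tensor
   power of a symmetric matrix is a combination of translates of its images under
   the Young symmetrizers of the shapes 2mu, so A_t(Sigma) - A_t(X) is orthogonal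
   to A_t(Sigma) as well, and vanishes. *)

Require Import Defs.
From HB Require Import structures.
From mathcomp Require Import all_boot all_order perm all_algebra finfield.
From mathcomp Require Import boolp classical_sets cardinality fsbigop reals.
From mathcomp Require Import topology normedtype.
From mathcomp Require Import ring zify.

Set Implicit Arguments.
Unset Strict Implicit.
Unset Printing Implicit Defensive.

Import Order.TTheory GRing.Theory Num.Theory.
Local Open Scope ring_scope.

(** * Orthogonal projections and the Grassmannian *)

Section Projections.
Variables (R : realType) (n : nat).
Implicit Types (U : {vspace 'cV[R]_n}) (P : 'M[R]_n).

(** The invariant theory is elementary because t <= 3: among at most six slots two different indices
    cannot both occur four times, so a traceless tensor invariant under O(m) x O(n - m) is killed by
    sign changes, transpositions and one infinitesimal rotation. The isotropy of A_t(X) rests on the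
    completeness relation of the g_v. Averaging over characters leaves only vectors of S with sum 0,
    so for t = 3 two free vectors u and v remain, the third being u + v. Hence Witt's theorem is
    needed for pairs only, and transvections suffice for it. In the converse the design hypothesis
    speaks only of partitions with at most m = 2^s parts, which for s <= 1 leaves out shapes of the
    Young decomposition. Their contractions with the projections vanish for another reason:
    antisymmetry in more than m slots meets a matrix of rank m. *)

Lemma dot_self_eq0 (x : 'cV[R]_n) : (x^T *m x) 0 0 = 0 -> x = 0.
Proof.
rewrite mxE => /eqP; rewrite psumr_eq0 => [/allP x0|i _]; last first.
  by rewrite mxE -expr2 sqr_ge0.
apply/colP => i; have /implyP/(_ isT) := x0 i (mem_index_enum i).
by rewrite !mxE mulf_eq0 orbb => /eqP.
Qed.

(** Gram-Schmidt: a unit vector u of U is split off, and a frame of its orthogonal complement in U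
    is completed by u. *)
Lemma orthonormal_frame m U : \dim U = m ->
  exists2 B : 'M[R]_(n, m), B^T *m B = 1%:M &
    forall x, (x \in U) = (B *m (B^T *m x) == x).
Proof.
elim: m U => [|m IHm] U dU.
  exists 0; first by apply/matrixP => -[].
  move=> x; move/eqP: dU; rewrite dimv_eq0 => /eqP->.
  by rewrite mul0mx memv0 eq_sym.
have Un0 : U != 0%VS by rewrite -dimv_eq0 dU.
pose v := vpick U; have vn0 : v != 0 by rewrite vpick0.
have vv_gt0 : 0 < (v^T *m v) 0 0.
  rewrite lt_def; apply/andP; split; last first.
    by rewrite mxE sumr_ge0 // => i _; rewrite mxE -expr2 sqr_ge0.
  by apply: contra_neq vn0 => /dot_self_eq0.
pose u := (Num.sqrt ((v^T *m v) 0 0))^-1 *: v.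
have uU : u \in U by rewrite memvZ // memv_pick.
have uu : u^T *m u = 1%:M.
  have -> : u^T = (Num.sqrt ((v^T *m v) 0 0))^-1 *: v^T.
    by apply/matrixP => i j; rewrite !mxE.
  rewrite -scalemxAl -scalemxAr scalerA.
  apply/matrixP => i j; rewrite !ord1 mxE -expr2 exprVn sqr_sqrtr ?ltW //.
  by rewrite mulVf ?gt_eqF // mxE.
pose f : 'Hom('cV[R]_n, 'cV[R]_1) := linfun (mulmx u^T).
have fE x : f x = u^T *m x by rewrite lfunE.
have dK : \dim (U :&: lker f) = m.
  have := limg_ker_dim f U; rewrite dU.
  have -> : (f @: U)%VS = fullv; last by rewrite dimvf /dim /= muln1 addn1 => -[].
  apply/vspaceP => y; rewrite memvf.
  have -> : y = y 0 0 *: f u.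
    by rewrite fE uu; apply/matrixP => i j; rewrite !ord1 !mxE mulr1.
  by rewrite memvZ ?memv_img.
have [B BB BU] := IHm _ dK.
have uB : u^T *m B = 0.
  apply/matrixP => i j; rewrite ord1.
  have : col j B \in (U :&: lker f)%VS.
    by rewrite BU colE (mulmxA B^T) BB mul1mx.
  rewrite memv_cap memv_ker fE => /andP[_ /eqP/matrixP/(_ i 0)].
  by rewrite !mxE ord1 => e; rewrite -[RHS]e; apply: eq_bigr => l _; rewrite !mxE.
have Bu : B^T *m u = 0 by rewrite -[LHS]trmxK trmx_mul trmxK uB trmx0.
pose C : 'M[R]_(n, 1 + m) := row_mx u B.
have CC : C^T *m C = 1%:M.
  by rewrite tr_row_mx mul_col_row uu BB uB Bu -scalar_mx_block.
have CCT : C *m C^T = u *m u^T + B *m B^T by rewrite tr_row_mx mul_row_col.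
exists C => // x; rewrite mulmxA CCT mulmxDl -!mulmxA.
set y := x - u *m (u^T *m x).
have -> : (x \in U) = (y \in U).
  have uxU : u *m (u^T *m x) \in U.
    rewrite [u^T *m x]mx11_scalar -scalemx1 -scalemxAr mulmx1; exact: memvZ.
  by rewrite /y rpredBr.
have fy : y \in lker f.
  by rewrite memv_ker fE /y mulmxBr (mulmxA u^T) uu mul1mx subrr.
have -> : (y \in U) = (y \in (U :&: lker f)%VS) by rewrite memv_cap fy andbT.
rewrite BU /y mulmxBr [B^T *m (u *m _)]mulmxA Bu mul0mx subr0.
by rewrite eq_sym subr_eq eq_sym addrC.
Qed.

Definition is_projm U P : Prop :=
  [/\ P^T = P, P *m P = P & forall x, (x \in U) = (P *m x == x)].

Lemma frame_projm m U (B : 'M[R]_(n, m)) : B^T *m B = 1%:M ->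
  (forall x, (x \in U) = (B *m (B^T *m x) == x)) -> is_projm U (B *m B^T).
Proof.
move=> BB BU; split; first by rewrite trmx_mul trmxK.
  by rewrite mulmxA -(mulmxA B) BB mulmx1.
by move=> x; rewrite BU mulmxA.
Qed.

(** Equal fixed spaces give P P' = P' and P' P = P; by symmetry, transposing the second identity
    turns it into P P' = P. *)
Lemma is_projm_uniq U P P' : is_projm U P -> is_projm U P' -> P = P'.
Proof.
move=> [PT PP PU] [P'T P'P' P'U].
have fix1 (A A' : 'M[R]_n) : A' *m A' = A' ->
    (forall x : 'cV_n, (A' *m x == x) -> (A *m x == x)) -> A *m A' = A'.
  move=> A'A' AA'; apply/matrixP => i j.
  have A'j : A' *m col j A' == col j A' by rewrite colE mulmxA A'A'.
  have /eqP/colP/(_ i) := AA' _ A'j.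
  by rewrite !mxE => <-; apply: eq_bigr => l _; rewrite !mxE.
have e1 : P *m P' = P' by apply: fix1 => // x; rewrite -P'U PU.
have e2 : P' *m P = P by apply: fix1 => // x; rewrite -PU P'U.
by rewrite -PT -e2 trmx_mul PT P'T e1.
Qed.

Lemma is_projm_inj U U' P : is_projm U P -> is_projm U' P -> U = U'.
Proof. by move=> [_ _ PU] [_ _ PU']; apply/vspaceP => x; rewrite PU PU'. Qed.

Definition projm U : 'M[R]_n := xget 0 [set P | is_projm U P]%classic.

Lemma projmP U : is_projm U (projm U).
Proof.
have [B BB BU] := orthonormal_frame (erefl (\dim U)).
by apply: (@xgetPex _ 0 [set P | is_projm U P]%classic);
   exists (B *m B^T); apply: frame_projm.
Qed.

Lemma projm_eq U P : is_projm U P -> projm U = P.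
Proof. exact: is_projm_uniq (projmP U). Qed.

Lemma projm_inj : injective projm.
Proof.
by move=> U U' e; apply: is_projm_inj (projmP U) _; rewrite e; apply: projmP.
Qed.

Lemma Gr_frame m U : Gr m U ->
  exists2 B : 'M[R]_(n, m), B^T *m B = 1%:M & projm U = B *m B^T.
Proof.
move=> dU; have [B BB BU] := orthonormal_frame dU.
by exists B => //; apply: projm_eq; apply: frame_projm.
Qed.

Lemma dim_projm U : (\dim U)%:R = \tr (projm U).
Proof.
have [B BB ->] := Gr_frame (erefl (\dim U)).
by rewrite mxtrace_mulC BB mxtrace1.
Qed.

Lemma orthogonal_mxV (g : 'M[R]_n) : orthogonal_mx g -> g *m g^T = 1%:M.
Proof. exact: mulmx1C. Qed.

Lemma actGE (g : 'M[R]_n) U : orthogonal_mx g ->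
  forall x, (x \in actG g U) = (g^T *m x \in U).
Proof.
move=> gO x; apply/memv_imgP/idP => [[y yU ->]|gxU].
  by rewrite lfunE /= mulmxA gO mul1mx.
by exists (g^T *m x); rewrite // lfunE /= mulmxA orthogonal_mxV ?mul1mx.
Qed.

Lemma projm_actG (g : 'M[R]_n) U : orthogonal_mx g ->
  projm (actG g U) = g *m projm U *m g^T.
Proof.
move=> gO; apply: projm_eq; have [PT PP PU] := projmP U.
split; first by rewrite !trmx_mul trmxK PT mulmxA.
  by rewrite !mulmxA -(mulmxA _ g^T) gO mulmx1 -(mulmxA g) PP.
move=> x; rewrite actGE // PU -!mulmxA; apply/eqP/eqP => [->|e].
  by rewrite mulmxA orthogonal_mxV // mul1mx.
by rewrite -{2}e (mulmxA g^T g) gO mul1mx.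
Qed.

Lemma orthonormal_coframe m (B : 'M[R]_(n, m)) : B^T *m B = 1%:M ->
  exists B' : 'M[R]_(n, n - m),
    [/\ B'^T *m B' = 1%:M, B'^T *m B = 0 & B *m B^T + B' *m B'^T = 1%:M].
Proof.
move=> BB; pose f : 'Hom('cV[R]_n, 'cV[R]_m) := linfun (mulmx B^T).
have fE x : f x = B^T *m x by rewrite lfunE.
have dK : \dim (lker f) = (n - m)%N.
  have := limg_ker_dim f fullv; rewrite capfv dimvf /dim /= muln1.
  have -> : (f @: fullv)%VS = fullv.
    apply/vspaceP => y; rewrite memvf.
    have -> : y = f (B *m y) by rewrite fE mulmxA BB mul1mx.
    by rewrite memv_img ?memvf.
  by rewrite dimvf /dim /= muln1 => e; rewrite -[X in (X - m)%N]e addnK.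
have [B' B'B' B'U] := orthonormal_frame dK.
have B'B : B'^T *m B = 0.
  rewrite -[LHS]trmxK trmx_mul trmxK; apply/eqP; rewrite trmx_eq0; apply/eqP.
  apply/matrixP => i j.
  have : col j B' \in lker f.
    by rewrite B'U colE (mulmxA B'^T) B'B' mul1mx.
  rewrite memv_ker fE => /eqP/matrixP/(_ i 0).
  by rewrite !mxE => e; rewrite -[RHS]e; apply: eq_bigr => l _; rewrite !mxE.
exists B'; split=> //; apply/matrixP => i j.
pose x : 'cV[R]_n := delta_mx j 0.
have : x - B *m (B^T *m x) \in lker f.
  by rewrite memv_ker fE mulmxBr (mulmxA B^T) BB mul1mx subrr.
rewrite B'U mulmxBr !(mulmxA B'^T) B'B mul0mx subr0 mulmxA eq_sym subr_eq.
rewrite mulmxA -mulmxDl addrC => /eqP/colP/(_ i).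
have -> : (B *m B^T + B' *m B'^T) i j = col j (B *m B^T + B' *m B'^T) i 0.
  by rewrite [RHS]mxE.
by rewrite colE -/x => <-; rewrite !mxE eqxx andbT.
Qed.

Lemma Gr_transitive m U0 U : Gr m U0 -> Gr m U ->
  exists2 g : 'M[R]_n, orthogonal_mx g & U = actG g U0.
Proof.
move=> /Gr_frame[B0 BB0 P0] /Gr_frame[B BB P].
have [B0' [BB0' BB0'0 B01]] := orthonormal_coframe BB0.
have [B' [BB' BB'0 _]] := orthonormal_coframe BB.
have BB'0T : B^T *m B' = 0 by rewrite -[LHS]trmxK trmx_mul trmxK BB'0 trmx0.
(* Maps the frame B0 to B and the complementary frame B0' to B', so it is orthogonal and carries U0
   to U. *)
pose g := B *m B0^T + B' *m B0'^T.
have gB0 : g *m B0 = B.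
  by rewrite mulmxDl -!mulmxA BB0 BB0'0 mulmx0 addr0 mulmx1.
have gO : orthogonal_mx g.
  have gT : g^T = B0 *m B^T + B0' *m B'^T.
    apply/matrixP => i j; rewrite !mxE.
    by congr (_ + _); apply: eq_bigr => l _; rewrite !mxE mulrC.
  rewrite /orthogonal_mx gT mulmxDl !mulmxDr.
  rewrite -!mulmxA !(mulmxA B^T) !(mulmxA B'^T) BB BB' BB'0 BB'0T.
  by rewrite !mul0mx !mul1mx !mulmx0 addr0 add0r.
exists g => //; apply: projm_inj; rewrite projm_actG // P P0 !mulmxA gB0.
by rewrite -mulmxA -trmx_mul gB0.
Qed.

Definition fixsp P : {vspace 'cV[R]_n} := lker (linfun (mulmx (P - 1%:M))).

Lemma is_projm_fixsp P : P^T = P -> P *m P = P -> is_projm (fixsp P) P.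
Proof.
move=> PT PP; split=> // x.
by rewrite memv_ker lfunE /= mulmxBl mul1mx subr_eq0.
Qed.

End Projections.

(** * Tensors with slots and their complete contractions along matchings *)

Section Contractions.
Variables (R : realType) (n : nat).

Section Slots.
Variable I : finType.
Implicit Types (i : {ffun I -> 'I_n}) (A : {set I}).

(** Summed over [l], this contracts slots p and q; for slots in ['I_d] it is convertible to the
    expression in [traceless]. *)
Definition upd2 (p q : I) i (l : 'I_n) : {ffun I -> 'I_n} :=
  [ffun c => if (c == p) || (c == q) then l else i c].

Definition upd1 (p : I) i (l : 'I_n) : {ffun I -> 'I_n} :=
  [ffun c => if c == p then l else i c].

(* [phi] pairs off the slots of [T]: [ctr phi P T] contracts [T] with the t-th
   tensor power of [P] along this matching. *)
Definition ctr t (phi : 'I_t * bool -> I) (P : 'M[R]_n)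
    (T : {ffun I -> 'I_n} -> R) : R :=
  \sum_(i : {ffun I -> 'I_n})
     T i * \prod_(c < t) P (i (phi (c, false))) (i (phi (c, true))).

Lemma prod_matching t (phi : 'I_t * bool -> I) (F : I -> R) : bijective phi ->
  \prod_a F a = \prod_(c < t) (F (phi (c, false)) * F (phi (c, true))).
Proof.
move=> phiB; rewrite (reindex phi) /=; last exact: onW_bij.
under [RHS]eq_bigr => c _ do rewrite mulrC -(big_bool _ (fun b => F (phi (c, b)))).
by rewrite pair_bigA; apply: eq_bigr => -[].
Qed.

(** Since [phi] is bijective, an index function is a free choice of two indices for each c, and the
    sum of products factors by distributivity. *)
Lemma sum_matching t (phi : 'I_t * bool -> I) (H : 'I_t -> 'I_n -> 'I_n -> R) :
  bijective phi ->
  \sum_(i : {ffun I -> 'I_n})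
     \prod_(c < t) H c (i (phi (c, false))) (i (phi (c, true))) =
  \prod_(c < t) \sum_x \sum_y H c x y.
Proof.
move=> [psi phiK psiK].
pose h (f : {ffun 'I_t -> 'I_n * 'I_n}) : {ffun I -> 'I_n} :=
  [ffun a => if (psi a).2 then (f (psi a).1).2 else (f (psi a).1).1].
rewrite (reindex h) /=; last first.
  exists (fun i : {ffun I -> 'I_n} =>
    [ffun c => (i (phi (c, false)), i (phi (c, true)))]).
    by move=> f _; apply/ffunP => c; rewrite !ffunE !phiK /=; case: (f c).
  move=> i _; apply/ffunP => a; rewrite !ffunE /=.
  by have := psiK a; case: (psi a) => c [] /= <-.
under eq_bigr => f _ do under eq_bigr => c _ do rewrite !ffunE !phiK /=.
rewrite -(bigA_distr_bigA (fun c (xy : 'I_n * 'I_n) => H c xy.1 xy.2)).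
by apply: eq_bigr => c _; rewrite pair_bigA.
Qed.

(** [z] is a base value: an index function agreeing on p and q amounts to one normalised to z there,
    together with the common value l. *)
Lemma sum_diag (p q : I) (z : 'I_n) (G : {ffun I -> 'I_n} -> R) : p != q ->
  \sum_(i : {ffun I -> 'I_n} | i p == i q) G i =
  \sum_(i : {ffun I -> 'I_n} | (i p == z) && (i q == z)) \sum_l G (upd2 p q i l).
Proof.
move=> pq; rewrite pair_big_dep /=.
rewrite (reindex_onto (fun il : {ffun I -> 'I_n} * 'I_n => upd2 p q il.1 il.2)
  (fun i => (upd2 p q i z, i p))) /=.
  apply: eq_bigl => -[i l] /=; rewrite !ffunE !eqxx orbT eqxx /=.
  rewrite xpair_eqE eqxx !andbT.
  apply/eqP/andP => [<-|[/eqP ip /eqP iq]]; first by rewrite !ffunE !eqxx orbT.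
  apply/ffunP => c; rewrite !ffunE.
  by case: eqP => [->|_] //=; case: eqP => [->|_].
move=> i /eqP ipq; apply/ffunP => c; rewrite !ffunE /=.
by case: eqP => [->|_] //=; case: eqP => [->|_].
Qed.

(** A single pair suffices: the identity matrix at c0 forces equal indices on p and q, the other
    factors do not see their common value, and summing over it is a trace of T. *)
Lemma ctr_traceless t (phi : 'I_t * bool -> I) (T : {ffun I -> 'I_n} -> R) :
  (0 < t)%N -> bijective phi ->
  (forall p q, p != q -> forall i, \sum_l T (upd2 p q i l) = 0) ->
  ctr phi 1%:M T = 0.
Proof.
move=> t_gt0 phiB Ttr; pose c0 := Ordinal t_gt0.
have phi_inj := bij_inj phiB.
set p := phi (c0, false); set q := phi (c0, true).
have pq : p != q by rewrite (inj_eq phi_inj) xpair_eqE andbF.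
pose rest (i : {ffun I -> 'I_n}) : R := \prod_(c < t | c != c0)
  (1%:M : 'M[R]_n) (i (phi (c, false))) (i (phi (c, true))).
have -> : ctr phi 1%:M T = \sum_(i : {ffun I -> 'I_n} | i p == i q) T i * rest i.
  rewrite big_mkcond /=; apply: eq_bigr => i _.
  rewrite (bigD1 c0) //= mxE -/p -/q -/(rest i).
  by case: eqP => _; rewrite ?mul1r // mul0r mulr0.
have [z _|no] := pickP 'I_n; last first.
  by rewrite big1 // => i _; have := no (i p).
rewrite (sum_diag z) // big1 // => i _.
have restE l : rest (upd2 p q i l) = rest i.
  have ne c b b' : c != c0 -> (phi (c, b) == phi (c0, b')) = false.
    by move=> cc0; rewrite (inj_eq phi_inj) xpair_eqE (negbTE cc0).
  by apply: eq_bigr => c cc0; rewrite !ffunE /p /q !ne.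
under eq_bigr => l _ do rewrite restE.
by rewrite -mulr_suml Ttr // mul0r.
Qed.

End Slots.

Lemma ctr_actT d t (phi : 'I_t * bool -> 'I_d) (P g : 'M[R]_n) (T : tensor R n d) :
  bijective phi -> ctr phi P (actT g T) = ctr phi (g^T *m P *m g) T.
Proof.
move=> phiB; rewrite /ctr.
under eq_bigr => i _ do rewrite ffunE mulr_suml.
rewrite exchange_big /=; apply: eq_bigr => j _.
under eq_bigr => i _ do rewrite mulrAC (prod_matching _ phiB) -big_split mulrC /=.
rewrite -mulr_sumr; congr (_ * _).
rewrite (sum_matching (fun c x y => g x (j (phi (c, false))) *
  g y (j (phi (c, true))) * P x y) phiB).
apply: eq_bigr => c _; rewrite mxE exchange_big /=; apply: eq_bigr => y _.
rewrite mxE mulr_suml; apply: eq_bigr => x _; rewrite mxE.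
by rewrite mulrAC.
Qed.

End Contractions.

(** * Traceless tensors invariant under O(m) x O(n - m) *)

Section Invariance.
Variables (R : realType) (n : nat) (I : finType) (col : 'I_n -> bool).
Implicit Types (i : {ffun I -> 'I_n}) (A : {set I}).
Implicit Types tau : {ffun I -> 'I_n} -> R.

Definition cnt A i x := #|[set c in A | i c == x]|.

(* Invariance under O(m) x O(n - m), the colours being the two blocks of indices:
   [inv_sign] and [inv_perm] come from signed permutations and [inv_rot] from
   infinitesimal rotations in a coordinate plane of one colour. *)
Record colour_invariant A tau : Prop := Invariant {
  inv_dep : forall i (j : {ffun I -> 'I_n}), (forall c, c \in A -> i c = j c) -> tau i = tau j;
  inv_sign : forall i x, odd (cnt A i x) -> tau i = 0;
  inv_perm : forall i x y, col x = col y -> tau [ffun c => tperm x y (i c)] = tau i;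
  inv_rot : forall i x y, x != y -> col x = col y ->
    \sum_(c in A) (if i c == x then tau (upd1 c i y)
                   else if i c == y then - tau (upd1 c i x) else 0) = 0 }.

Lemma cnt_upd2 A (p q : I) i x y : p \in A -> q \in A -> p != q ->
  cnt A (upd2 p q i y) x = (cnt (A :\ p :\ q) i x + (y == x).*2)%N.
Proof.
move=> pA qA; rewrite eq_sym => qp.
rewrite /cnt (cardsD1 p) (cardsD1 q) !inE qp /= pA qA.
rewrite !ffunE !eqxx orbT /= addnA addnn addnC; congr (_ + _)%N.
apply: eq_card => c; rewrite !inE !ffunE.
by case: (c == q); case: (c == p).
Qed.

(** Induction on the number of distinct indices of the colour of [i c0] that occur. An odd
    multiplicity gives 0 by a sign change. An index of multiplicity 2 is treated by the trace over
    its two slots. Otherwise every multiplicity in this colour is at least 4, so with at most 6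
    slots only the index of c0 occurs, and a rotation relation combined with the traces
    concludes. *)
Lemma colour_invariant_traceless_eq0 A tau : colour_invariant A tau -> (0 < #|A|)%N ->
  (#|A| <= 6)%N ->
  (forall p q, p \in A -> q \in A -> p != q -> forall i b,
     \sum_(x | col x == b) tau (upd2 p q i x) = 0) ->
  forall i, tau i = 0.
Proof.
move=> [dep sgn prm rot] /card_gt0P[c0 c0A] A6 tr i.
pose V i := [set x | (col x == col (i c0)) && (0 < cnt A i x)%N].
have [N] := ubnP #|V i|; elim: N => // N IHN in i * => /ltnSE-leN.
have cnt_c0 : (0 < cnt A i (i c0))%N.
  by apply/card_gt0P; exists c0; rewrite !inE c0A /=.
have [/existsP[x oddx]|noodd] := boolP [exists x, odd (cnt A i x)].
  exact: sgn oddx.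
have ev x : ~~ odd (cnt A i x) by move: noodd; rewrite negb_exists => /forallP.
have [/existsP[x /andP[/eqP colx /eqP cntx]]|no2] :=
    boolP [exists x, (col x == col (i c0)) && (cnt A i x == 2)].
  have /cards2P[p [q [pq pqE]]] : #|[set c in A | i c == x]| == 2 by apply/eqP.
  have /andP[pA /eqP ip] : (p \in A) && (i p == x).
    by have := set21 p q; rewrite -pqE inE.
  have /andP[qA /eqP iq] : (q \in A) && (i q == x).
    by have := set22 p q; rewrite -pqE inE.
  have xV : x \in V i by rewrite inE colx eqxx cntx.
  (* Here y already occurs in i while x disappears: one index fewer, so the induction hypothesis
     applies. *)
  have other y : col y = col x -> y != x -> y \in V i -> tau (upd2 p q i y) = 0.
    move=> yx ynx yV; apply: IHN.
    apply: leq_trans leN; rewrite [X in (_ < X)%N](cardsD1 x) xV ltnS.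
    apply: subset_leq_card; apply/fintype.subsetP => w; rewrite !inE cnt_upd2 // ffunE.
    have -> : col (if (c0 == p) || (c0 == q) then y else i c0) = col (i c0).
      by case: ifP => // _; rewrite yx.
    have cw u : cnt A i u = (cnt (A :\ p :\ q) i u + (x == u).*2)%N.
      rewrite -(@cnt_upd2 A p q i u x) //; congr (cnt A _ u).
      by apply/ffunP => c; rewrite !ffunE; case: eqP => [->|_] //=; case: eqP => [->|_].
    have cx0 : cnt (A :\ p :\ q) i x = 0%N by move: cntx; rewrite cw eqxx addn2 => -[].
    case/andP => -> /= w_gt0; have [wx|wx] := eqVneq w x.
      by move: w_gt0; rewrite wx cx0 (negbTE ynx).
    have [wy|wy] := eqVneq y w; first by move: yV; rewrite inE wy => /andP[].
    by move: w_gt0; rewrite cw (negbTE wy) addn0 addn_gt0 => ->.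
  (* For y = x nothing changes, and an absent y is exchanged with x by a transposition. The trace
     thus becomes a positive multiple of [tau i]. *)
  have same y : col y = col x -> y \notin V i :\ x -> tau (upd2 p q i y) = tau i.
    move=> yx; rewrite !inE yx colx eqxx /= negb_and negbK -leqNgt leqn0 => yV.
    rewrite -(prm i x y) //; apply: dep => c cA; rewrite !ffunE.
    have -> : (c == p) || (c == q) = (i c == x).
      by have := in_set2 c p q; rewrite -pqE inE cA.
    case: eqP => [->|/eqP icx]; first by rewrite tpermL.
    case/orP: yV => [/eqP->|]; first by rewrite tperm1 perm1.
    rewrite cards_eq0 => /eqP/setP/(_ c); rewrite !inE cA /= => /negbT icy.
    by rewrite tpermD // eq_sym.
  have := tr p q pA qA pq i (col x).
  rewrite (bigID (mem (V i :\ x))) /= big1 ?add0r => [|y /andP[/eqP yx]]; last first.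
    by rewrite in_setD1 => /andP[ynx yV]; apply: other.
  under eq_bigr => y /andP[/eqP yx yV] do rewrite same //.
  rewrite sumr_const => /eqP; rewrite mulrn_eq0 => /orP[|/eqP//].
  by rewrite (cardD1 x) unfold_in /= eqxx !inE eqxx.
have ge4 x : col x = col (i c0) -> (0 < cnt A i x)%N -> (4 <= cnt A i x)%N.
  move=> colx; have := ev x; move: no2; rewrite negb_exists => /forallP/(_ x).
  by rewrite colx eqxx /=; case: (cnt A i x) => [|[|[|[|]]]].
set b0 := i c0 in cnt_c0 ge4 *; pose B := [set c in A | i c == b0].
have c0B : c0 \in B by rewrite !inE c0A /=.
have absent y : col y = col b0 -> y != b0 -> forall c, c \in A -> i c != y.
  move=> yb ynb c cA; apply: contraL (leqnn (cnt A i b0 + cnt A i y)) => /eqP icy.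
  rewrite -ltnNge.
  have : (0 < cnt A i y)%N by apply/card_gt0P; exists c; rewrite inE cA icy /=.
  move=> /(ge4 _ yb) y4; have b4 := ge4 b0 erefl cnt_c0.
  suff cA6 : (cnt A i b0 + cnt A i y <= #|A|)%N.
    exact: leq_ltn_trans cA6 (leq_ltn_trans A6 (leq_trans _ (leq_add b4 y4))).
  rewrite -cardsUI [X in (_ + X)%N]eq_card0 ?addn0 => [|c'].
    by apply: subset_leq_card; apply/fintype.subsetP => c'; rewrite !inE => /orP[]/andP[].
  rewrite !inE; case: (eqVneq (i c') y) => [->|_]; last by rewrite !andbF.
  by rewrite (negbTE ynb) !andbF.
(* The rotation in the plane of a and b0 is applied to i with slot c0 changed to a. No other slot
   holds a, so besides c0 only the slots holding b0 contribute. *)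
have rotE a : col a = col b0 -> a != b0 ->
    tau i = \sum_(c in B :\ c0) tau (upd2 c0 c i a).
  move=> ab anb; have := rot (upd1 c0 i a) a b0 anb ab.
  rewrite (bigD1 c0) //= ffunE eqxx eqxx.
  have -> : upd1 c0 (upd1 c0 i a) b0 = i.
    by apply/ffunP => c; rewrite !ffunE; case: eqP => [->|].
  move=> /eqP; rewrite addr_eq0 => /eqP->; rewrite -sumrN big_mkcond [RHS]big_mkcond /=.
  apply: eq_bigr => c _; rewrite !inE ffunE.
  case cA : (c \in A) => /=; last by rewrite andbF.
  case: (eqVneq c c0) => [//|cc0]; rewrite ?andbF //=.
  rewrite (negbTE (absent a ab anb c cA)); case: eqP => // _; rewrite ?oppr0 // opprK.
  congr tau; apply/ffunP => c'; rewrite !ffunE.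
  by case: (eqVneq c' c0) => [->|_]; rewrite ?(negbTE cc0) ?orbT //; case: eqP.
(* Summing [rotE] over a gives k copies of [tau i]; the traces over c0 and c turn the same sum into
   minus one copy for each c. So [k + #|B :\ c0|] copies vanish, and this number is at least 3. *)
pose k := #|[set a | (col a == col b0) && (a != b0)]|.
have e1 : \sum_(a | (col a == col b0) && (a != b0))
    \sum_(c in B :\ c0) tau (upd2 c0 c i a) = tau i *+ k.
  under eq_bigr => a /andP[/eqP ab anb] do rewrite -rotE //.
  by rewrite sumr_const /k cardsE.
have e2 : \sum_(a | (col a == col b0) && (a != b0))
    \sum_(c in B :\ c0) tau (upd2 c0 c i a) = - (tau i *+ #|B :\ c0|).
  rewrite exchange_big /= -sumr_const -sumrN; apply: eq_bigr => c.
  rewrite !inE => /and3P[cc0 cA /eqP icb].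
  have := tr c0 c c0A cA; rewrite eq_sym => /(_ cc0 i (col b0)).
  rewrite (bigD1 b0) //= => /eqP; rewrite addrC addr_eq0 => /eqP->; congr (- tau _).
  apply/ffunP => c'; rewrite ffunE.
  by case: (eqVneq c' c0) => [->|_] //=; case: eqP => [->|_].
have : tau i *+ (k + #|B :\ c0|) = 0 by rewrite mulrnDr -e1 e2 addNr.
move=> /eqP; rewrite mulrn_eq0 => /orP[|/eqP//].
rewrite addn_eq0 => /andP[_].
have := ge4 b0 erefl cnt_c0; rewrite /cnt -/B (cardsD1 c0) c0B.
by case: #|B :\ c0|.
Qed.

(** Contraction of p with q against [colmx], the projection onto the span of the basis vectors of
    colour true. *)
Definition wctr p q tau i : R := \sum_(x | col x) tau (upd2 p q i x).

Lemma upd2_id (p q : I) i x : (upd2 p q i x) p = x /\ (upd2 p q i x) q = x.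
Proof. by rewrite !ffunE !eqxx orbT. Qed.

(** For rotations, the relation of [tau] is summed over the shared index z of p and q. The slots
    outside p and q give the claim; the terms [s0] at p and q cancel, because the generator is
    antisymmetric and both slots carry the same z. *)
Lemma colour_invariant_wctr A tau p q : colour_invariant A tau ->
  p \in A -> q \in A -> p != q -> colour_invariant (A :\ p :\ q) (wctr p q tau).
Proof.
move=> [dep sgn prm rot] pA qA pq; have qp : q != p by rewrite eq_sym.
split.
- move=> i j ij; apply: eq_bigr => x _; apply: dep => c cA; rewrite !ffunE.
  by case: ifP => // /norP[cp cq]; apply: ij; rewrite !inE cp cq.
- move=> i x oddx; apply: big1 => y _; apply: (sgn _ x).
  by rewrite cnt_upd2 // oddD odd_double addbF.
- move=> i x y xy; rewrite /wctr (reindex_inj (@perm_inj _ (tperm x y))) /=.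
  apply: eq_big => z; first by case: tpermP => // ->.
  move=> _; rewrite -(prm (upd2 p q i z) x y) //; congr tau.
  by apply/ffunP => c; rewrite !ffunE; case: ifP.
move=> i x y xy cxy.
have : \sum_(z | col z) \sum_(c in A)
   (if upd2 p q i z c == x then tau (upd1 c (upd2 p q i z) y)
    else if upd2 p q i z c == y then - tau (upd1 c (upd2 p q i z) x) else 0) = 0.
  by apply: big1 => z _; apply: rot.
rewrite exchange_big (bigD1 p) //= (bigD1 q) ?qA //= addrA.
set s0 := (X in X + _ = 0); suff -> : s0 = 0.
  rewrite add0r => e; rewrite -[RHS]e; apply: eq_big => [c|c].
    by rewrite !inE; case: (c == p); case: (c == q); rewrite ?andbF ?andbT.
  rewrite !inE => /and3P[cq cp _].
  have ic z : upd2 p q i z c = i c by rewrite ffunE (negbTE cp) (negbTE cq).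
  have uC z w : upd1 c (upd2 p q i z) w = upd2 p q (upd1 c i w) z.
    apply/ffunP => e'; rewrite !ffunE.
    by case: (eqVneq e' c) => [->|//]; rewrite (negbTE cp) (negbTE cq).
  under [RHS]eq_bigr => z _ do rewrite ic !uC.
  by case: ifP => _; [|case: ifP => _; [rewrite sumrN|rewrite big1]].
rewrite /s0 -big_split /=.
case cx : (col x); last first.
  apply: big1 => z cz; rewrite !(upd2_id p q i z).1 !(upd2_id p q i z).2.
  have -> : z == x = false by apply: contraTF cz => /eqP->; rewrite cx.
  have -> : z == y = false by apply: contraTF cz => /eqP->; rewrite -cxy cx.
  by rewrite addr0.
rewrite (bigD1 x) //= (bigD1 y) /= -?cxy ?cx 1?eq_sym ?xy //= big1; last first.
  move=> z /andP[/andP[_ zx] zy].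
  rewrite !(upd2_id p q i z).1 !(upd2_id p q i z).2 (negbTE zx) (negbTE zy).
  by rewrite addr0.
rewrite !(upd2_id p q i _).1 !(upd2_id p q i _).2 !eqxx eq_sym (negbTE xy) addr0.
have -> : upd1 p (upd2 p q i x) y = upd1 q (upd2 p q i y) x.
  apply/ffunP => e; rewrite !ffunE.
  case: (eqVneq e p) => [->|ep] /=; first by rewrite (negbTE pq).
  by case: (eqVneq e q).
have -> : upd1 q (upd2 p q i x) y = upd1 p (upd2 p q i y) x.
  apply/ffunP => e; rewrite !ffunE.
  case: (eqVneq e p) => [->|ep] /=; first by rewrite (negbTE pq).
  by case: (eqVneq e q).
ring.
Qed.

Fixpoint flat (ps : seq (I * I)) : seq I :=
  if ps is pq :: ps' then [:: pq.1, pq.2 & flat ps'] else [::].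

Definition con (ps : seq (I * I)) tau :=
  foldr (fun pq s => wctr pq.1 pq.2 s) tau ps.

Lemma colour_invariant_con tau ps : colour_invariant [set: I] tau -> uniq (flat ps) ->
  colour_invariant [set c | c \notin flat ps] (con ps tau).
Proof.
move=> inv; elim: ps => [|[p q] ps IHps] /=.
  by move=> _; congr (colour_invariant _ tau): inv; apply/setP => c; rewrite !inE.
rewrite inE negb_or -andbA => /and4P[pq pps qps ups].
have -> : [set c | c \notin [:: p, q & flat ps]] =
   [set c | c \notin flat ps] :\ p :\ q.
  by apply/setP => c; rewrite !inE !negb_or; do 2![case: (_ == _)].
by apply: colour_invariant_wctr; rewrite ?inE //; apply: IHps.
Qed.

Lemma con_trace tau ps p q i : p \notin flat ps -> q \notin flat ps ->
  \sum_x con ps tau (upd2 p q i x) =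
  con ps (fun j => \sum_x tau (upd2 p q j x)) i.
Proof.
elim: ps i => [|[p' q'] ps IHps] i //=.
rewrite !inE !negb_or => /and3P[pp' pq' pps] /and3P[qp' qq' qps].
rewrite /wctr /= exchange_big /=; apply: eq_bigr => y _.
rewrite -IHps //; apply: eq_bigr => x _; congr (con ps tau _).
apply/ffunP => e; rewrite !ffunE.
case: (eqVneq e p') => [->|ep'] /=; first by rewrite eq_sym (negbTE pp') eq_sym (negbTE qp').
case: (eqVneq e q') => [->|//]; by rewrite eq_sym (negbTE pq') eq_sym (negbTE qq').
Qed.

Definition colmx : 'M[R]_n := \matrix_(x, y) ((x == y) && col x)%:R.

(** Once the pairs exhaust the slots, the condition on j is void and the right side is a complete
    contraction with [colmx]. *)
Lemma con_sum tau ps i : uniq (flat ps) ->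
  con ps tau i = \sum_(j : {ffun I -> 'I_n} | [forall c, (c \notin flat ps) ==> (j c == i c)])
     tau j * \prod_(pq <- ps) colmx (j pq.1) (j pq.2).
Proof.
elim: ps i => [|[p q] ps IHps] i.
  move=> _; rewrite (big_pred1 i) ?big_nil ?mulr1 // => j /=.
  apply/forallP/eqP => [ji|-> c]; last by rewrite eqxx.
  by apply/ffunP => c; apply/eqP; apply: ji.
rewrite [flat _]/= [uniq _]/= inE negb_or -andbA => /and4P[pq pps qps ups].
have -> : con ((p, q) :: ps) tau i = \sum_(x | col x) con ps tau (upd2 p q i x) by [].
under eq_bigr => x _ do rewrite IHps // big_mkcond.
rewrite exchange_big [RHS]big_mkcond /=; apply: eq_bigr => j _.
rewrite big_cons mxE /=.
have agreeE x : [forall c, (c \notin flat ps) ==> (j c == upd2 p q i x c)] =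
    [&& [forall c, (c \notin [:: p, q & flat ps]) ==> (j c == i c)], j p == x & j q == x].
  apply/forallP/and3P => [h|[/forallP h /eqP jp /eqP jq] c].
    split; first apply/forallP => c.
    - rewrite !inE !negb_or; apply/implyP => /and3P[cp cq cps].
      by have := h c; rewrite cps /= ffunE (negbTE cp) (negbTE cq).
    - by have := h p; rewrite pps /= ffunE eqxx.
    by have := h q; rewrite qps /= ffunE eqxx orbT.
  apply/implyP => cps; rewrite ffunE.
  case: (eqVneq c p) => [->|cp] /=; first by rewrite jp.
  case: (eqVneq c q) => [->|cq] /=; first by rewrite jq.
  by have := h c; rewrite !inE !negb_or cp cq cps.
under eq_bigr => x _ do rewrite agreeE.
case: ifP => agree; last by rewrite big1.
rewrite -big_mkcondr /= [LHS](eq_bigl (fun x => (x == j p) && ((j p == j q) && col (j p)))).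
  case: andP => jj; last by rewrite mul0r mulr0 big_pred0 // => x; rewrite andbF.
  by rewrite mul1r (big_pred1 (j p)) // => x; rewrite andbT.
move=> x /=; rewrite [j p == x]eq_sym [j q == x]eq_sym andbC.
by case: (eqVneq x (j p)) => [->|//]; rewrite !andTb andbC andbC.
Qed.

Lemma flat_nth (ps : seq (I * I)) z c : (c < size ps)%N ->
  nth z (flat ps) c.*2 = (nth (z, z) ps c).1 /\
  nth z (flat ps) c.*2.+1 = (nth (z, z) ps c).2.
Proof. by elim: ps c => [|[p q] ps IHps] [|c] //=; apply: IHps. Qed.

Lemma size_flat (ps : seq (I * I)) : size (flat ps) = (size ps).*2.
Proof. by elim: ps => //= pq ps ->; rewrite doubleS. Qed.

Lemma flat_matching t (ps : seq (I * I)) z : size ps = t -> uniq (flat ps) ->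
  #|I| = (t * 2)%N ->
  bijective (fun cb : 'I_t * bool =>
    if cb.2 then (nth (z, z) ps cb.1).2 else (nth (z, z) ps cb.1).1).
Proof.
move=> sz us cI; apply: inj_card_bij; last by rewrite card_prod card_ord card_bool cI.
have nthE (cb : 'I_t * bool) : (if cb.2 then (nth (z, z) ps cb.1).2 else
    (nth (z, z) ps cb.1).1) = nth z (flat ps) (cb.2 + cb.1.*2).
  by case: cb => c [] /=; have [] := @flat_nth ps z c; rewrite ?sz.
have lt (cb : 'I_t * bool) : (cb.2 + cb.1.*2 < size (flat ps))%N.
  by rewrite size_flat sz; case: cb => -[c ct] [] /=; lia.
move=> cb cb'; rewrite !nthE => /eqP; rewrite nth_uniq // => /eqP.
case: cb {lt} => -[c ct] b; case: cb' => -[c' ct'] b' /= e.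
have bb' : b = b' by move: e => /(congr1 odd); rewrite !oddD !odd_double !addbF !oddb.
by rewrite bb' in e *; congr pair; apply: val_inj => /=; lia.
Qed.

(* The first fundamental theorem for O(m) x O(n-m) in low degree, in dual form. *)
Lemma colour_invariant_ctr_eq0 t tau : (0 < t <= 3)%N -> #|I| = (t * 2)%N ->
  colour_invariant [set: I] tau ->
  (forall p q, p != q -> forall i, \sum_x tau (upd2 p q i x) = 0) ->
  (forall phi : 'I_t * bool -> I, bijective phi -> ctr phi colmx tau = 0) ->
  forall i, tau i = 0.
Proof.
move=> /andP[t_gt0 t3] cI inv tr ctr0.
(* Induction on the number k of pairs not yet contracted. For k = 0 this is a complete contraction,
   zero by hypothesis. Otherwise the trace over colour true vanishes by the case of one more pair
   and the full trace by tracelessness, hence also the trace over colour false, and the preceding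
   vanishing lemma applies to the remaining slots. *)
suff con0 k ps : (size ps + k)%N = t -> uniq (flat ps) -> forall i, con ps tau i = 0.
  exact: (con0 t [::]).
elim: k ps => [|k IHk] ps.
  rewrite addn0 => sz us i.
  have /card_gt0P[z _] : (0 < #|I|)%N by rewrite cI; lia.
  have phiB := flat_matching z sz us cI.
  rewrite con_sum // -[RHS](ctr0 _ phiB) /ctr big_mkcond /=; apply: eq_bigr => j _.
  have -> : [forall c, (c \notin flat ps) ==> (j c == i c)].
    apply/forallP => c; suff -> : c \in flat ps by [].
    have /subset_cardP : #|flat ps| = #|I| by rewrite (card_uniqP us) size_flat sz cI muln2.
    by move=> /(_ (subset_predT _)) ->.
  by rewrite (big_nth (z, z)) big_mkord sz.
rewrite addnS => sz us.
have cA : #|[set c | c \notin flat ps]| = k.+1.*2.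
  have := cardC (mem (flat ps)); rewrite (card_uniqP us) size_flat cI -sz => e.
  have -> : #|[set c | c \notin flat ps]| = #|[predC mem (flat ps)]|.
    by apply: eq_card => c; rewrite !inE.
  by move: e; set N := #|_|; lia.
apply: (@colour_invariant_traceless_eq0 [set c | c \notin flat ps]).
- exact: colour_invariant_con.
- by rewrite cA; lia.
- by rewrite cA; lia.
move=> p q; rewrite !inE => pps qps pq i b.
have W j : \sum_(x | col x) con ps tau (upd2 p q j x) = 0.
  apply: (IHk ((p, q) :: ps)); first by rewrite /= addSn.
  by rewrite /= inE negb_or pq pps qps us.
have all0 : \sum_x con ps tau (upd2 p q i x) = 0.
  rewrite con_trace //.
  have -> : (fun j => \sum_x tau (upd2 p q j x)) = fun=> 0.
    by apply: funext => j; apply: tr.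
  by elim: (ps) i => //= pq' ps' IH i; rewrite /wctr big1.
case: b; first by rewrite -[RHS](W i); apply: eq_bigl => x; rewrite eqb_id.
move: all0; rewrite (bigID col) /= W add0r => all0; rewrite -[RHS]all0.
by apply: eq_bigl => x; rewrite eqbF_neg.
Qed.

End Invariance.

(** Leibniz rule for the derivative at 0 of a product. *)
Lemma coef1_prod (R : comNzRingType) (I : finType) (F : I -> {poly R}) :
  (\prod_a F a)`_1 = \sum_a (F a)`_1 * \prod_(b | b != a) (F b)`_0.
Proof.
elim: index_enum (index_enum_uniq I) => [|x r IHr] /=.
  by rewrite !big_nil coef1.
case/andP=> xr ur; rewrite !big_cons coefM !big_ord_recl big_ord0 /= IHr //.
rewrite addr0 eqxx /= addrC coef0_prod; congr (_ * _ + _).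
  rewrite [RHS]big_mkcond big_seq [RHS]big_seq; apply: eq_bigr => b br.
  by case: eqVneq br xr => // -> ->.
rewrite mulr_sumr big_seq [RHS]big_seq; apply: eq_bigr => a ar.
rewrite big_cons; case: eqVneq ar xr => [-> -> //|_ _ _].
by rewrite mulrCA.
Qed.

Lemma poly_ext (R : numDomainType) (p q : {poly R}) :
  (forall u, p.[u] = q.[u]) -> p = q.
Proof.
move=> pq; apply/eqP; rewrite -subr_eq0; apply/eqP.
apply: (@roots_geq_poly_eq0 _ _ [seq k%:R | k <- iota 0 (size (p - q))]).
- by apply/allP => u _; rewrite rootE hornerD hornerN pq subrr.
- by rewrite map_inj_uniq ?iota_uniq //; apply: mulrIn; apply: oner_neq0.
- by rewrite size_map size_iota.
Qed.

(** * From invariance under O(m) x O(n - m) to colour invariance *)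

Section OrthogonalInvariance.
Variables (R : realType) (n : nat) (col : 'I_n -> bool) (d : nat).
Implicit Types (T : tensor R n d) (i : {ffun 'I_d -> 'I_n}).

Definition colour_preserving (g : 'M[R]_n) : Prop :=
  forall x y, col x != col y -> g x y = 0.

Lemma actT_monomial (g : 'M[R]_n) (c : 'I_n -> R) (f : 'I_n -> 'I_n) T i :
  (forall x y, g x y = c x * (y == f x)%:R) ->
  actT g T i = (\prod_a c (i a)) * T [ffun a => f (i a)].
Proof.
move=> gE; rewrite ffunE (bigD1 [ffun a => f (i a)]) //= [X in _ + X]big1.
  rewrite addr0; congr (_ * _); apply: eq_bigr => a _.
  by rewrite gE ffunE eqxx mulr1.
move=> j jf; have [a ja] : exists a, j a != f (i a).
  apply/existsP; apply: contra_neqT jf; rewrite negb_exists => /forallP ja.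
  by apply/ffunP => a; rewrite ffunE; apply/eqP; have := ja a; rewrite negbK.
by rewrite (bigD1 a) //= gE (negbTE ja) mulr0 !mul0r.
Qed.

Section Rotation.
Variables (x y : 'I_n) (xy : x != y).

Definition rgen (z w : 'I_n) : R :=
  ((z == x) && (w == y))%:R - ((z == y) && (w == x))%:R.

(** The rotation in the plane of x and y by the angle of tangent u. Up to one square root for each
    slot in this plane its action is polynomial in u, so the infinitesimal relation is read off a
    coefficient and nothing has to be differentiated. *)
Definition rotmx (u : R) : 'M[R]_n := \matrix_(z, w)
  (if (z == x) || (z == y) then ((z == w)%:R + u * rgen z w) / Num.sqrt (1 + u ^+ 2)
   else (z == w)%:R).

Lemma rotmx_orthogonal u : orthogonal_mx (rotmx u).
Proof.
have s_gt0 : 0 < 1 + u ^+ 2 by rewrite ltr_pwDl // sqr_ge0.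
set s := Num.sqrt (1 + u ^+ 2).
have ss : s * s = 1 + u ^+ 2 by rewrite -expr2 sqr_sqrtr ?ltW.
have s0 : s != 0 by rewrite gt_eqF // sqrtr_gt0.
apply/matrixP => z w; rewrite !mxE.
under eq_bigr => l _ do rewrite !mxE -/s /rgen.
rewrite (bigD1 x) //= (bigD1 y) 1?eq_sym //= !eqxx orbT.
rewrite (eq_bigr (fun l : 'I_n => (l == z)%:R * (l == w)%:R)); last first.
  by move=> l /andP[lx ly]; rewrite (negbTE lx) (negbTE ly).
have -> : \sum_(l | (l != x) && (l != y)) ((l == z)%:R * (l == w)%:R) =
    [&& z == w, z != x & z != y]%:R :> R.
  case: (boolP ((z != x) && (z != y))) => [zxy|zxy].
    rewrite (bigD1 z) //= eqxx mul1r big1 ?addr0 ?andbT // => l /andP[_ lz].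
    by rewrite (negbTE lz) mul0r.
  rewrite andbF big1 // => l lxy; case: eqVneq => [lz|_]; last by rewrite mul0r.
  by rewrite lz (negbTE zxy) in lxy.
have u0 : 1 + u ^+ 2 != 0 by rewrite gt_eqF.
have key (a b c e : R) : a * b + c * e = 1 + u ^+ 2 ->
    a / s * (b / s) + (c / s * (e / s) + 0) = 1.
  by move=> abce; rewrite addr0 !mulf_div ss -mulrDl abce divff.
have key0 (a b c e : R) : a * b + c * e = 0 ->
    a / s * (b / s) + (c / s * (e / s) + 0) = 0.
  by move=> abce; rewrite addr0 !mulf_div ss -mulrDl abce mul0r.
have yx : y == x = false by rewrite eq_sym (negbTE xy).
case: (eqVneq z x) => [?|zx]; [subst z|case: (eqVneq z y) => [?|zy]; [subst z|]];
  (case: (eqVneq w x) => [?|wx]; [subst w|case: (eqVneq w y) => [?|wy]; [subst w|]]);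
  rewrite ?eqxx ?yx ?(negbTE xy) ?andbF ?andbT /=;
  first [by apply: key; ring | by apply: key0; ring | by rewrite ?andbT; ring].
Qed.

(** The action of [rotmx (e * u)] with the square roots removed, as a polynomial in u; e = 1 and e =
    -1 are the two senses of rotation. *)
Definition rotpoly (e : R) T i : {poly R} :=
  \sum_j (T j)%:P * \prod_a ((i a == j a)%:R%:P + (e * rgen (i a) (j a)) *: 'X).

Lemma rotpoly_coef1 e T i : (rotpoly e T i)`_1 = e *
  \sum_a (if i a == x then T (upd1 a i y) else if i a == y then - T (upd1 a i x) else 0).
Proof.
rewrite /rotpoly coef_sum mulr_sumr.
under eq_bigr => j _.
  rewrite coefCM coef1_prod mulr_sumr.
  under eq_bigr => a _.
    rewrite coefD coefC coefZ coefX mulr1 add0r.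
    under eq_bigr => b _ do rewrite coefD coefC coefZ coefX mulr0 addr0.
    over.
  over.
rewrite exchange_big /=; apply: eq_bigr => a _.
transitivity (\sum_w e * rgen (i a) w * T (upd1 a i w)).
  rewrite [LHS](bigID (fun j : {ffun 'I_d -> 'I_n} => upd1 a i (j a) == j)) /=.
  rewrite [X in _ + X]big1 ?addr0 => [|j ij]; last first.
    have [b /andP[ba ib]] : exists b, (b != a) && (i b != j b).
      apply/existsP; apply: contraNT ij; rewrite negb_exists => /forallP h.
      apply/eqP/ffunP => b; rewrite ffunE; case: eqVneq => [->//|ba].
      by have := h b; rewrite ba negbK => /eqP.
    by rewrite (bigD1 b) //= (negbTE ib) mul0r !mulr0.
  rewrite (reindex_onto (upd1 a i) (fun j : {ffun 'I_d -> 'I_n} => j a)) /=; last first.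
    by move=> j /eqP.
  apply: eq_big => w; first by rewrite !ffunE !eqxx.
  move=> _; rewrite ffunE eqxx big1 ?mulr1 1?mulrC // => b ba.
  by rewrite ffunE (negbTE ba) eqxx.
case: (eqVneq (i a) x) => [iax|iax]; last case: (eqVneq (i a) y) => [iay|iay].
- rewrite (bigD1 y) //= /rgen iax !eqxx (negbTE xy) subr0 mulr1 big1 ?addr0 // => w wy.
  by rewrite (negbTE wy) subrr mulr0 mul0r.
- rewrite (bigD1 x) //= /rgen iay !eqxx [y == x]eq_sym (negbTE xy) sub0r big1 ?addr0 => [|w wx].
    by rewrite mulrN1 mulNr mulrN.
  by rewrite (negbTE wx) subrr mulr0 mul0r.
by rewrite big1 ?mulr0 // => w _; rewrite /rgen (negbTE iax) (negbTE iay) subrr mulr0 mul0r.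
Qed.

Lemma rotpolyE u e T i : (forall v, actT (rotmx v) T = T) ->
  (rotpoly e T i).[u] =
  Num.sqrt (1 + (e * u) ^+ 2) ^+ #|[set a | (i a == x) || (i a == y)]| * T i.
Proof.
move=> Tinv; rewrite /rotpoly horner_sum -{2}(Tinv (e * u)) ffunE mulr_sumr.
apply: eq_bigr => j _; rewrite hornerM hornerC horner_prod mulrC mulrA.
congr (_ * _); set s := Num.sqrt _.
have s0 : s != 0 by rewrite gt_eqF // sqrtr_gt0 ltr_pwDl // sqr_ge0.
rewrite -sum1_card -prodrXr [X in X * _]big_mkcond -big_split /=.
apply: eq_bigr => a _; rewrite !inE hornerD hornerC hornerZ hornerX mxE -/s.
case: ifP => ia; first by rewrite expr1 mulrCA divff // mulr1 mulrAC.
rewrite mul1r /rgen; move/negbT: ia; rewrite negb_or => /andP[ix iy].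
by rewrite (negbTE ix) (negbTE iy) subrr mulr0 mul0r addr0.
Qed.

End Rotation.

Lemma actT_colour_invariant T :
  (forall g, orthogonal_mx g -> colour_preserving g -> actT g T = T) ->
  colour_invariant col [set: 'I_d] T.
Proof.
move=> Tinv; split.
- by move=> i j ij; congr (T _); apply/ffunP => c; apply: ij; rewrite inE.
- move=> i x oddx.
  pose g : 'M[R]_n := \matrix_(y, z) ((-1) ^+ (y == x) * (z == y)%:R).
  have gE y z : g y z = (-1) ^+ (y == x) * (z == id y)%:R by rewrite mxE.
  have gO : orthogonal_mx g.
    apply/matrixP => y z; rewrite mxE (bigD1 y) //= big1 ?addr0.
      by rewrite !mxE eqxx mulr1 [z == y]eq_sym mulrA -expr2 sqrr_sign mul1r.
    by move=> l ly; rewrite !mxE [y == l]eq_sym (negbTE ly) mulr0 mul0r.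
  have gC : colour_preserving g.
    by move=> y z; rewrite mxE; case: (eqVneq z y) => [->|_]; rewrite ?eqxx ?mulr0.
  have := congr1 (fun S : tensor R n d => S i) (Tinv g gO gC).
  rewrite (actT_monomial _ _ gE).
  have -> : [ffun a => id (i a)] = i by apply/ffunP => a; rewrite ffunE.
  rewrite (_ : \prod_a _ = (-1) ^+ cnt [set: 'I_d] i x).
    rewrite -signr_odd oddx expr1 mulN1r => /eqP.
    by rewrite eq_sym -addr_eq0 -mulr2n mulrn_eq0 => /eqP.
  rewrite /cnt -sum1_card -prodrXr [RHS]big_mkcond /=; apply: eq_bigr => a _.
  by rewrite !inE /=; case: eqP.
- move=> i x y xy.
  pose g : 'M[R]_n := \matrix_(z, w) (w == tperm x y z)%:R.
  have gE z w : g z w = 1 * (w == tperm x y z)%:R by rewrite mxE mul1r.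
  have gO : orthogonal_mx g.
    apply/matrixP => z w; rewrite mxE (bigD1 (tperm x y z)) //= big1 ?addr0.
      by rewrite !mxE tpermK eqxx mul1r [z == w]eq_sym.
    move=> l lz; rewrite !mxE (_ : z == _ = false) ?mul0r //.
    by apply: contraNF lz => /eqP->; rewrite tpermK.
  have gC : colour_preserving g.
    move=> z w; rewrite mxE; case: (w =P tperm x y z) => // ->.
    by case: tpermP => [->|->|_ _]; rewrite ?xy eqxx.
  rewrite -[in RHS](Tinv g gO gC) (actT_monomial _ _ gE) big1 ?mul1r //.
move=> i x y xy cxy.
have rotinv v : actT (rotmx x y v) T = T.
  apply: Tinv; first exact: rotmx_orthogonal.
  move=> z w zw; rewrite mxE /rgen.
  have zw0 : z == w = false by apply: contraNF zw => /eqP->.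
  rewrite zw0; case: ifP => // zxy; rewrite add0r.
  have -> : (z == x) && (w == y) = false.
    by apply: contraNF zw => /andP[/eqP-> /eqP->]; rewrite cxy.
  have -> : (z == y) && (w == x) = false.
    by apply: contraNF zw => /andP[/eqP-> /eqP->]; rewrite cxy.
  by rewrite subrr mulr0 mul0r.
(* By [rotpolyE] the values depend on e only through its square, so e = 1 and e = -1 give the same
   polynomial; the linear coefficients are opposite, hence zero. *)
have := congr1 (fun p : {poly R} => p`_1)
  (@poly_ext R (rotpoly x y 1 T i) (rotpoly x y (-1) T i) _).
rewrite !rotpoly_coef1 // mul1r mulN1r => /(_ _)/eqP h.
have {h}/h : forall u, (rotpoly x y 1 T i).[u] = (rotpoly x y (-1) T i).[u].
  by move=> u; rewrite !rotpolyE // mulN1r sqrrN mul1r.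
rewrite -addr_eq0 -mulr2n mulrn_eq0 /= => /eqP h.
by rewrite -[RHS]h; apply: eq_bigl => a; rewrite inE.
Qed.

End OrthogonalInvariance.

(** A subspace of maximal dimension inside Q contains all of Q, since adjoining a further element of
    Q would enlarge it. This makes the Weyl module, given as a predicate, a [{vspace}]. *)
Lemma closed_vspace (K : fieldType) (V : vectType K) (Q : V -> Prop) :
  Q 0 -> (forall c x y, Q x -> Q y -> Q (c *: x + y)) ->
  exists M : {vspace V}, forall x, x \in M <-> Q x.
Proof.
move=> Q0 Qlin.
pose P d := `[< exists2 M : {vspace V}, forall x, x \in M -> Q x & \dim M = d >].
have exP : exists d, P d.
  exists 0%N; apply/asboolP; exists 0%VS; last by rewrite dimv0.
  by move=> x; rewrite memv0 => /eqP->.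
have leP d : P d -> (d <= \dim {: V})%N.
  by move=> /asboolP[M _ <-]; apply: dimvS; apply: subvf.
case: (ex_maxnP exP leP) => d /asboolP[M MQ dM] dmax.
exists M => x; split=> [/MQ //|Qx]; apply/negPn/negP => xM.
have : P (\dim (M + <[x]>)%VS).
  apply/asboolP; exists (M + <[x]>)%VS => // y /memv_addP[u uM [v /vlineP[c ->] ->]].
  by rewrite addrC; apply: Qlin => //; apply: MQ.
move=> /dmax; rewrite -dM leqNgt => /negP; apply.
rewrite (ltn_leqif (dimv_leqif_sup (addvSl M <[x]>))).
by apply: contra xM => /subvP/(_ x); apply; rewrite memvE addvSr.
Qed.

Section Riesz.
Variables (R : realType) (X : finType).
Local Notation V := {ffun X -> R^o}.

Definition dotT (x y : V) : R := \sum_i x i * y i.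

Lemma dotTC x y : dotT x y = dotT y x.
Proof. by apply: eq_bigr => i _; rewrite mulrC. Qed.

Lemma dotTDl x x' y : dotT (x + x') y = dotT x y + dotT x' y.
Proof. by rewrite -big_split; apply: eq_bigr => i _; rewrite ffunE mulrDl. Qed.

Lemma dotTZl c x y : dotT (c *: x) y = c * dotT x y.
Proof. by rewrite mulr_sumr; apply: eq_bigr => i _; rewrite ffunE mulrA. Qed.

Lemma dotTBl x x' y : dotT (x - x') y = dotT x y - dotT x' y.
Proof. by rewrite -scaleN1r dotTDl dotTZl mulN1r. Qed.

Lemma dotT_suml (J : finType) (F : J -> V) y :
  dotT (\sum_j F j) y = \sum_j dotT (F j) y.
Proof.
apply: (big_morph (fun x => dotT x y) (fun a b => dotTDl a b y)).
by rewrite /dotT big1 // => i _; rewrite ffunE mul0r.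
Qed.

Lemma dotT_sumr (J : finType) (F : J -> V) y :
  dotT y (\sum_j F j) = \sum_j dotT y (F j).
Proof. by rewrite dotTC dotT_suml; apply: eq_bigr => j _; rewrite dotTC. Qed.

Lemma dotT_eq0 x : dotT x x = 0 -> x = 0.
Proof.
move=> /eqP; rewrite psumr_eq0 => [/allP x0|i _]; last by rewrite -expr2 sqr_ge0.
apply/ffunP => i; have /implyP/(_ isT) := x0 i (mem_index_enum i).
by rewrite ffunE mulf_eq0 orbb => /eqP.
Qed.

(** The Gram matrix G of a basis of M is invertible because [dotT] is definite; the coordinates c of
    the representing vector solve the system with matrix G. *)
Lemma riesz (M : {vspace V}) (l : V -> R) :
  (forall c x y, x \in M -> y \in M -> l (c *: x + y) = c * l x + l y) ->
  exists2 t, t \in M & forall x, x \in M -> l x = dotT t x.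
Proof.
move=> llin; pose B := vbasis M; pose r := \dim M.
have BM (j : 'I_r) : B`_j \in M by apply: vbasis_mem; rewrite mem_nth ?size_tuple.
have l0 : l 0 = 0.
  by have := llin (-1) 0 0 (mem0v M) (mem0v M); rewrite scaler0 add0r mulN1r addNr.
have lsum (c : 'I_r -> R) : l (\sum_j c j *: B`_j) = \sum_j c j * l B`_j.
  have : (\sum_j c j *: B`_j \in M) /\ l (\sum_j c j *: B`_j) = \sum_j c j * l B`_j.
    elim/big_rec2: _ => [|j y x _ [xM lx]]; first by rewrite mem0v.
    by rewrite llin // lx memvD ?memvZ.
  by case.
pose G : 'M[R]_r := \matrix_(i, j) dotT B`_i B`_j.
have vker (v : 'rV[R]_r) : v *m G = 0 -> v = 0.
  move=> vG; pose w := \sum_j v 0 j *: B`_j.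
  have w0 : w = 0.
    apply: dotT_eq0; rewrite {2}/w dotT_sumr big1 // => j _.
    rewrite dotTC dotTZl dotTC; have /rowP/(_ j) := vG; rewrite [LHS]mxE [RHS]mxE => e.
    rewrite (_ : dotT w _ = 0) ?mulr0 // -[RHS]e dotT_suml.
    by apply: eq_bigr => l' _; rewrite dotTZl mxE.
  apply/rowP => j; rewrite [RHS]mxE.
  by have /freeP/(_ (fun j => v 0 j) w0 j) := basis_free (vbasisP M).
have Gunit : G \in unitmx.
  rewrite -row_free_unit -kermx_eq0; apply/eqP/row_matrixP => i; rewrite row0.
  by apply: vker; apply/sub_kermxP; apply: row_sub.
pose c : 'rV[R]_r := (\row_j l B`_j) *m invmx G.
exists (\sum_j c 0 j *: B`_j); first by apply: memv_suml => j _; rewrite memvZ.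
move=> x xM; rewrite (coord_vbasis xM) lsum dotT_sumr; apply: eq_bigr => j _.
rewrite [RHS]dotTC dotTZl dotTC; congr (_ * _).
have /rowP/(_ j) : c *m G = \row_j l B`_j by rewrite mulmxKV.
rewrite [LHS]mxE [RHS]mxE => <-; rewrite dotT_suml; apply: eq_bigr => i _.
by rewrite dotTZl [G _ _]mxE.
Qed.

End Riesz.

Section WeylModuleTheory.
Variables (R : realType) (n : nat).

Lemma dotT_actT d (g : 'M[R]_n) (x y : tensor R n d) :
  dotT (actT g x) y = dotT x (actT g^T y).
Proof.
rewrite /dotT; under eq_bigr => i _ do rewrite ffunE mulr_suml.
rewrite exchange_big; apply: eq_bigr => j _ /=; rewrite ffunE mulr_sumr.
apply: eq_bigr => i _; rewrite mulrA [x j * _]mulrC; congr (_ * _ * _).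
by apply: eq_bigr => a _; rewrite mxE.
Qed.

Lemma tracelessE d (T : tensor R n d) : traceless T ->
  forall p q, p != q -> forall i, \sum_l T (upd2 p q i l) = 0.
Proof. by []. Qed.

(** Summing over the contracted index leaves the entry of g^T g at (j p, j q), a Kronecker delta,
    and so a trace of T itself. *)
Lemma traceless_actT d (g : 'M[R]_n) (T : tensor R n d) : orthogonal_mx g ->
  traceless T -> traceless (actT g T).
Proof.
move=> gO Ttr p q pq i.
under eq_bigr => l _ do rewrite ffunE.
rewrite exchange_big /=.
pose rest (j : {ffun 'I_d -> 'I_n}) : R :=
  \prod_(a | (a != p) && (a != q)) g (i a) (j a).
transitivity (\sum_(j : {ffun 'I_d -> 'I_n} | j p == j q) rest j * T j).
  rewrite [RHS]big_mkcond; apply: eq_bigr => j _; rewrite -mulr_suml.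
  under eq_bigr => l _.
    rewrite (bigD1 p) //= (bigD1 q) 1?eq_sym //= !ffunE !eqxx orbT mulrA.
    rewrite (eq_bigr (fun a => g (i a) (j a))); last first.
      by move=> a /andP[ap aq]; rewrite ffunE (negbTE ap) (negbTE aq).
    rewrite -/(rest j).
    over.
  rewrite -mulr_suml; have /matrixP/(_ (j p) (j q)) := gO.
  rewrite !mxE => e; rewrite (_ : \sum_l _ = (j p == j q)%:R).
    by case: eqP; rewrite ?mul1r // !mul0r.
  by rewrite -e; apply: eq_bigr => l _; rewrite mxE.
have [z _|no] := pickP 'I_n; last by rewrite big1 // => j _; have := no (j p).
rewrite (sum_diag z) // big1 // => j _.
under eq_bigr => l _.
  rewrite (_ : rest (upd2 p q j l) = rest j); first over.
  by apply: eq_bigr => a /andP[ap aq]; rewrite ffunE (negbTE ap) (negbTE aq).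
by rewrite -mulr_sumr tracelessE ?mulr0.
Qed.

Lemma young_symmetrizer_lin la c (x y : tensor R n (sumn la)) :
  young_symmetrizer (c *: x + y) =
  c *: young_symmetrizer x + young_symmetrizer y.
Proof.
apply/ffunP => i; rewrite !ffunE /GRing.scale /= mulr_sumr -big_split.
apply: eq_bigr => p _ /=; rewrite mulr_sumr -big_split; apply: eq_bigr => q _ /=.
by rewrite !ffunE /GRing.scale /= mulrDr mulrCA.
Qed.

Lemma actT_young_symmetrizer la (g : 'M[R]_n) (T : tensor R n (sumn la)) :
  actT g (young_symmetrizer T) = young_symmetrizer (actT g T).
Proof.
apply/ffunP => i; rewrite !ffunE.
under eq_bigr => j _ do rewrite ffunE mulr_sumr.
rewrite exchange_big; apply: eq_bigr => p _ /=.
under eq_bigr => j _ do rewrite mulr_sumr.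
rewrite exchange_big; apply: eq_bigr => q _ /=.
rewrite ffunE mulr_sumr.
pose s := (p * q)%g.
rewrite (reindex (fun j : {ffun 'I_(sumn la) -> 'I_n} => [ffun a => j ((s^-1)%g a)])) /=.
  apply: eq_bigr => j _; rewrite mulrCA; congr (_ * (_ * _)).
    rewrite [LHS](reindex_inj (@perm_inj _ s)); apply: eq_bigr => a _ /=.
    by rewrite !ffunE permK /s permM.
  by congr (T _); apply/ffunP => a; rewrite !ffunE -(permM p q) permK.
apply: onW_bij; exists (fun j : {ffun 'I_(sumn la) -> 'I_n} => [ffun a => j (s a)]) => j;
  by apply/ffunP => a; rewrite !ffunE ?permK ?permKV.
Qed.

Lemma weyl_module_actT la (g : 'M[R]_n) (T : tensor R n (sumn la)) :
  orthogonal_mx g -> weyl_module T -> weyl_module (actT g T).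
Proof.
move=> gO [Ttr [T0 TE]]; split; first exact: traceless_actT.
by exists (actT g T0); rewrite TE actT_young_symmetrizer.
Qed.

Lemma weyl_module_lin la c (x y : tensor R n (sumn la)) :
  weyl_module x -> weyl_module y -> weyl_module (c *: x + y).
Proof.
move=> [xtr [x0 xE]] [ytr [y0 yE]]; split; last first.
  by exists (c *: x0 + y0); rewrite young_symmetrizer_lin xE yE.
move=> a b ab i; under eq_bigr => l _ do rewrite !ffunE /GRing.scale /=.
by rewrite big_split -mulr_sumr /= xtr // ytr // mulr0 addr0.
Qed.

Lemma weyl_module0 la : weyl_module (0 : tensor R n (sumn la)).
Proof.
split; first by move=> a b ab i; rewrite big1 // => l _; rewrite ffunE.
exists 0; apply/ffunP => i; rewrite !ffunE big1 // => p _.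
by rewrite big1 // => q _; rewrite ffunE mulr0.
Qed.

Lemma ctr_lin (I : finType) t (phi : 'I_t * bool -> I) (P : 'M[R]_n)
    c (x y : {ffun {ffun I -> 'I_n} -> R^o}) :
  ctr phi P (c *: x + y) = c * ctr phi P x + ctr phi P y.
Proof.
rewrite /ctr mulr_sumr -big_split; apply: eq_bigr => i _ /=.
by rewrite !ffunE /GRing.scale /= mulrDl mulrA.
Qed.

End WeylModuleTheory.

Lemma sumn_twice mu : sumn (twice mu) = (sumn mu * 2)%N.
Proof. by elim: mu => //= x mu; rewrite /twice => ->; rewrite mulnDl mulnC. Qed.

(** * Functions in H^(2mu) as combinations of contractions of the projection *)

Section ZonalFunctions.
Variables (R : realType) (n m : nat).

Let col (x : 'I_n) : bool := (x < m)%N.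
Let P0 : 'M[R]_n := colmx R col.
Let U0 : {vspace 'cV[R]_n} := fixsp P0.

Lemma colmx_proj : P0^T = P0 /\ P0 *m P0 = P0.
Proof.
split; apply/matrixP => x y; rewrite !mxE.
  by rewrite eq_sym; case: eqP => // ->.
rewrite (bigD1 x) //= big1 => [|z zx]; last by rewrite !mxE eq_sym (negbTE zx) mul0r.
by rewrite !mxE eqxx addr0; case: (col x); rewrite ?andbF ?mul1r ?mul0r.
Qed.

Lemma Gr_colmx : (m <= n)%N -> Gr m U0.
Proof.
move=> mn; have [PT PP] := colmx_proj.
apply/eqP; rewrite -(eqr_nat R) dim_projm (projm_eq (is_projm_fixsp PT PP)).
apply/eqP; rewrite /mxtrace (eq_bigr (fun x => (col x)%:R)); last first.
  by move=> x _; rewrite mxE eqxx.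
rewrite -natr_sum; congr _%:R.
under eq_bigr => x _ do rewrite -[nat_of_bool _]/(if x < m then 1 else 0)%N.
by rewrite -big_mkcond -(big_ord_widen n (fun=> 1%N) mn) sum1_card card_ord.
Qed.

(* By the Riesz representation on the Weyl module, evaluation at the standard
   subspace is a tensor fixed by its stabiliser O(m) x O(n - m); minus its
   projection on the span of the complete contractions it vanishes by
   [colour_invariant_ctr_eq0]. *)
Lemma H2_ctr mu (f : {vspace 'cV[R]_n} -> R) : (m <= n)%N -> (1 <= sumn mu <= 3)%N -> H2 m mu f ->
  exists2 T : tensor R n (sumn (twice mu)), weyl_module T &
  exists a : {ffun 'I_(sumn mu) * bool -> 'I_(sumn (twice mu))} -> R,
    forall U, Gr m U ->
      f U = \sum_(phi : {ffun 'I_(sumn mu) * bool -> 'I_(sumn (twice mu))} |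
               injectiveb phi) a phi * ctr phi (projm U) T.
Proof.
move=> mn mu13 [Phi [_ PhiL PhiE [T TW fE]]]; exists T => //.
set d := sumn (twice mu) in Phi PhiL PhiE T TW fE *.
pose bij phi := injectiveb (phi : {ffun 'I_(sumn mu) * bool -> 'I_d}).
have cardI : #|'I_d| = (sumn mu * 2)%N by rewrite card_ord /d sumn_twice.
have bijP phi : bij phi -> bijective phi.
  by move=> /injectiveP inj; apply: inj_card_bij; rewrite // cardI card_prod card_bool card_ord.
have [M MW] := closed_vspace (weyl_module0 R n (twice mu)) (@weyl_module_lin R n (twice mu)).
have GU0 := Gr_colmx mn.
have [PT PP] := colmx_proj.
have projU0 : projm U0 = P0 by apply: projm_eq; apply: is_projm_fixsp.
have [t tM tE] : exists2 t, t \in M & forall x, x \in M -> Phi x U0 = dotT t x.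
  by apply: riesz => c x y /MW xW /MW yW; apply: PhiL.
have ePhi (phi : {ffun 'I_(sumn mu) * bool -> 'I_d}) :
    exists e, e \in M /\ forall x, x \in M -> ctr phi P0 x = dotT e x.
  by have [|e eM eE] := @riesz _ _ M (ctr phi P0); [move=> *; apply: ctr_lin | exists e].
have /choice[e eP] := ePhi.
pose E := (\sum_(phi | bij phi) <[e phi]>)%VS.
have eE phi : bij phi -> e phi \in E by move=> b; rewrite memvE (sumv_sup phi).
(* t1 is the orthogonal projection of t onto the span E of the contractions, obtained by
   representing [dotT t] inside E. *)
have [t1 t1E t1P] : exists2 t1, t1 \in E & forall x, x \in E -> dotT t x = dotT t1 x.
  by apply: riesz => c x y _ _; rewrite dotTC dotTDl dotTZl ![dotT t _]dotTC.
have EM : (E <= M)%VS.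
  by apply/subv_sumP => phi _; rewrite -memvE; have [] := eP phi.
have t1M : t1 \in M by apply: subvP t1E.
have [vs vsE t1sum] := memv_sumP t1E.
have /choice[a aE] : forall phi, exists c, bij phi -> vs phi = c *: e phi.
  move=> phi; have [b|nb] := boolP (bij phi); last by exists 0 => b; case/negP: nb.
  by have /vlineP[c ->] := vsE phi b; exists c.
have dot_t1 x : dotT t1 x = \sum_(phi | bij phi) a phi * dotT (e phi) x.
  rewrite t1sum big_mkcond dotT_suml [RHS]big_mkcond; apply: eq_bigr => phi _.
  by case: ifP => [/aE->|_]; rewrite ?dotTZl // /dotT big1 // => i _; rewrite ffunE mul0r.
have P0g g : colour_preserving col g -> g *m P0 = P0 *m g.
  move=> gC; apply/matrixP => x y; rewrite !mxE (bigD1 y) //= [RHS](bigD1 x) //=.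
  rewrite !big1 ?addr0 => [|z zx|z zy]; rewrite !mxE ?eqxx /=.
  - case: (eqVneq (col x) (col y)) => [->|/gC->]; last by rewrite mul0r mulr0.
    by rewrite mulrC.
  - by rewrite eq_sym (negbTE zx) mul0r.
  - by rewrite (negbTE zy) mulr0.
have MactT g x : orthogonal_mx g -> x \in M -> actT g x \in M.
  by move=> gO /MW xW; apply/MW; apply: weyl_module_actT.
(* g fixes U0, hence the evaluation represented by t; and g commutes with P0, hence fixes every
   contraction with P0, and so t1. *)
have K_t1 g x : orthogonal_mx g -> colour_preserving col g -> x \in M ->
    dotT (t - t1) (actT g x) = dotT (t - t1) x.
  move=> gO gC xM; have gxM := MactT g x gO xM.
  rewrite !dotTBl; congr (_ - _); last first.
    rewrite !dot_t1; apply: eq_bigr => phi /bijP b; congr (_ * _).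
    rewrite -!(eP phi).2 // ctr_actT // -mulmxA -P0g // mulmxA.
    by rewrite gO mul1mx.
  have gU0 : actG g U0 = U0.
    apply: projm_inj; rewrite projm_actG // projU0 P0g // -mulmxA.
    by rewrite orthogonal_mxV // mulmx1.
  rewrite -!tE // -{1}gU0; apply: PhiE => //; exact/MW.
have tt1M : t - t1 \in M by apply: rpredB.
(* Agreement at U0 is enough: some h carries U to U0, and both sides are equivariant. *)
suff t0 : t = t1.
  exists a => U GU; have [h hO U0E] := Gr_transitive GU GU0.
  rewrite fE // -(PhiE h T hO TW U GU) -U0E tE; last by apply/MactT/MW.
  rewrite t0 dot_t1; apply: eq_bigr => phi /bijP b; congr (_ * _).
  rewrite -(eP phi).2 ?ctr_actT //; last by apply/MactT/MW.
  congr ctr; rewrite -projU0 U0E projm_actG // !mulmxA hO mul1mx -mulmxA.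
  by rewrite hO mulmx1.
apply/eqP; rewrite -subr_eq0; apply/eqP/ffunP => i; rewrite [RHS]ffunE.
apply: (@colour_invariant_ctr_eq0 _ _ _ col (sumn mu)) => //.
- apply: actT_colour_invariant => g gO gC; apply/eqP; rewrite -subr_eq0; apply/eqP.
  have gTO : orthogonal_mx g^T by rewrite /orthogonal_mx trmxK orthogonal_mxV.
  have gTC : colour_preserving col g^T by move=> x y xy; rewrite mxE gC // eq_sym.
  set w := _ - _; have wM : w \in M by rewrite rpredB ?MactT.
  apply: dotT_eq0; rewrite {1}/w dotTBl dotT_actT.
  by rewrite K_t1 // subrr.
- by have [] := (MW _).1 tt1M.
move=> phi phiB; pose phi' := [ffun cb => phi cb].
have b : bij phi'.
  by apply/injectiveP => x y; rewrite !ffunE; apply: bij_inj.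
have -> : ctr phi P0 (t - t1) = ctr phi' P0 (t - t1).
  by apply: eq_bigr => j _; congr (_ * _); apply: eq_bigr => c _; rewrite !ffunE.
by rewrite (eP phi').2 // dotTC dotTBl t1P ?eE // subrr.
Qed.

End ZonalFunctions.

Lemma F2P (x : 'F_2) : x = 0 \/ x = 1.
Proof. by case: x => [[|[|//]] ltx]; [left|right]; apply: val_inj. Qed.

Lemma F2_addxx (x : 'F_2) : x + x = 0.
Proof. by case: (F2P x) => ->; apply: val_inj. Qed.

Lemma F2_addvv (V : lmodType 'F_2) (v : V) : v + v = 0.
Proof.
by rewrite -mulr2n -scaler_nat (_ : 2%:R = 0 :> 'F_2) ?scale0r //; apply: val_inj.
Qed.

Lemma F2_oppv (V : lmodType 'F_2) (v : V) : - v = v.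
Proof. by apply/eqP; rewrite eq_sym -addr_eq0 F2_addvv. Qed.

(** * The extraspecial group and its common eigenspaces *)

Section Labels.
Variable k : nat.

Lemma odd_digits_inj j (a b : nat) : (a < 2 ^ j)%N -> (b < 2 ^ j)%N ->
  (forall l, (l < j)%N -> odd (a %/ 2 ^ l) = odd (b %/ 2 ^ l)) -> a = b.
Proof.
elim: j a b => [|j IHj] a b; first by rewrite !ltnS !leqn0 => /eqP-> /eqP->.
move=> la lb ab; rewrite -(odd_double_half a) -(odd_double_half b).
have := ab 0%N (ltn0Sn j); rewrite !divn1 => ->; congr (_ + _.*2)%N.
rewrite -!divn2; apply: IHj => [||l lj].
- by rewrite ltn_divLR // -expnSr.
- by rewrite ltn_divLR // -expnSr.
by have := ab l.+1 lj; rewrite expnS !divnMA.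
Qed.

Lemma label_inj : injective (@label k).
Proof.
move=> i j ij; apply: val_inj; apply: (@odd_digits_inj k) => //= l lk.
have /rowP/(_ (Ordinal lk)) := ij; rewrite !mxE /= => e.
have := congr1 (fun x : 'F_2 => x : nat) e.
by rewrite !val_Fp_nat // !modn2; do 2![case: odd].
Qed.

Lemma label_bij : bijective (@label k).
Proof.
by apply: inj_card_bij label_inj _; rewrite card_mx card_Fp // mul1n card_ord.
Qed.

Implicit Types a b : 'rV['F_2]_k.

Lemma dotF2C a b : dotF2 a b = dotF2 b a.
Proof. by apply: eq_bigr => j _; rewrite mulrC. Qed.

Lemma dotF2Dl a a' b : dotF2 (a + a') b = dotF2 a b + dotF2 a' b.
Proof. by rewrite -big_split; apply: eq_bigr => j _; rewrite mxE mulrDl. Qed.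

Lemma dotF2Dr a b b' : dotF2 a (b + b') = dotF2 a b + dotF2 a b'.
Proof. by rewrite dotF2C dotF2Dl ![dotF2 _ a]dotF2C. Qed.

Lemma dotF2_0l b : dotF2 0 b = 0.
Proof. by rewrite /dotF2 big1 // => j _; rewrite mxE mul0r. Qed.

Lemma dotF2_0r b : dotF2 b 0 = 0.
Proof. by rewrite dotF2C dotF2_0l. Qed.

Lemma dotF2_nondegenerate a : a != 0 -> exists b, dotF2 a b = 1.
Proof.
move=> a0; have [j aj] : exists j, a 0 j != 0.
  apply/existsP; apply: contra_neqT a0; rewrite negb_exists => /forallP h.
  by apply/rowP => j; rewrite mxE; apply/eqP; have := h j; rewrite negbK.
exists (delta_mx 0 j); rewrite /dotF2 (bigD1 j) //= mxE !eqxx mulr1 big1 ?addr0.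
  by case: (F2P (a 0 j)) aj => ->; rewrite ?eqxx.
by move=> l lj; rewrite mxE (negbTE lj) andbF mulr0.
Qed.

Variable R : realType.

Definition sg (x : 'F_2) : R := (-1) ^+ (x != 0).

Lemma sgD x y : sg (x + y) = sg x * sg y.
Proof.
by case: (F2P x) => ->; case: (F2P y) => ->; rewrite ?addr0 ?add0r ?F2_addxx /sg
  ?eqxx ?oner_eq0 /= ?expr0 ?expr1 ?mulrNN ?mulr1 ?mul1r.
Qed.

Lemma sg0 : sg 0 = 1. Proof. by rewrite /sg eqxx. Qed.
Lemma sg1 : sg 1 = -1. Proof. by rewrite /sg oner_eq0. Qed.

Lemma sg_sqr x : sg x * sg x = 1.
Proof. by rewrite -sgD F2_addxx sg0. Qed.

Lemma sg_sum b : \sum_a sg (dotF2 b a) = (2 ^ k)%:R * (b == 0)%:R.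
Proof.
case: eqVneq => [->|b0].
  under eq_bigr => a _ do rewrite dotF2_0l sg0.
  by rewrite sumr_const card_mx card_Fp // mul1n mulr1.
have [z bz] := dotF2_nondegenerate b0; rewrite mulr0.
have : \sum_a sg (dotF2 b a) = - \sum_a sg (dotF2 b a).
  rewrite {1}(reindex_inj (addrI z)) -sumrN; apply: eq_bigr => a _ /=.
  by rewrite dotF2Dr bz sgD sg1 mulN1r.
by move=> /eqP; rewrite -addr_eq0 -mulr2n mulrn_eq0 => /eqP.
Qed.

Definition gmx (v : F2k2 k) : 'M[R]_(2 ^ k) := Xmx R v.1 *m Ymx R v.2.

Lemma gmxE v i j :
  gmx v i j = (label i == label j + v.1)%:R * sg (dotF2 v.2 (label j)).
Proof.
rewrite mxE (bigD1 j) //= big1 ?addr0 => [|l lj]; rewrite !mxE ?eqxx ?mulr1 //.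
by rewrite (negbTE lj) !mulr0.
Qed.

Lemma gmxM u v : gmx u *m gmx v = sg (dotF2 u.2 v.1) *: gmx (u + v).
Proof.
apply/matrixP => i j; rewrite [LHS]mxE [RHS]mxE gmxE.
have [lab_inv _ labK] := label_bij.
set l0 := lab_inv (label j + v.1).
rewrite (bigD1 l0) //= big1 => [|l ll0].
  rewrite !gmxE labK eqxx mul1r addr0 dotF2Dr dotF2Dl !sgD /= addrA.
  rewrite [label j + u.1 + _]addrAC.
  by case: (_ == _); rewrite ?mul0r ?mulr0 // !mul1r; ring.
rewrite !gmxE (_ : label l == _ = false) ?mul0r ?mulr0 //.
by apply: contraNF ll0 => /eqP e; apply/eqP/label_inj; rewrite labK.
Qed.

(** The link between q and transposition: v is singular exactly when g_v is symmetric. It later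
    turns the indicator of q = 0 into a mean over transposing. *)
Lemma gmxT v : (gmx v)^T = sg (q v) *: gmx v.
Proof.
apply/matrixP => i j; rewrite [LHS]mxE [RHS]mxE !gmxE.
have -> : (label j == label i + v.1) = (label i == label j + v.1).
  by rewrite -subr_eq F2_oppv eq_sym.
case: eqP => [->|_]; last by rewrite !mul0r mulr0.
by rewrite dotF2Dr sgD !mul1r /q [dotF2 v.1 _]dotF2C mulrC.
Qed.

Lemma gmx0 : gmx 0 = 1%:M.
Proof.
apply/matrixP => i j.
by rewrite gmxE addr0 dotF2_0l sg0 mulr1 mxE (inj_eq label_inj).
Qed.

Lemma gmx_trace v : \tr (gmx v) = (2 ^ k)%:R * (v == 0)%:R.
Proof.
rewrite /mxtrace; under eq_bigr => i _ do rewrite gmxE -{1}[label i]addr0 (inj_eq (addrI _)) eq_sym.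
rewrite -mulr_sumr.
have -> : \sum_(i < 2 ^ k) sg (dotF2 v.2 (label i)) = \sum_a sg (dotF2 v.2 a).
  by rewrite [RHS](reindex (@label k)) //; apply: onW_bij; apply: label_bij.
rewrite sg_sum; case: v => a b /=; rewrite xpair_eqE mulrCA; congr (_ * _).
by do 2![case: (_ == _)]; rewrite ?mulr0 ?mulr1.
Qed.

(* This makes sums over quadrics collapse to products of Kronecker deltas. *)
Lemma gmx_complete i j i' j' :
  \sum_v gmx v i j * gmx v i' j' = (2 ^ k)%:R * ((i == i') && (j == j'))%:R.
Proof.
rewrite (eq_bigr (fun v : F2k2 k =>
  ((label i == label j + v.1)%:R * (label i' == label j' + v.1)%:R) *
   sg (dotF2 (label j + label j') v.2))); last first.
  by move=> v _; rewrite !gmxE dotF2Dl ![dotF2 (label _) _]dotF2C sgD; ring.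
rewrite -(pair_bigA _ (fun a b =>
  ((label i == label j + a)%:R * (label i' == label j' + a)%:R) *
   sg (dotF2 (label j + label j') b))) /=.
under eq_bigr => a _ do rewrite -mulr_sumr sg_sum.
rewrite -mulr_suml addr_eq0 F2_oppv (inj_eq label_inj).
case: eqVneq => [<-|_]; last by rewrite andbF !mulr0.
rewrite andbT mulr1 mulrC; congr (_ * _).
rewrite (bigD1 (label i - label j)) //= big1 ?addr0 => [|a aij].
  by rewrite addrC subrK eqxx mul1r eq_sym (inj_eq label_inj).
rewrite (_ : label i == _ = false) ?mul0r //.
by apply: contraNF aij => /eqP->; rewrite addrC addKr.
Qed.

End Labels.

Section Eigenspaces.
Variables (R : realType) (k : nat).
Implicit Types (S : {vspace F2k2 k}) (u v : F2k2 k) (psi : {ffun F2k2 k -> bool}).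
Local Notation n := (2 ^ k)%N.

(* The joint eigenvalue systems of the g_v = X(a)Y(b), v = (a, b) in S: since
   g_u g_v = (-1)^(u.2 * v.1) g_(u + v), these are twisted characters of S.
   They are extended by [false] outside S. *)
Definition characters S : {set {ffun F2k2 k -> bool}} :=
  [set psi : {ffun F2k2 k -> bool} | [forall u, (u \notin S) ==> ~~ psi u] &&
    [forall u, forall v, (u \in S) && (v \in S) ==>
       (psi (u + v) == psi u (+) psi v (+) (dotF2 u.2 v.1 != 0))]].

Definition ch psi v : R := (-1) ^+ psi v.

Definition Prj S psi : 'M[R]_n :=
  (#|S|%:R)^-1 *: \sum_(v in S) ch psi v *: gmx R v.

Lemma chM S psi u v : psi \in characters S -> u \in S -> v \in S ->
  ch psi (u + v) = ch psi u * ch psi v * sg R (dotF2 u.2 v.1).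
Proof.
rewrite inE => /andP[_ /forallP/(_ u)/forallP/(_ v)] + uS vS.
by rewrite uS vS /= => /eqP; rewrite /ch /sg => ->; rewrite !signr_addb.
Qed.

Lemma ch_out S psi v : psi \in characters S -> v \notin S -> psi v = false.
Proof. by rewrite inE => /andP[/forallP/(_ v)/implyP h _] /h/negbTE. Qed.

Lemma ch_sqr psi v : ch psi v * ch psi v = 1.
Proof. by rewrite /ch -expr2 sqrr_sign. Qed.

Lemma ch_inj psi psi' v : ch psi v = ch psi' v -> psi v = psi' v.
Proof. by rewrite /ch; apply: signr_inj. Qed.

Lemma ch0 S psi : psi \in characters S -> ch psi 0 = 1.
Proof.
move=> psiS; have := chM psiS (mem0v S) (mem0v S).
by rewrite addr0 ch_sqr dotF2_0l sg0 mulr1.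
Qed.

Lemma card_S_gt0 S : (0 < #|S|)%N.
Proof. by apply/card_gt0P; exists 0; apply: mem0v. Qed.

Lemma card_S_neq0 S : #|S|%:R != 0 :> R.
Proof. by rewrite pnatr_eq0 -lt0n card_S_gt0. Qed.

Lemma card_SE S : #|S| = (2 ^ \dim S)%N.
Proof. by rewrite card_vspace card_Fp. Qed.

Lemma gmx_Prj S psi u : psi \in characters S -> u \in S ->
  gmx R u *m Prj S psi = ch psi u *: Prj S psi.
Proof.
move=> psiS uS; rewrite /Prj -scalemxAr scalerA mulrC -scalerA; congr (_ *: _).
rewrite mulmx_sumr scaler_sumr [RHS](reindex_inj (addrI u)) /=.
apply: eq_big => [v|v vS]; first by rewrite rpredDl.
rewrite -scalemxAr gmxM !scalerA (chM psiS) // !mulrA ch_sqr mul1r.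
by [].
Qed.

Lemma Prj_idem S psi : psi \in characters S -> Prj S psi *m Prj S psi = Prj S psi.
Proof.
move=> psiS; rewrite {1}/Prj -scalemxAl mulmx_suml.
under eq_bigr => v vS do rewrite -scalemxAl (gmx_Prj psiS) // scalerA ch_sqr scale1r.
by rewrite sumr_const -scaler_nat scalerA mulVf ?scale1r // card_S_neq0.
Qed.

Lemma tiP S v : totally_isotropic S -> v \in S -> q v = 0.
Proof. by move=> /forallP/(_ v)/implyP h /h/eqP. Qed.

Lemma gmx_sym S v : totally_isotropic S -> v \in S -> (gmx R v)^T = gmx R v.
Proof. by move=> tS vS; rewrite gmxT (tiP tS vS) sg0 scale1r. Qed.

Lemma Prj_sym S psi : totally_isotropic S -> (Prj S psi)^T = Prj S psi.
Proof.
move=> tS; apply/matrixP => i j; rewrite mxE [LHS]mxE [RHS]mxE !summxE.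
congr (_ * _); apply: eq_bigr => v vS; rewrite [LHS]mxE [RHS]mxE.
by rewrite -{1}(gmx_sym tS vS) [(gmx R v)^T _ _]mxE.
Qed.

Lemma Prj_gmx S psi u : totally_isotropic S -> psi \in characters S -> u \in S ->
  Prj S psi *m gmx R u = ch psi u *: Prj S psi.
Proof.
move=> tS psiS uS; rewrite -(Prj_sym psi tS) -{1}(gmx_sym tS uS) -trmx_mul gmx_Prj //.
by apply/matrixP => i j; rewrite !mxE.
Qed.

Lemma gmx_dot u v : \sum_i \sum_j gmx R u i j * gmx R v i j = n%:R * (u == v)%:R.
Proof.
transitivity (\tr ((gmx R u)^T *m gmx R v)).
  rewrite exchange_big /mxtrace; apply: eq_bigr => j _; rewrite [RHS]mxE.
  by apply: eq_bigr => i _; rewrite [(gmx R u)^T _ _]mxE.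
rewrite gmxT -scalemxAl gmxM scalerA linearZ /= gmx_trace addr_eq0.
have -> : - v = v by case: v => a b; congr pair; apply: F2_oppv.
case: eqVneq => [->|_]; last by rewrite !mulr0.
by rewrite /q dotF2C sg_sqr mul1r.
Qed.

Lemma Prj_dot S psi v : \sum_i \sum_j gmx R v i j * Prj S psi i j =
  (#|S|%:R)^-1 * n%:R * (if v \in S then ch psi v else 0).
Proof.
transitivity (\sum_(u in S) (#|S|%:R)^-1 * ch psi u * (n%:R * (v == u)%:R)).
  under [RHS]eq_bigr => u _ do rewrite -gmx_dot mulr_sumr.
  rewrite [RHS]exchange_big; apply: eq_bigr => i _ /=.
  under [RHS]eq_bigr => u _ do rewrite mulr_sumr.
  rewrite [RHS]exchange_big; apply: eq_bigr => j _ /=.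
  rewrite [Prj _ _ _ _]mxE summxE !mulr_sumr; apply: eq_bigr => u _.
  by rewrite [(ch psi u *: gmx R u) _ _]mxE; ring.
case: ifP => vS; last first.
  rewrite mulr0 big1 // => u uS; case: eqVneq => [vu|_]; last by rewrite !mulr0.
  by rewrite vu uS in vS.
rewrite (bigD1 v) //= eqxx mulr1 big1 ?addr0 => [|u /andP[_ uv]].
  by rewrite mulrAC.
by rewrite eq_sym (negbTE uv) !mulr0.
Qed.

(** By [Prj_dot] the pairing with g_v is nonzero exactly for v in S, and its sign is then psi v.
    Hence no point of D_Sigma is counted twice. *)
Lemma Prj_inj S S' psi psi' : psi \in characters S -> psi' \in characters S' ->
  Prj S psi = Prj S' psi' -> S = S' /\ psi = psi'.
Proof.
move=> psiS psiS' e.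
have n0 : n%:R != 0 :> R by rewrite pnatr_eq0 expn_eq0.
have e' v : (#|S|%:R)^-1 * n%:R * (if v \in S then ch psi v else 0) =
    (#|S'|%:R)^-1 * n%:R * (if v \in S' then ch psi' v else 0).
  by rewrite -!Prj_dot e.
have ne0 (T : {vspace F2k2 k}) : (#|T|%:R)^-1 * n%:R != 0 :> R.
  by rewrite mulf_neq0 ?invr_eq0 ?card_S_neq0.
have memE (T : {vspace F2k2 k}) chi v :
    (v \in T) = ((#|T|%:R)^-1 * n%:R * (if v \in T then ch chi v else 0) != 0).
  rewrite mulf_eq0 (negbTE (ne0 T)) /=; case: ifP => _; last by rewrite eqxx.
  by rewrite signr_eq0.
have SS' : S = S' by apply/vspaceP => v; rewrite (memE S psi) e' -memE.
subst S'; split=> //; apply/ffunP => v.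
have [vS|vS] := boolP (v \in S); last by rewrite !(@ch_out S).
by apply: ch_inj; have := e' v; rewrite vS => /(mulfI (ne0 S)).
Qed.

Lemma Prj_orth S psi psi' : totally_isotropic S ->
  psi \in characters S -> psi' \in characters S -> psi != psi' ->
  Prj S psi *m Prj S psi' = 0.
Proof.
move=> tS psiS psiS' ne.
have [v vne] : exists v, psi v != psi' v.
  apply/existsP; apply: contra_neqT ne; rewrite negb_exists => /forallP h.
  by apply/ffunP => v; apply/eqP; have := h v; rewrite negbK.
have vS : v \in S by apply: contraNT vne => vS; rewrite !(@ch_out S).
have : ch psi v *: (Prj S psi *m Prj S psi') = ch psi' v *: (Prj S psi *m Prj S psi').
  by rewrite scalemxAl -Prj_gmx // -mulmxA gmx_Prj // scalemxAr.
move=> /eqP; rewrite -subr_eq0 -scalerBl scaler_eq0 => /orP[|/eqP//].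
by rewrite subr_eq0 => /eqP/ch_inj/eqP; rewrite (negbTE vne).
Qed.

(** For v != 0 some linear functional l takes the value 1 at v. Adding l permutes the twisted
    characters of S and changes the sign of [ch psi v]. *)
Lemma sum_ch S v : v \in S ->
  \sum_(psi in characters S) ch psi v = #|characters S|%:R * (v == 0)%:R.
Proof.
move=> vS; case: eqVneq => [->|v0].
  under eq_bigr => psi psiS do rewrite (ch0 psiS).
  by rewrite sumr_const mulr1.
rewrite mulr0.
have [z zv] : exists z : F2k2 k, dotF2 z.1 v.1 + dotF2 z.2 v.2 = 1.
  move: v0; case: (v) => a b; rewrite xpair_eqE negb_and.
  case/orP=> [/dotF2_nondegenerate[z az]|/dotF2_nondegenerate[z bz]].
    by exists (z, 0); rewrite /= dotF2_0l addr0 dotF2C.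
  by exists (0, z); rewrite /= dotF2_0l add0r dotF2C.
pose l u := (dotF2 z.1 u.1 + dotF2 z.2 u.2 != 0).
have lD u w : l (u + w) = l u (+) l w.
  rewrite /l /= !dotF2Dr addrACA.
  case: (F2P (dotF2 z.1 u.1 + dotF2 z.2 u.2)) => ->;
  case: (F2P (dotF2 z.1 w.1 + dotF2 z.2 w.2)) => ->; by
    rewrite ?addr0 ?add0r ?F2_addxx ?eqxx ?oner_eq0.
pose tw psi := [ffun u => psi u (+) ((u \in S) && l u)] : {ffun F2k2 k -> bool}.
have twK : involutive tw.
  by move=> psi; apply/ffunP => u; rewrite !ffunE -addbA addbb addbF.
have twS psi : psi \in characters S -> tw psi \in characters S.
  move=> psiS; have := psiS; rewrite !inE => /andP[/forallP h1 /forallP h2].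
  apply/andP; split; apply/forallP => u.
    by apply/implyP => uS; rewrite ffunE (ch_out psiS uS) (negbTE uS).
  apply/forallP => w; apply/implyP => /andP[uS wS]; rewrite !ffunE.
  have := h2 u => /forallP/(_ w); rewrite uS wS /= => /eqP->.
  rewrite memvD // lD /=.
  by case: (psi u); case: (psi w); case: (l u); case: (l w); case: (dotF2 u.2 w.1 != 0).
have twSE psi : (tw psi \in characters S) = (psi \in characters S).
  by apply/idP/idP => [/twS|/twS//]; rewrite twK.
have : \sum_(psi in characters S) ch psi v = - \sum_(psi in characters S) ch psi v.
  rewrite {1}(reindex_inj (inv_inj twK)) -sumrN; apply: eq_big => // psi _.
  by rewrite /ch ffunE vS /l zv oner_eq0 signr_addb mulrN1.
by move=> /eqP; rewrite -addr_eq0 -mulr2n mulrn_eq0 => /eqP.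
Qed.

(** Isotropy gives g_v g_v = 1, so each eigenvalue is 1 or -1, and the product rule for the g_v is
    the twisted character relation. *)
Lemma eigenvector_character S (x : 'cV[R]_n) : totally_isotropic S -> x != 0 ->
  (forall v, v \in S -> exists c, gmx R v *m x = c *: x) ->
  exists2 psi, psi \in characters S &
    forall v, v \in S -> gmx R v *m x = ch psi v *: x.
Proof.
move=> tS x0 xE.
pose psi := [ffun v => (v \in S) && (gmx R v *m x == - x)] : {ffun F2k2 k -> bool}.
have xI (a b : R) : a *: x = b *: x -> a = b.
  move=> /eqP; rewrite -subr_eq0 -scalerBl scaler_eq0 (negbTE x0) orbF subr_eq0.
  by move/eqP.
have psiE v : v \in S -> gmx R v *m x = ch psi v *: x.
  move=> vS; have [c cE] := xE v vS; rewrite /ch ffunE vS /=.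
  case: eqP => [->|ne]; first by rewrite scaleN1r.
  have : gmx R v *m (gmx R v *m x) = x.
    rewrite mulmxA gmxM -[dotF2 _ _]dotF2C -[dotF2 _ _]/(q v) (tiP tS vS) sg0 scale1r.
    rewrite (_ : v + v = 0) ?gmx0 ?mul1mx //.
    by case: (v) => a b; congr pair; apply: F2_addvv.
  rewrite !cE -scalemxAr cE scalerA -[RHS]scale1r => /xI/eqP.
  rewrite -expr2 sqrf_eq1 => /orP[/eqP->//|/eqP c1].
  by case: ne; rewrite cE c1 scaleN1r.
exists psi => //; rewrite inE; apply/andP; split; apply/forallP => u.
  by apply/implyP => uS; rewrite ffunE (negbTE uS).
apply/forallP => v; apply/implyP => /andP[uS vS].
rewrite -(inj_eq (@signr_inj R)) !signr_addb -!/(ch _ _) -/(sg R _); apply/eqP/xI.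
rewrite -psiE ?memvD // -[gmx R (u + v)]scale1r -(sg_sqr R (dotF2 u.2 v.1)).
rewrite -scalerA -gmxM -scalemxAl -mulmxA psiE // -scalemxAr psiE // !scalerA.
by congr (_ *: _); ring.
Qed.

Lemma gmx_comm S u v : totally_isotropic S -> u \in S -> v \in S ->
  gmx R u *m gmx R v = gmx R v *m gmx R u.
Proof.
move=> tS uS vS; rewrite !gmxM addrC; congr (sg R _ *: _).
have := tiP tS (memvD uS vS); rewrite /q /= dotF2Dl !dotF2Dr.
rewrite -/(q u) -/(q v) (tiP tS uS) (tiP tS vS) add0r addr0.
rewrite [dotF2 u.2 _]dotF2C [dotF2 v.2 _]dotF2C.
by case: (F2P (dotF2 u.1 v.2)) => ->; case: (F2P (dotF2 v.1 u.2)) => ->.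
Qed.

(** A common eigenvector is built one v at a time: g_v x + x is fixed by g_v, and if it is zero then
    x already has eigenvalue -1. Commutation preserves the earlier eigenvalues. *)
Lemma characters_neq0 S : totally_isotropic S -> (0 < #|characters S|)%N.
Proof.
move=> tS.
have [x x0 xE] : exists2 x : 'cV[R]_n, x != 0 &
    forall v, v \in enum S -> exists c, gmx R v *m x = c *: x.
  have : {subset enum S <= S} by move=> v; rewrite mem_enum.
  elim: (enum S) => [_|v l IHl vlS].
    exists (const_mx 1) => //; apply/eqP => /colP/(_ (Ordinal (expn_gt0 2 k))).
    by move/eqP; rewrite !mxE oner_eq0.
  have [w wl|x x0 xE] := IHl; first by apply: vlS; rewrite inE wl orbT.
  have vS : v \in S by apply: vlS; rewrite mem_head.
  have [e|ne] := eqVneq (gmx R v *m x + x) 0.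
    exists x => // w; rewrite inE => /orP[/eqP->|/xE//].
    by exists (-1); apply/eqP; rewrite scaleN1r -addr_eq0 e.
  exists (gmx R v *m x + x) => // w; rewrite inE => /orP[/eqP->|wl].
    exists 1; rewrite scale1r mulmxDr mulmxA gmxM.
    rewrite [dotF2 _ _]dotF2C -/(q v) (tiP tS vS) sg0 scale1r.
    rewrite (_ : v + v = 0) ?gmx0 ?mul1mx 1?addrC //.
    by case: (v) => a b; congr pair; apply: F2_addvv.
  have [c cE] := xE w wl; exists c.
  have wS : w \in S by apply: vlS; rewrite inE wl orbT.
  by rewrite mulmxDr mulmxA (gmx_comm tS wS vS) -mulmxA cE -scalemxAr scalerDr.
have [|psi psiS _] := @eigenvector_character S x tS x0.
  by move=> v vS; apply: xE; rewrite mem_enum.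
by apply/card_gt0P; exists psi.
Qed.

(** The sum Q of the pairwise orthogonal projections is idempotent. By [sum_ch] it is also the
    scalar c, the quotient of the two cardinals, so c = c * c, and c != 0 gives c = 1. *)
Lemma card_characters S : totally_isotropic S -> #|characters S| = #|S|.
Proof.
move=> tS; pose Q := \sum_(psi in characters S) Prj S psi.
pose c : R := #|characters S|%:R / #|S|%:R.
have Q1 : Q = c%:M.
  rewrite /Q /Prj -scaler_sumr exchange_big /= (bigD1 (0 : F2k2 k)); last exact: mem0v.
  rewrite /= [X in _ + X]big1 => [|v /andP[vS v0]].
    rewrite -scaler_suml sum_ch ?mem0v // eqxx mulr1 gmx0 addr0 scalerA.
    by rewrite scalemx1 mulrC.
  by rewrite -scaler_suml sum_ch // (negbTE v0) mulr0 scale0r.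
have QQ : Q *m Q = Q.
  rewrite {1}/Q mulmx_suml; apply: eq_bigr => psi psiS.
  rewrite mulmx_sumr (bigD1 psi) //= Prj_idem // big1 ?addr0 // => psi' /andP[psiS' ne].
  by rewrite Prj_orth // eq_sym.
have c0 : c != 0.
  by rewrite mulf_neq0 ?invr_eq0 ?card_S_neq0 // pnatr_eq0 -lt0n characters_neq0.
have : c * c = c.
  move: QQ; rewrite Q1 -scalar_mxM => /matrixP/(_ (Ordinal (expn_gt0 2 k)) (Ordinal (expn_gt0 2 k))).
  by rewrite !mxE eqxx.
move/(canRL (mulfK c0)); rewrite divff // => /(canRL (divfK (card_S_neq0 S))).
by rewrite mul1r => /eqP; rewrite eqr_nat => /eqP.
Qed.

End Eigenspaces.

(** * The members of D_Sigma, indexed by pairs (S, psi) *)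

Section DesignPoints.
Variables (R : realType) (k : nat).
Implicit Types (S : {vspace F2k2 k}) (psi : {ffun F2k2 k -> bool}).
Local Notation n := (2 ^ k)%N.

Lemma Prj_trace S psi : psi \in characters S -> \tr (Prj R S psi) = n%:R / #|S|%:R.
Proof.
move=> psiS; rewrite linearZ /= raddf_sum /= (bigD1 (0 : F2k2 k)); last exact: mem0v.
rewrite /= [X in _ + X]big1 => [|v /andP[_ v0]].
  by rewrite linearZ /= gmx_trace eqxx (ch0 _ psiS) mul1r mulr1 addr0 mulrC.
by rewrite linearZ /= gmx_trace (negbTE v0) !mulr0.
Qed.

Definition Wsp S psi : {vspace 'cV[R]_n} := fixsp (Prj R S psi).

Lemma is_projm_Wsp S psi : totally_isotropic S -> psi \in characters S ->
  is_projm (Wsp S psi) (Prj R S psi).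
Proof. by move=> tS psiS; apply: is_projm_fixsp; [apply: Prj_sym|apply: Prj_idem]. Qed.

Lemma projm_Wsp S psi : totally_isotropic S -> psi \in characters S ->
  projm (Wsp S psi) = Prj R S psi.
Proof. by move=> tS psiS; apply: projm_eq; apply: is_projm_Wsp. Qed.

Lemma dim_Wsp S psi s : (s <= k)%N -> totally_isotropic S -> psi \in characters S ->
  \dim S = (k - s)%N -> \dim (Wsp S psi) = (2 ^ s)%N.
Proof.
move=> sk tS psiS dS; apply/eqP; rewrite -(eqr_nat R) dim_projm projm_Wsp //.
rewrite Prj_trace // card_SE dS -[X in (2 ^ X)%:R / _](subnKC sk) expnD natrM.
by rewrite mulfK // pnatr_eq0 expn_eq0.
Qed.

Lemma mem_Wsp S psi (x : 'cV[R]_n) : totally_isotropic S -> psi \in characters S ->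
  x \in Wsp S psi <-> forall v, v \in S -> gmx R v *m x = ch R psi v *: x.
Proof.
move=> tS psiS; have [_ _ ->] := is_projm_Wsp tS psiS; split.
  by move=> /eqP xE v vS; rewrite -{1}xE mulmxA gmx_Prj // -scalemxAl xE.
move=> xE; rewrite /Prj -scalemxAl mulmx_suml.
under eq_bigr => v vS do rewrite -scalemxAl xE // scalerA ch_sqr scale1r.
by rewrite sumr_const -scaler_nat scalerA mulVf ?scale1r // card_S_neq0.
Qed.

Lemma DS_characters S (W : {vspace 'cV[R]_n}) : totally_isotropic S ->
  DS S W <-> exists2 psi, psi \in characters S & W = Wsp S psi.
Proof.
move=> tS; split=> [[W0 [chi WE]]|[psi psiS ->]].
  (* A nonzero vector x of W determines psi, and comparing eigenvalues on x identifies [chi] with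
     psi. *)
  pose x := vpick W; have x0 : x != 0 by rewrite vpick0; apply/eqP.
  have xW : x \in W by apply: memv_pick.
  have preg v : v \in S -> preimE S (gmx R v).
    by move=> vS; exists false, v; rewrite expr0 scale1r.
  have [|psi psiS psiE] := @eigenvector_character R k S x tS x0.
    by move=> v vS; exists (chi (gmx R v)); have /WE := xW; apply; apply: preg.
  exists psi => //; apply/vspaceP => y; apply/idP/idP => [yW|].
    apply/(mem_Wsp _ tS psiS) => v vS; have /WE-> := yW; last exact: preg.
    congr (_ *: _); apply/eqP; rewrite -subr_eq0.
    have /WE/(_ _ (preg v vS))/eqP := xW.
    by rewrite psiE // eq_sym -subr_eq0 -scalerBl scaler_eq0 (negbTE x0) orbF.
  move=> /(mem_Wsp _ tS psiS) yE; apply/WE => _ [c [v [vS ->]]].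
  have gE (z : 'cV[R]_n) : gmx R v *m z = ch R psi v *: z ->
      ((-1) ^+ c *: (Xmx R v.1 *m Ymx R v.2)) *m z = ((-1) ^+ c * ch R psi v) *: z.
    by move=> zE; rewrite -scalemxAl -/(gmx R v) zE scalerA.
  rewrite gE ?yE //; congr (_ *: _); apply/eqP; rewrite -subr_eq0.
  have gS : preimE S ((-1) ^+ c *: (Xmx R v.1 *m Ymx R v.2)) by exists c, v.
  have /WE/(_ _ gS)/eqP := xW.
  by rewrite gE ?psiE // -subr_eq0 -scalerBl scaler_eq0 (negbTE x0) orbF.
have WspP := mem_Wsp _ tS psiS.
have W0 : Wsp S psi <> 0%VS.
  move=> W0; have : (\dim (Wsp S psi))%:R != 0 :> R.
    rewrite dim_projm projm_Wsp // Prj_trace // mulf_neq0 ?invr_eq0 ?card_S_neq0 //.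
    by rewrite pnatr_eq0 expn_eq0.
  by rewrite W0 dimv0 eqxx.
split=> //; pose x := vpick (Wsp S psi).
have x0 : x != 0 by rewrite vpick0; apply/eqP.
have xE := (WspP x).1 (memv_pick _).
have xx0 : (x^T *m x) 0 0 != 0 by apply: contra_neq x0 => /dot_self_eq0.
(* The Rayleigh quotient at x: defined for every matrix, it returns the eigenvalue whenever x is an
   eigenvector. *)
pose chi (g : 'M[R]_n) := (x^T *m (g *m x)) 0 0 / (x^T *m x) 0 0.
have chiE (g : 'M[R]_n) c : g *m x = c *: x -> chi g = c.
  by move=> gx; rewrite /chi gx -scalemxAr mxE mulfK.
exists chi => y; rewrite WspP; split=> [yE _ [c [v [vS ->]]]|yE v vS].
  rewrite (chiE _ ((-1) ^+ c * ch R psi v)).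
    by rewrite -scalemxAl -/(gmx R v) yE // scalerA.
  by rewrite -scalemxAl -/(gmx R v) xE // scalerA.
rewrite yE; last by exists false, v; rewrite expr0 scale1r.
by congr (_ *: _); apply: chiE; apply: xE.
Qed.

Variable Sigma : {set {vspace F2k2 k}}.
Hypothesis Sigma_iso : forall S, S \in Sigma -> totally_isotropic S.

Definition points : {set {vspace F2k2 k} * {ffun F2k2 k -> bool}} :=
  [set w | (w.1 \in Sigma) && (w.2 \in characters w.1)].

Lemma in_points w : (w \in points) = (w.1 \in Sigma) && (w.2 \in characters w.1).
Proof. by rewrite /points finset.in_set. Qed.

Definition DSigma_seq := [seq Wsp w.1 w.2 | w <- enum points].

Lemma DSigma_seqE : DSigma R Sigma = [set` DSigma_seq]%classic.
Proof.
apply/predeqP => W; split=> [[S SS]|/mapP[w]].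
  move=> /(DS_characters _ (Sigma_iso SS))[psi psiS ->].
  by apply/mapP; exists (S, psi); rewrite // mem_enum in_points SS.
rewrite mem_enum in_points => /andP[wS wC] ->; exists w.1 => //.
by apply/DS_characters; [apply: Sigma_iso|exists w.2].
Qed.

Lemma DSigma_seq_uniq : uniq DSigma_seq.
Proof.
rewrite map_inj_in_uniq ?enum_uniq // => -[S psi] [S' psi'].
rewrite !mem_enum !in_points /= => /andP[SS psiS] /andP[SS' psiS'] e.
have /Prj_inj[||-> ->//] // : Prj R S psi = Prj R S' psi'.
rewrite -(projm_Wsp (Sigma_iso SS) psiS) -(projm_Wsp (Sigma_iso SS') psiS').
by congr projm.
Qed.

Lemma sum_DSigma (f : {vspace 'cV[R]_n} -> R) :
  \sum_(U \in DSigma R Sigma) f U =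
  \sum_(S in Sigma) \sum_(psi in characters S) f (Wsp S psi).
Proof.
rewrite DSigma_seqE -fsbig_seq ?DSigma_seq_uniq // big_map big_enum /=.
rewrite pair_big_dep /=; by apply: eq_big => [w|[]//]; rewrite in_points.
Qed.

Lemma DSigma_Gr s (W : {vspace 'cV[R]_n}) : (s <= k)%N ->
  (forall S, S \in Sigma -> \dim S = (k - s)%N) ->
  DSigma R Sigma W -> Gr (2 ^ s) W.
Proof.
move=> sk dS [S SS] /(DS_characters _ (Sigma_iso SS))[psi psiS ->].
by apply: dim_Wsp; [|apply: Sigma_iso| |apply: dS].
Qed.

End DesignPoints.

(** * Averages of tensor powers of projections *)

Section TensorPowers.
Variables (R : realType) (n : nat).

Definition tpow t (P : 'M[R]_n) (i : {ffun 'I_t * bool -> 'I_n}) : R :=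
  \prod_(c < t) P (i (c, false)) (i (c, true)).

(* A pair-indexed tensor is isotropic when it is orthogonal to every tensor all
   of whose complete contractions vanish, i.e. when it is a combination of
   products of Kronecker deltas. *)
Definition isotropic_tensor t (A : {ffun 'I_t * bool -> 'I_n} -> R) : Prop :=
  forall T : {ffun 'I_t * bool -> 'I_n} -> R,
    (forall phi : 'I_t * bool -> 'I_t * bool, bijective phi -> ctr phi 1%:M T = 0) ->
    \sum_i T i * A i = 0.

Lemma ctr_tpow t (P : 'M[R]_n) (T : {ffun 'I_t * bool -> 'I_n} -> R) :
  ctr id P T = \sum_i T i * tpow P i.
Proof. by []. Qed.

Lemma ctr_reindex (I J : finType) t (phi' : 'I_t * bool -> I) (phi : I -> J)
    (psi : J -> I) (P : 'M[R]_n) (T : {ffun J -> 'I_n} -> R) :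
  cancel phi psi -> cancel psi phi ->
  ctr phi' P (fun j => T [ffun a => j (psi a)]) = ctr (phi \o phi') P T.
Proof.
move=> phiK psiK.
rewrite /ctr (reindex (fun i : {ffun J -> 'I_n} => [ffun a => i (phi a)])) /=.
  apply: eq_bigr => i _; congr (T _ * _).
    by apply/ffunP => a; rewrite !ffunE psiK.
  by apply: eq_bigr => c _; rewrite !ffunE.
apply: onW_bij; exists (fun j : {ffun I -> 'I_n} => [ffun a => j (psi a)]) => j;
  by apply/ffunP => a; rewrite !ffunE ?phiK ?psiK.
Qed.

Lemma tpow_dot t (P P' : 'M[R]_n) :
  \sum_(i : {ffun 'I_t * bool -> 'I_n}) tpow P i * tpow P' i =
  (\sum_x \sum_y P x y * P' x y) ^+ t.
Proof.
under eq_bigr => i _ do rewrite -big_split /=.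
rewrite (sum_matching (phi := id) (fun _ x y => P x y * P' x y)); last by exists id.
by rewrite prodr_const card_ord.
Qed.

(** Contracting two slots contracts two columns of B, and B^T B = 1 leaves a delta on their column
    indices. Only m survives, so complete contractions depend on the rank alone. *)
Lemma ctr1_tpow m t (B : 'M[R]_(n, m)) (phi : 'I_t * bool -> 'I_t * bool) :
  B^T *m B = 1%:M -> bijective phi ->
  ctr phi 1%:M (tpow (B *m B^T)) = \sum_(j : {ffun 'I_t -> 'I_m})
    \prod_(c < t) (j (phi (c, false)).1 == j (phi (c, true)).1)%:R.
Proof.
move=> BB phiB; rewrite /ctr /tpow.
transitivity (\sum_(i : {ffun 'I_t * bool -> 'I_n}) \sum_(j : {ffun 'I_t -> 'I_m})
   \prod_(c < t) (B (i (phi (c, false))) (j (phi (c, false)).1) *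
     B (i (phi (c, true))) (j (phi (c, true)).1) *
     (1%:M : 'M[R]_n) (i (phi (c, false))) (i (phi (c, true))))).
  apply: eq_bigr => i _.
  under eq_bigr => c _ do rewrite mxE.
  rewrite bigA_distr_bigA mulr_suml; apply: eq_bigr => j _ /=.
  rewrite [RHS]big_split /=; congr (_ * _).
  rewrite -(prod_matching (fun a => B (i a) (j a.1)) phiB).
  rewrite (prod_matching (phi := id)) //; last by exists id.
  by apply: eq_bigr => c _; rewrite [B^T _ _]mxE.
rewrite exchange_big; apply: eq_bigr => j _ /=.
rewrite (sum_matching (fun c x y => B x (j (phi (c, false)).1) *
  B y (j (phi (c, true)).1) * (1%:M : 'M[R]_n) x y) phiB).
apply: eq_bigr => c _.
have /matrixP/(_ (j (phi (c, false)).1) (j (phi (c, true)).1)) := BB.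
rewrite mxE [RHS]mxE => <-; apply: eq_bigr => x _.
rewrite (bigD1 x) //= big1 ?addr0 => [|y yx]; rewrite !mxE ?eqxx ?mulr1 //.
by rewrite eq_sym (negbTE yx) mulr0.
Qed.

Definition ext_pair t (i : {ffun 'I_t * bool -> 'I_n}) (l : 'I_n) :
    {ffun 'I_t.+1 * bool -> 'I_n} :=
  [ffun a => if unlift ord0 a.1 is Some c then i (c, a.2) else l].

Lemma tpow_ext_pair t (P : 'M[R]_n) (i : {ffun 'I_t * bool -> 'I_n}) l :
  tpow P (ext_pair i l) = P l l * tpow P i.
Proof.
rewrite /tpow big_ord_recl !ffunE /= unlift_none; congr (_ * _).
by apply: eq_bigr => c _; rewrite !ffunE /= liftK.
Qed.

(** The two slots of one pair contract to the trace m; slots of different pairs merge two factors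
    into one by P P = P. Neither [kappa] nor [i'] depends on P, so the identity survives
    averaging. *)
Lemma tpow_contract t m (p q : 'I_t.+1 * bool) (i : {ffun 'I_t.+1 * bool -> 'I_n}) :
  p != q -> exists kappa i', forall P : 'M[R]_n,
    P^T = P -> P *m P = P -> \tr P = m ->
    \sum_l tpow P (upd2 p q i l) = kappa * tpow (t := t) P i'.
Proof.
case: p q => c0 b0 [c1 b1] pq; have [cc|cc] := eqVneq c0 c1.
  subst c1; exists m, [ffun a => i (lift c0 a.1, a.2)] => P _ _ trP.
  rewrite -trP /mxtrace mulr_suml; apply: eq_bigr => l _.
  rewrite /tpow (bigD1_ord c0) //= !ffunE !xpair_eqE eqxx /=.
  have -> : (false == b0) || (false == b1) by case: b0 b1 pq => -[]; rewrite ?eqxx.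
  have -> : (true == b0) || (true == b1) by case: b0 b1 pq => -[]; rewrite ?eqxx.
  congr (_ * _); apply: eq_bigr => c _; rewrite !ffunE !xpair_eqE /=.
  by rewrite eq_sym (negbTE (neq_lift _ _)).
have [c1' c1E] : {c1' | c1 = lift c0 c1'} by case/unlift_some: cc => c' -> _; exists c'.
pose x := i (c0, ~~ b0); pose y := i (c1, ~~ b1).
exists 1, [ffun a => if a.1 == c1' then (if a.2 then y else x) else i (lift c0 a.1, a.2)].
move=> P PT PP _; rewrite mul1r.
have symP z w : P z w = P w z by rewrite -{1}PT mxE.
have upd_c0 l b : upd2 (c0, b0) (c1, b1) i l (c0, b) = (if b == b0 then l else x).
  rewrite ffunE !xpair_eqE eqxx (negbTE cc) orbF /=; case: eqP => // /eqP bb0.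
  by have -> : b = ~~ b0 by move: bb0; case: (b); case: (b0).
have upd_c1 l b : upd2 (c0, b0) (c1, b1) i l (c1, b) = (if b == b1 then l else y).
  rewrite ffunE !xpair_eqE eqxx [c1 == c0]eq_sym (negbTE cc) /=; case: eqP => // /eqP bb1.
  by have -> : b = ~~ b1 by move: bb1; case: (b); case: (b1).
have upd_c l b c : c != c0 -> c != c1 -> upd2 (c0, b0) (c1, b1) i l (c, b) = i (c, b).
  by move=> /negbTE cc0 /negbTE cc1; rewrite ffunE !xpair_eqE cc0 cc1.
rewrite /tpow [RHS](bigD1 c1') //= !ffunE /= eqxx.
have -> : P x y = \sum_l P x l * P l y by rewrite -{1}PP mxE.
rewrite mulr_suml; apply: eq_bigr => l _.
rewrite (bigD1_ord c0) //= (bigD1 c1') //= -c1E mulrA; congr (_ * _); last first.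
  apply: eq_bigr => c cc1.
  have e1 : lift c0 c != c0 by rewrite eq_sym neq_lift.
  have e2 : lift c0 c != c1 by rewrite c1E (inj_eq lift_inj).
  by rewrite !upd_c // !ffunE /= (negbTE cc1).
rewrite !upd_c0 !upd_c1 {upd_c0 upd_c1 upd_c pq}; move: x y.
by case: b0; case: b1 => x y /=; rewrite ?[P l x]symP ?[P y l]symP.
Qed.

End TensorPowers.

Section Averages.
Variables (R : realType) (k s : nat).
Hypothesis sk : (s <= k)%N.
Local Notation n := (2 ^ k)%N.
Implicit Types (S : {vspace F2k2 k}) (psi : {ffun F2k2 k -> bool}).
Implicit Types (Sigma : {set {vspace F2k2 k}}).

Definition isotropic_family Sigma : Prop :=
  [/\ (0 < #|Sigma|)%N, forall S, S \in Sigma -> totally_isotropic S &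
      forall S, S \in Sigma -> \dim S = (k - s)%N].

Definition avg Sigma (F : 'M[R]_n -> R) : R :=
  (#|Sigma|%:R * (2 ^ (k - s))%:R)^-1 *
  \sum_(S in Sigma) \sum_(psi in characters S) F (Prj R S psi).

Definition mean_tensor Sigma t (i : {ffun 'I_t * bool -> 'I_n}) : R :=
  avg Sigma (fun P => tpow P i).

Lemma avg_sum Sigma (J : Type) (r : seq J) (p : pred J) (T : J -> R)
    (F : J -> 'M[R]_n -> R) :
  \sum_(j <- r | p j) T j * avg Sigma (F j) =
  avg Sigma (fun P => \sum_(j <- r | p j) T j * F j P).
Proof.
rewrite /avg; under eq_bigr => j _ do rewrite mulrCA.
rewrite -mulr_sumr; congr (_ * _); under eq_bigr => j _ do rewrite mulr_sumr.
rewrite exchange_big; apply: eq_bigr => S _ /=.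
under eq_bigr => j _ do rewrite mulr_sumr.
by rewrite exchange_big.
Qed.

Lemma avg_mull Sigma c (F : 'M[R]_n -> R) :
  c * avg Sigma F = avg Sigma (fun P => c * F P).
Proof.
rewrite /avg mulrCA mulr_sumr; congr (_ * _); apply: eq_bigr => S _.
by rewrite mulr_sumr.
Qed.

Lemma eq_avg Sigma (F F' : 'M[R]_n -> R) :
  (forall S psi, S \in Sigma -> psi \in characters S ->
     F (Prj R S psi) = F' (Prj R S psi)) -> avg Sigma F = avg Sigma F'.
Proof.
by move=> FF'; congr (_ * _); apply: eq_bigr => S SS; apply: eq_bigr => psi; apply: FF'.
Qed.

Section Family.
Variable Sigma : {set {vspace F2k2 k}}.
Hypothesis fam : isotropic_family Sigma.

Let iso S : S \in Sigma -> totally_isotropic S. Proof. by case: fam => _ + _; apply. Qed.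
Let dimS S : S \in Sigma -> \dim S = (k - s)%N. Proof. by case: fam => _ _; apply. Qed.

Lemma card_family S : S \in Sigma -> #|S| = (2 ^ (k - s))%N.
Proof. by move=> SS; rewrite card_SE dimS. Qed.

Lemma norm_neq0 : #|Sigma|%:R * (2 ^ (k - s))%:R != 0 :> R.
Proof. by case: fam => S0 _ _; rewrite mulf_neq0 ?pnatr_eq0 -?lt0n ?expn_gt0. Qed.

Lemma avg_const c : avg Sigma (fun=> c) = c.
Proof.
rewrite /avg (eq_bigr (fun=> c * (2 ^ (k - s))%:R)) => [|S SS]; last first.
  by rewrite sumr_const card_characters ?iso // card_family // -[c *+ _]mulr_natr.
rewrite sumr_const -[_ *+ #|_|]mulr_natr mulrC -mulrA -[RHS](mulfK norm_neq0).
by congr (_ / _); ring.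
Qed.

Lemma Prj_props S psi : S \in Sigma -> psi \in characters S ->
  [/\ (Prj R S psi)^T = Prj R S psi, Prj R S psi *m Prj R S psi = Prj R S psi &
      \tr (Prj R S psi) = (2 ^ s)%:R].
Proof.
move=> SS psiS; split; [exact: Prj_sym (iso SS)|exact: Prj_idem|].
by rewrite -projm_Wsp ?iso // -dim_projm (dim_Wsp _ sk) ?iso ?dimS.
Qed.

Lemma sum_DSigma_avg (f : {vspace 'cV[R]_n} -> R) (F : 'M[R]_n -> R) :
  (forall U, Gr (2 ^ s) U -> f U = F (projm U)) ->
  \sum_(U \in DSigma R Sigma) f U = #|Sigma|%:R * (2 ^ (k - s))%:R * avg Sigma F.
Proof.
move=> fF; rewrite (sum_DSigma iso).
rewrite /avg mulVKf ?norm_neq0 //; apply: eq_bigr => S SS; apply: eq_bigr => psi psiS.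
rewrite fF; first by rewrite projm_Wsp ?iso.
by apply: dim_Wsp; rewrite ?iso ?dimS.
Qed.

Lemma ctr1_mean_tensor t (phi : 'I_t * bool -> 'I_t * bool) : bijective phi ->
  ctr phi 1%:M (mean_tensor Sigma (t := t)) = \sum_(j : {ffun 'I_t -> 'I_(2 ^ s)})
    \prod_(c < t) (j (phi (c, false)).1 == j (phi (c, true)).1)%:R.
Proof.
move=> phiB; rewrite /ctr; under eq_bigr => i _ do rewrite mulrC.
rewrite avg_sum -[RHS]avg_const; apply: eq_avg => S psi SS psiS.
have GW : Gr (2 ^ s) (Wsp R S psi) by apply: dim_Wsp; rewrite ?iso ?dimS.
have [B BB PE] := Gr_frame GW; rewrite projm_Wsp ?iso // in PE.
rewrite -(ctr1_tpow BB phiB) PE; apply: eq_bigr => i _; exact: mulrC.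
Qed.

Lemma Prj_dot_Prj S S' psi psi' : S \in Sigma -> S' \in Sigma ->
  \sum_i \sum_j Prj R S psi i j * Prj R S' psi' i j =
  n%:R / ((2 ^ (k - s))%:R ^+ 2) * \sum_(v in (S :&: S')%VS) ch R psi v * ch R psi' v.
Proof.
move=> SS SS'; transitivity ((#|S|%:R)^-1 * \sum_(v in S) ch R psi v *
    ((#|S'|%:R)^-1 * n%:R * (if v \in S' then ch R psi' v else 0))).
  under [X in _ * X]eq_bigr => v _ do rewrite -Prj_dot mulr_sumr.
  rewrite [X in _ * X]exchange_big mulr_sumr; apply: eq_bigr => i _ /=.
  under [X in _ * X]eq_bigr => v _ do rewrite mulr_sumr.
  rewrite [X in _ * X]exchange_big mulr_sumr; apply: eq_bigr => j _ /=.
  rewrite [Prj R S _ _ _]mxE summxE -mulrA mulr_suml; congr (_ * _).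
  by apply: eq_bigr => v _; rewrite [(ch R psi v *: gmx R v) _ _]mxE mulrA.
rewrite !card_family //.
transitivity (n%:R / (2 ^ (k - s))%:R ^+ 2 *
    \sum_(v in S) (if v \in S' then ch R psi v * ch R psi' v else 0)).
  rewrite !mulr_sumr; apply: eq_bigr => v _.
  by case: ifP => _; rewrite ?mulr0 // expr2 invfM; ring.
congr (_ * _); rewrite -big_mkcondr /=; apply: eq_bigl => v.
by rewrite memv_cap.
Qed.

(** On the intersection the two twists cancel, so the product of psi and psi' is a genuine character
    and x is 0 or the cardinal of the intersection. *)
Lemma character_sum_sqr S S' psi psi' : psi \in characters S -> psi' \in characters S' ->
  let x := \sum_(v in (S :&: S')%VS) ch R psi v * ch R psi' v in
  x * x = (card_capv S S')%:R * x.
Proof.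
move=> psiS psiS' x; rewrite {1}/x mulr_suml.
transitivity (\sum_(v in (S :&: S')%VS) x); last first.
  rewrite sumr_const -[_ *+ #|_|]mulr_natl; congr (_%:R * _).
  by rewrite /card_capv cardsE.
apply: eq_bigr => u; rewrite memv_cap => /andP[uS uS'].
rewrite {2}/x (reindex_inj (addrI u)) /x mulr_sumr.
apply: eq_big => [v|v]; first by rewrite rpredDl // memv_cap uS.
rewrite memv_cap => /andP[vS vS']; rewrite (chM _ psiS) // (chM _ psiS') //.
set e := sg R _; have ee : e * e = 1 by apply: sg_sqr.
by rewrite -[LHS]mulr1 -ee; ring.
Qed.

Lemma character_sum_sum S S' : S \in Sigma -> S' \in Sigma ->
  \sum_(psi in characters S) \sum_(psi' in characters S')
     \sum_(v in (S :&: S')%VS) ch R psi v * ch R psi' v = (2 ^ (k - s))%:R ^+ 2.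
Proof.
move=> SS SS'.
transitivity (\sum_(v in (S :&: S')%VS)
   (\sum_(psi in characters S) ch R psi v) * (\sum_(psi' in characters S') ch R psi' v)).
  rewrite [RHS](eq_bigr (fun v => \sum_(psi in characters S)
     \sum_(psi' in characters S') ch R psi v * ch R psi' v)).
    rewrite [RHS]exchange_big; apply: eq_bigr => psi _ /=.
    by rewrite exchange_big.
  by move=> v _; rewrite mulr_suml; apply: eq_bigr => psi _; rewrite mulr_sumr.
rewrite (bigD1 (0 : F2k2 k)) ?mem0v //= [X in _ + X]big1 => [|v /andP[]]; last first.
  by rewrite memv_cap => /andP[vS vS'] v0; rewrite sum_ch // (negbTE v0) mulr0 mul0r.
by rewrite !sum_ch ?mem0v // eqxx !mulr1 addr0 !card_characters ?iso // !card_family.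
Qed.

Lemma mean_tensor_dot t :
  \sum_(i : {ffun 'I_t.+1 * bool -> 'I_n}) mean_tensor Sigma i * mean_tensor Sigma i =
  (n%:R / (2 ^ (k - s))%:R ^+ 2) ^+ t.+1 * intersection_moment R Sigma t.
Proof.
set C := n%:R / _; set w : R := (2 ^ (k - s))%:R.
have w0 : w != 0 by rewrite pnatr_eq0 -lt0n expn_gt0.
rewrite avg_sum.
transitivity (avg Sigma (fun P => avg Sigma (fun P' =>
    (\sum_x \sum_y P x y * P' x y) ^+ t.+1))).
  apply: eq_avg => S psi _ _; under eq_bigr => i _ do rewrite mulrC.
  by rewrite avg_sum; apply: eq_avg => S' psi' _ _; rewrite tpow_dot.
rewrite /avg /intersection_moment.
transitivity ((#|Sigma|%:R * w)^-1 * ((#|Sigma|%:R * w)^-1 *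
   \sum_(S in Sigma) \sum_(S' in Sigma) C ^+ t.+1 * (card_capv S S')%:R ^+ t * w ^+ 2)).
  congr (_ * _); rewrite mulr_sumr; apply: eq_bigr => S SS.
  rewrite -mulr_sumr; congr (_ * _); rewrite exchange_big; apply: eq_bigr => S' SS' /=.
  rewrite /w -(character_sum_sum SS SS') mulr_sumr; apply: eq_bigr => psi psiS.
  rewrite mulr_sumr; apply: eq_bigr => psi' psiS'.
  rewrite Prj_dot_Prj // exprMn -mulrA; congr (_ * _).
  (* By this relation each further power of x contributes one factor [card_capv S S'], so only the
     plain sum of x over the characters is left. *)
  have xx := character_sum_sqr psiS psiS'; set x := \sum_(v in _) _ in xx *.
  elim: t => [|t IHt]; first by rewrite expr1 expr0 mul1r.
  by rewrite exprS IHt mulrCA xx [in RHS]exprS; ring.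
under eq_bigr => S _ do rewrite -mulr_suml -mulr_sumr.
rewrite -mulr_suml -mulr_sumr invfM.
set M := \sum_(S in Sigma) _.
have N0 : #|Sigma|%:R != 0 :> R by case: fam => S0 _ _; rewrite pnatr_eq0 -lt0n.
by field; rewrite N0 w0.
Qed.

End Family.

(** Tracing out the first pair multiplies by the rank 2^s, which is nonzero. *)
Lemma mean_tensor_contract Sigma Sigma' t :
  isotropic_family Sigma -> isotropic_family Sigma' ->
  (forall i : {ffun 'I_t.+1 * bool -> 'I_n}, mean_tensor Sigma i = mean_tensor Sigma' i) ->
  forall i : {ffun 'I_t * bool -> 'I_n}, mean_tensor Sigma i = mean_tensor Sigma' i.
Proof.
move=> fam fam' e i.
have tr Sig : isotropic_family Sig ->
    \sum_l 1 * mean_tensor Sig (ext_pair i l) = (2 ^ s)%:R * mean_tensor Sig i.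
  move=> famS; rewrite avg_sum avg_mull; apply: eq_avg => S psi SS psiS.
  have [_ _ <-] := Prj_props famS SS psiS; rewrite /mxtrace mulr_suml.
  by apply: eq_bigr => l _; rewrite mul1r tpow_ext_pair.
have m0 : (2 ^ s)%:R != 0 :> R by rewrite pnatr_eq0 expn_eq0.
apply: (mulfI m0); rewrite -!tr //; apply: eq_bigr => l _; by rewrite e.
Qed.

(** Every contraction at level t + 1 is a fixed multiple of a value at level t, where the two
    families agree. *)
Lemma mean_tensor_traceless Sigma Sigma' t (p q : 'I_t.+1 * bool)
    (i : {ffun 'I_t.+1 * bool -> 'I_n}) :
  isotropic_family Sigma -> isotropic_family Sigma' ->
  (forall i : {ffun 'I_t * bool -> 'I_n}, mean_tensor Sigma i = mean_tensor Sigma' i) ->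
  p != q ->
  \sum_l (mean_tensor Sigma (upd2 p q i l) - mean_tensor Sigma' (upd2 p q i l)) = 0.
Proof.
move=> fam fam' e pq.
have [kappa [i' contr]] := @tpow_contract R n t (2 ^ s)%:R p q i pq.
have tr Sig : isotropic_family Sig ->
    \sum_l mean_tensor Sig (upd2 p q i l) = kappa * mean_tensor Sig i'.
  move=> famS; rewrite avg_mull.
  under eq_bigr => l _ do rewrite -[mean_tensor _ _]mul1r.
  rewrite avg_sum; apply: eq_avg => S psi SS psiS.
  have [PT PP trP] := Prj_props famS SS psiS; rewrite -contr //.
  by apply: eq_bigr => l _; rewrite mul1r.
by rewrite sumrB !tr // e subrr.
Qed.

Lemma moment_eqP Sigma Sigma' t :
  isotropic_family Sigma -> isotropic_family Sigma' ->
  isotropic_tensor (mean_tensor Sigma' (t := t.+1)) ->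
  intersection_moment R Sigma t = intersection_moment R Sigma' t <->
  forall i : {ffun 'I_t.+1 * bool -> 'I_n}, mean_tensor Sigma i = mean_tensor Sigma' i.
Proof.
move=> fam fam' iso.
have C0 : (n%:R / (2 ^ (k - s))%:R ^+ 2) ^+ t.+1 != 0 :> R.
  by rewrite expf_neq0 // mulf_neq0 ?invr_eq0 ?expf_neq0 // pnatr_eq0 expn_eq0.
split=> [e|e]; last first.
  apply: (mulfI C0); rewrite -!mean_tensor_dot //.
  by apply: eq_bigr => i _; rewrite e.
pose T (i : {ffun 'I_t.+1 * bool -> 'I_n}) := mean_tensor Sigma i - mean_tensor Sigma' i.
have TA' : \sum_i T i * mean_tensor Sigma' i = 0.
  apply: iso => phi phiB; rewrite /ctr.
  under eq_bigr => i _ do rewrite mulrBl.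
  by rewrite sumrB -!/(ctr _ _ _) !ctr1_mean_tensor // subrr.
have TT : \sum_i T i ^+ 2 = 0.
  (* With A = A' + T, the square norm of T is that of A minus that of A' minus twice the product of
     T and A'. *)
  transitivity (\sum_i (mean_tensor Sigma i * mean_tensor Sigma i -
      mean_tensor Sigma' i * mean_tensor Sigma' i - 2 * (T i * mean_tensor Sigma' i))).
    by apply: eq_bigr => i _; rewrite /T; ring.
  by rewrite !sumrB -mulr_sumr TA' !mean_tensor_dot // e subrr mulr0 subr0.
move=> i; apply/eqP; rewrite -subr_eq0 -/(T i) -sqrf_eq0; apply/eqP.
by apply: (psumr_eq0P _ TT) => // j _; apply: sqr_ge0.
Qed.

Lemma design_of_isotropic Sigma t : (t <= 3)%N -> isotropic_family Sigma ->
  (forall t', (0 < t' <= t)%N -> isotropic_tensor (mean_tensor Sigma (t := t'))) ->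
  is_2t_design (2 ^ s) t (DSigma R Sigma).
Proof.
move=> t3 fam iso; have [_ ti dS] := fam; split.
- by move=> U; apply: DSigma_Gr.
- by rewrite DSigma_seqE.
move=> mu f _ _ /andP[mu0 mut] Hf.
have mu13 : (1 <= sumn mu <= 3)%N by rewrite mu0 (leq_trans mut).
have [|T [Ttr _] [a fE]] := H2_ctr _ mu13 Hf; first by rewrite leq_exp2l.
pose F (P : 'M[R]_n) := \sum_(phi : {ffun 'I_(sumn mu) * bool -> 'I_(sumn (twice mu))})
  (if injectiveb phi then a phi else 0) * ctr phi P T.
have sE := @sum_DSigma_avg Sigma fam f F.
rewrite sE => [|U /fE ->]; last first.
  by rewrite big_mkcond; apply: eq_bigr => phi _; case: ifP; rewrite ?mul0r.
rewrite /F -avg_sum big1 ?mulr0 // => phi _.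
case: ifP => phiI; last by rewrite mul0r.
have cI : #|{: 'I_(sumn mu) * bool}| = #|'I_(sumn (twice mu))|.
  by rewrite card_prod card_bool !card_ord sumn_twice.
rewrite (_ : avg _ _ = 0) ?mulr0 //.
have [psi phiK psiK] : bijective phi.
  by apply: inj_card_bij; [apply/injectiveP|rewrite cI].
(* T read on pairs through [phi]: its complete contractions are those of the traceless T, so
   isotropy applies to it. *)
pose T' (j : {ffun 'I_(sumn mu) * bool -> 'I_n}) := T [ffun b => j (psi b)].
transitivity (\sum_j T' j * mean_tensor Sigma j).
  rewrite avg_sum; apply: eq_avg => S psi' _ _.
  by rewrite -ctr_tpow (ctr_reindex _ _ _ phiK psiK).
apply: iso => [|phi' phi'B]; first by rewrite mu0.
rewrite (ctr_reindex _ _ _ phiK psiK); apply: ctr_traceless => //.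
by apply: bij_comp phi'B; exists psi.
Qed.

End Averages.

(** * Witt's theorem for pairs of singular vectors *)

Section Witt.
Variable k : nat.
Implicit Types (u v w x z : F2k2 k) (S : {vspace F2k2 k}).

Definition bform u v : 'F_2 := dotF2 u.1 v.2 + dotF2 u.2 v.1.

Lemma bformC u v : bform u v = bform v u.
Proof. by rewrite /bform addrC [dotF2 u.2 _]dotF2C [dotF2 u.1 _]dotF2C. Qed.

Lemma bformDl u u' v : bform (u + u') v = bform u v + bform u' v.
Proof. by rewrite /bform /= !dotF2Dl addrACA. Qed.

Lemma bformDr u v v' : bform u (v + v') = bform u v + bform u v'.
Proof. by rewrite bformC bformDl ![bform _ u]bformC. Qed.

Lemma bform0 u : bform u 0 = 0.
Proof. by rewrite /bform /= !dotF2_0r addr0. Qed.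

Lemma bformvv u : bform u u = 0.
Proof. by rewrite /bform [dotF2 u.2 _]dotF2C F2_addxx. Qed.

Lemma qD u v : q (u + v) = q u + q v + bform u v.
Proof.
rewrite /q /bform /= dotF2Dl !dotF2Dr [dotF2 u.2 _]dotF2C.
by rewrite -!addrA; congr (_ + _); rewrite addrA [LHS]addrC.
Qed.

Lemma q0 : q (0 : F2k2 k) = 0.
Proof. by rewrite /q dotF2_0l. Qed.

Lemma F2_addvv2 v : v + v = 0.
Proof. by case: v => a b; congr pair; apply: F2_addvv. Qed.

Lemma F2_oppv2 v : - v = v.
Proof. by apply/eqP; rewrite eq_sym -addr_eq0 F2_addvv2. Qed.

Lemma F2_addKv u v : u + (u + v) = v.
Proof. by rewrite addrA F2_addvv2 add0r. Qed.

Lemma bform_ex1 u : u != 0 -> exists z, bform z u = 1.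
Proof.
case: u => a b; rewrite xpair_eqE negb_and => /orP[/dotF2_nondegenerate[z az]|
  /dotF2_nondegenerate[z bz]].
  by exists (0, z); rewrite /bform /= dotF2_0l add0r dotF2C.
by exists (z, 0); rewrite /bform /= dotF2_0l addr0 dotF2C.
Qed.

Lemma bform_ex2 u v : v != 0 -> u != v -> exists2 z, bform z u = 0 & bform z v = 1.
Proof.
move=> v0 uv; have [z0 z0v] := bform_ex1 v0.
case: (F2P (bform z0 u)) => z0u; first by exists z0.
have [|z1] := @bform_ex1 (u + v).
  by apply: contra uv; rewrite addr_eq0 F2_oppv2.
rewrite bformDr; case: (F2P (bform z1 u)) => z1u; first by rewrite z1u add0r; exists z1.
rewrite z1u => /(canRL (addKr _)); rewrite addNr => z1v.
exists (z0 + z1); first by rewrite bformDl z0u z1u F2_addxx.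
by rewrite bformDl z0v z1v addr0.
Qed.

Lemma bform_ex3 u v v' : v != 0 -> u != v -> v' != 0 -> u != v' ->
  exists z, [/\ bform z u = 0, bform z v = 1 & bform z v' = 1].
Proof.
move=> v0 uv v'0 uv'; have [z0 z0u z0v] := bform_ex2 v0 uv.
have [z1 z1u z1v'] := bform_ex2 v'0 uv'.
case: (F2P (bform z0 v')) => z0v'; last by exists z0.
case: (F2P (bform z1 v)) => z1v; last by exists z1.
exists (z0 + z1); rewrite !bformDl z0u z1u z0v z1v z0v' z1v'.
by rewrite !addr0 add0r.
Qed.

Definition transvection w x : F2k2 k := x + bform x w *: w.

Lemma transvection_linear w : linear (transvection w).
Proof.
move=> c x y; rewrite /transvection bformDl.
have -> : bform (c *: x) w = c * bform x w.
  by case: (F2P c) => ->; rewrite ?scale0r ?scale1r ?mul0r ?mul1r // bformC bform0.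
by rewrite scalerDl scalerDr -!scalerA addrACA.
Qed.

HB.instance Definition _ w := GRing.isLinear.Build 'F_2 (F2k2 k) (F2k2 k) *:%R
  (transvection w) (transvection_linear w).

Lemma transvectionK w : involutive (transvection w).
Proof.
move=> x; rewrite /transvection bformDl.
have -> : bform (bform x w *: w) w = 0.
  by case: (F2P (bform x w)) => ->; rewrite ?scale0r ?scale1r ?bformvv // bformC bform0.
by rewrite addr0 -addrA F2_addvv2 addr0.
Qed.

Lemma q_transvection w x : q w = 1 -> q (transvection w x) = q x.
Proof.
move=> qw; rewrite /transvection; case: (F2P (bform x w)) => e; rewrite e.
  by rewrite scale0r addr0.
by rewrite scale1r qD qw e -addrA F2_addxx addr0.
Qed.

Variable d : nat.

Definition pair_count u v : nat :=
  \sum_(S in isotropic_subspaces k d) ((u \in S) && (v \in S)).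

Lemma pair_count_transvection w u v : q w = 1 ->
  pair_count (transvection w u) (transvection w v) = pair_count u v.
Proof.
move=> qw; pose f : 'End(F2k2 k) := linfun (transvection w).
have fE x : f x = transvection w x by rewrite lfunE.
have memf S x : (x \in (f @: S)%VS) = (transvection w x \in S).
  apply/memv_imgP/idP => [[y yS ->]|xS]; first by rewrite fE transvectionK.
  by exists (transvection w x); rewrite // fE transvectionK.
pose h S := (f @: S)%VS.
have hK : involutive h by move=> S; apply/vspaceP => x; rewrite !memf transvectionK.
have hX S : (h S \in isotropic_subspaces k d) = (S \in isotropic_subspaces k d).
  rewrite !inE; congr (_ && _); last first.
    rewrite limg_dim_eq //; apply/eqP; rewrite -subv0; apply/subvP => x.
    rewrite memv_cap memv_ker fE => /andP[_ /eqP e].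
    by rewrite -[x](transvectionK w) e linear0 mem0v.
  apply/forallP/forallP => H x; apply/implyP => xS.
    have /implyP := H (transvection w x).
    by rewrite memf transvectionK q_transvection //; apply.
  have /implyP := H (transvection w x); rewrite q_transvection //; apply.
  by rewrite -memf.
rewrite /pair_count [RHS](reindex_inj (inv_inj hK)) /=.
by apply: eq_big => S; [rewrite hX|rewrite !memf].
Qed.

(** Preservation of [pair_count] is a clause of its own, so that it is checked on transvections only
    and passes to compositions. *)
Definition isometry (h : F2k2 k -> F2k2 k) : Prop :=
  [/\ forall u v, h (u + v) = h u + h v, injective h, forall u, q (h u) = q u &
      forall u v, pair_count (h u) (h v) = pair_count u v].

Lemma isometry_comp h h' : isometry h -> isometry h' -> isometry (h \o h').
Proof.
move=> [hD hI hq hc] [hD' hI' hq' hc']; split=> /= [u v||u|u v].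
- by rewrite hD' hD.
- exact: inj_comp.
- by rewrite hq.
by rewrite hc.
Qed.

Lemma isometry_transvection w : q w = 1 -> isometry (transvection w).
Proof.
move=> qw; split; [exact: linearD|exact: inv_inj (transvectionK w)| |].
  by move=> u; apply: q_transvection.
by move=> u v; apply: pair_count_transvection.
Qed.

(** Here q (u + u') = 1, so the transvection along u + u' preserves q, and it carries u to u'. *)
Lemma swap_transvection u u' : q u = 0 -> q u' = 0 -> bform u u' = 1 ->
  isometry (transvection (u + u')) /\ transvection (u + u') u = u'.
Proof.
move=> qu qu' b; split; first by apply: isometry_transvection; rewrite qD qu qu' b !add0r.
by rewrite /transvection bformDr bformvv b add0r scale1r F2_addKv.
Qed.

Lemma fix_transvection w x : bform x w = 0 -> transvection w x = x.
Proof. by move=> b; rewrite /transvection b scale0r addr0. Qed.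

Lemma isometry_id : isometry id.
Proof. by split. Qed.

Lemma singular_transitive u u' : u != 0 -> u' != 0 -> q u = 0 -> q u' = 0 ->
  exists2 h, isometry h & h u = u'.
Proof.
move=> u0 u'0 qu qu'; have [->|uu'] := eqVneq u u'.
  by exists id => //; apply: isometry_id.
case: (F2P (bform u u')) => b; last first.
  by have [hI hE] := swap_transvection qu qu' b; exists (transvection (u + u')).
have [||z0 z0s z0u] := @bform_ex2 (u + u') u => //.
  by rewrite -subr_eq0 F2_oppv2 addrC F2_addKv.
have z0u' : bform z0 u' = 1.
  by move: z0s; rewrite bformDr z0u => /(canRL (addKr _)); rewrite addr0; case: (F2P (bform z0 u')) => ->.
(* When u and u' are orthogonal, the passage goes through a singular z orthogonal to neither. If z0
   is not singular, z0 + u is, with unchanged products. *)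
have [z [qz zu zu']] : exists z, [/\ q z = 0, bform u z = 1 & bform z u' = 1].
  case: (F2P (q z0)) => qz0; first by exists z0; rewrite bformC.
  exists (z0 + u); rewrite qD qz0 qu z0u addr0 F2_addxx bformC !bformDl bformvv z0u.
  by rewrite z0u' b !addr0.
have [h1 h1E] := swap_transvection qu qz zu.
have [h2 h2E] := swap_transvection qz qu' zu'.
by exists (transvection (z + u') \o transvection (u + z)); [apply: isometry_comp|rewrite /= h1E].
Qed.

(** As in [singular_transitive], with the intermediate z chosen orthogonal to u as well, so that all
    transvections used fix u. *)
Lemma singular_pair_transitive u v v' : q u = 0 -> q v = 0 -> q v' = 0 ->
  bform u v = 0 -> bform u v' = 0 -> v != 0 -> u != v -> v' != 0 -> u != v' ->
  exists2 h, isometry h & h u = u /\ h v = v'.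
Proof.
move=> qu qv qv' uv uv' v0 uvn v'0 uv'n; have [->|vv'] := eqVneq v v'.
  by exists id => //; apply: isometry_id.
case: (F2P (bform v v')) => b; last first.
  have [hI hE] := swap_transvection qv qv' b; exists (transvection (v + v')) => //.
  by split=> //; rewrite fix_transvection // bformDr uv uv' addr0.
have [z0 [z0u z0v z0v']] := bform_ex3 v0 uvn v'0 uv'n.
have [z [qz zu zv zv']] : exists z,
    [/\ q z = 0, bform u z = 0, bform v z = 1 & bform z v' = 1].
  case: (F2P (q z0)) => qz0; first by exists z0; rewrite bformC z0u bformC z0v.
  exists (z0 + v); rewrite qD qz0 qv z0v addr0 F2_addxx !bformDr bformDl bformvv uv.
  by rewrite z0v' b ![bform _ z0]bformC z0u z0v !addr0.
have [h1 h1E] := swap_transvection qv qz zv.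
have [h2 h2E] := swap_transvection qz qv' zv'.
exists (transvection (z + v') \o transvection (v + z)); first exact: isometry_comp.
rewrite /= h1E; split=> //.
by rewrite !fix_transvection ?bformDr ?uv ?uv' ?zu ?addr0.
Qed.

Definition nondegenerate_pair (p : F2k2 k * F2k2 k) : bool :=
  [&& (q p.1 == 0) && (q p.2 == 0) && (q (p.1 + p.2) == 0), p.1 != 0, p.2 != 0 &
      p.1 != p.2].

Lemma pair_count_line u u' : u != 0 -> u' != 0 -> q u = 0 -> q u' = 0 ->
  pair_count u u = pair_count u' u'.
Proof.
by move=> u0 u'0 qu qu'; have [h [_ _ _ hc] <-] := singular_transitive u0 u'0 qu qu'.
Qed.

Lemma pair_count_plane p p' : nondegenerate_pair p -> nondegenerate_pair p' ->
  pair_count p.1 p.2 = pair_count p'.1 p'.2.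
Proof.
case: p p' => u v [u' v'] /and4P[/= /andP[/andP[/eqP qu /eqP qv] /eqP quv] u0 v0 uv].
move=> /and4P[/= /andP[/andP[/eqP qu' /eqP qv'] /eqP quv'] u'0 v'0 uv'].
have [h [hD hI hq hc] hu] := singular_transitive u0 u'0 qu qu'.
have h0 : h 0 = 0 by have := hD 0 0; rewrite addr0 => /eqP; rewrite -subr_eq subrr => /eqP.
have b x y : q x = 0 -> q y = 0 -> q (x + y) = 0 -> bform x y = 0.
  by move=> qx qy; rewrite qD qx qy !add0r.
have qhv : q (h v) = 0 by rewrite hq.
have uhv0 : bform u' (h v) = 0 by apply: b; rewrite // -hu -hD hq.
have hv0 : h v != 0 by rewrite -h0 (inj_eq hI).
have uhv : u' != h v by rewrite -hu (inj_eq hI).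
have [h' [_ _ _ hc'] [hu' hv']] :=
  singular_pair_transitive qu' qhv qv' uhv0 (b _ _ qu' qv' quv') hv0 uhv v'0 uv'.
by rewrite -hc -hc' hu hu' hv'.
Qed.

Variable R : realType.

(* Witt's theorem for pairs of vectors: the count depends only on the
   coincidences between u, v and 0 as soon as they span a totally isotropic
   space. *)
Lemma pair_countE : exists c0 c1 c2 : R, forall u v,
  (pair_count u v)%:R = c2 * ((q u == 0) && (q v == 0) && (q (u + v) == 0))%:R +
    (c1 - c2) * ((u == 0)%:R * (q v == 0)%:R + (v == 0)%:R * (q u == 0)%:R +
                 (u == v)%:R * (q u == 0)%:R) +
    (c0 - 3 * c1 + 2 * c2) * ((u == 0)%:R * (v == 0)%:R).
Proof.
(* c1 and c2 are the counts for a nonzero singular vector and for a pair spanning a totally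
   isotropic plane. The default 0 is harmless, as the case it stands for then does not occur. At u =
   v = 0 all coefficients have to add up to the count there, which fixes the last one. *)
pose c1 := if [pick u : F2k2 k | (u != 0) && (q u == 0)] is Some u
  then pair_count u u else 0%N.
pose c2 := if [pick p | nondegenerate_pair p] is Some p then pair_count p.1 p.2 else 0%N.
exists (pair_count 0 0)%:R, c1%:R, c2%:R => u v.
have c1E x : x != 0 -> q x = 0 -> pair_count x x = c1.
  move=> x0 qx; rewrite /c1; case: pickP => [y /andP[y0 /eqP qy]|/(_ x)].
    exact: pair_count_line.
  by rewrite x0 qx eqxx.
have c2E p : nondegenerate_pair p -> pair_count p.1 p.2 = c2.
  move=> np; rewrite /c2; case: pickP => [p' np'|/(_ p)]; last by rewrite np.
  exact: pair_count_plane.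
have out : ~~ ((q u == 0) && (q v == 0) && (q (u + v) == 0)) -> pair_count u v = 0%N.
  move=> nti; rewrite /pair_count big1 // => S; rewrite inE => /andP[tS _].
  case: andP => // -[uS vS]; case/negP: nti.
  by rewrite !(tiP tS) ?memvD // eqxx.
have pc0l x : pair_count 0 x = pair_count x x.
  by apply: eq_bigr => S _; rewrite mem0v andbb.
have pc0r x : pair_count x 0 = pair_count x x.
  by apply: eq_bigr => S _; rewrite mem0v andbT andbb.
have [u0|u0] := eqVneq u 0.
  rewrite u0 add0r q0 eqxx /= andbb [0 == v]eq_sym; have [v0|v0] := eqVneq v 0.
    by rewrite v0 q0 eqxx /=; ring.
  have [qv|qv] := eqVneq (q v) 0; first by rewrite pc0l c1E //=; ring.
  by rewrite -u0 out ?u0 ?q0 ?(negbTE qv) ?andbF //=; ring.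
have [v0|v0] := eqVneq v 0.
  rewrite v0 addr0 q0 eqxx /= (negbTE u0) andbT andbb.
  have [qu|qu] := eqVneq (q u) 0; first by rewrite pc0r c1E //=; ring.
  by rewrite -v0 out ?(negbTE qu) //=; ring.
have [uv|uv] := eqVneq u v.
  rewrite -uv F2_addvv2 q0 eqxx andbT andbb.
  have [qu|qu] := eqVneq (q u) 0; first by rewrite c1E //=; ring.
  by move: out; rewrite -uv => ->; rewrite ?(negbTE qu) //=; ring.
have [ti|nti] := boolP ((q u == 0) && (q v == 0) && (q (u + v) == 0)); last first.
  by rewrite out //=; ring.
have /(c2E (u, v)) -> : nondegenerate_pair (u, v).
  by apply/and4P.
by rewrite /=; ring.
Qed.

End Witt.

(** * Isotropy of the averages *)

Section IsotropicTensors.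
Variables (R : realType) (n t : nat).
Local Notation slot := ('I_t * bool)%type.

Definition deltas (ps : seq (slot * slot)) (i : {ffun slot -> 'I_n}) : R :=
  \prod_(pq <- ps) (i pq.1 == i pq.2)%:R.

Lemma isotropic_deltas ps : size ps = t -> uniq (flat ps) ->
  isotropic_tensor (deltas ps).
Proof.
move=> sz us T T0.
have [t0|t_gt0] := posnP t.
  have phiB : bijective (id : slot -> slot) by exists id.
  rewrite -[RHS](T0 id phiB) /ctr; apply: eq_bigr => i _; congr (_ * _).
  rewrite /deltas (size0nil (etrans sz t0)) big_nil.
  by rewrite big1 // => c; have := ltn_ord c; rewrite {2}t0.
pose z : slot := (Ordinal t_gt0, false).
have phiB := flat_matching z sz us (etrans (card_prod _ _) (congr2 muln (card_ord t) card_bool)).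
rewrite -[RHS](T0 _ phiB) /ctr; apply: eq_bigr => i _; congr (_ * _).
by rewrite /deltas (big_nth (z, z)) big_mkord sz; apply: eq_bigr => c _; rewrite mxE.
Qed.

Lemma isotropic_lin (A B : {ffun slot -> 'I_n} -> R) c e :
  isotropic_tensor A -> isotropic_tensor B ->
  isotropic_tensor (fun i => c * A i + e * B i).
Proof.
move=> HA HB T T0; under eq_bigr => i _ do rewrite mulrDr !(mulrCA (T i)).
by rewrite big_split /= -!mulr_sumr HA // HB // !mulr0 addr0.
Qed.

Lemma isotropic_comb (l : seq (R * seq (slot * slot))) :
  all (fun x => (size x.2 == t) && uniq (flat x.2)) l ->
  isotropic_tensor (fun i => \sum_(x <- l) x.1 * deltas x.2 i).
Proof.
elim: l => [_ T _|[c ps] l IHl /= /andP[/andP[/eqP sz us] /IHl Hl]].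
  by rewrite big1 // => i _; rewrite big_nil mulr0.
move=> T T0; rewrite -[RHS](isotropic_lin c 1 (isotropic_deltas sz us) Hl T0).
by apply: eq_bigr => i _; rewrite big_cons mul1r.
Qed.

Lemma eq_isotropic (A B : {ffun slot -> 'I_n} -> R) :
  (forall i, A i = B i) -> isotropic_tensor A -> isotropic_tensor B.
Proof.
by move=> AB HA T T0; rewrite -[RHS](HA T T0); apply: eq_bigr => i _; rewrite AB.
Qed.

End IsotropicTensors.

Section MeanTensors.
Variables (R : realType) (k s : nat).
Hypothesis sk : (s <= k)%N.
Local Notation n := (2 ^ k)%N.
Local Notation w := ((2 ^ (k - s))%:R : R).
Local Notation g := (gmx R).
Local Notation dl x y := ((x == y)%:R : R).
Implicit Types (S : {vspace F2k2 k}) (u v : F2k2 k) (a b c d e f : 'I_n).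

Lemma singular_sg v : (q v == 0)%:R = (1 + sg R (q v)) / 2.
Proof.
case: (F2P (q v)) => ->; rewrite ?sg0 ?sg1 ?eqxx ?oner_eq0; last by rewrite subrr mul0r.
by rewrite -[1 + 1]/(2%:R) divff // pnatr_eq0.
Qed.

Lemma sg_gmx v a b : sg R (q v) * g v a b = g v b a.
Proof. by have /matrixP/(_ a b) := gmxT R v; rewrite mxE => ->; rewrite [RHS]mxE. Qed.

(** The indicator of q = 0 is half of 1 + [sg R (q v)], and this sign transposes g_v: the sum is the
    mean of two instances of [gmx_complete]. *)
Lemma quadric_sum a b c d : \sum_v (q v == 0)%:R * (g v a b * g v c d) =
  n%:R / 2 * (dl a c * dl b d + dl a d * dl b c).
Proof.
transitivity (2^-1 * (\sum_v g v a b * g v c d + \sum_v g v a b * g v d c)).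
  rewrite -big_split mulr_sumr; apply: eq_bigr => v _ /=.
  by rewrite singular_sg -(sg_gmx v c d); ring.
by rewrite !gmx_complete -!mulnb !natrM; ring.
Qed.

Lemma triple_sum a b c d e f :
  \sum_u \sum_v g u a b * (g v c d * (g u *m g v) e f) =
  n%:R ^+ 2 * (dl a e * dl b c * dl d f).
Proof.
transitivity (\sum_x (\sum_u g u a b * g u e x) * (\sum_v g v c d * g v x f)).
  under [RHS]eq_bigr => x _ do rewrite mulr_suml.
  rewrite [RHS]exchange_big; apply: eq_bigr => u _ /=.
  under [RHS]eq_bigr => x _ do rewrite mulr_sumr.
  rewrite [RHS]exchange_big; apply: eq_bigr => v _ /=.
  by rewrite [(g u *m g v) _ _]mxE !mulr_sumr; apply: eq_bigr => x _; ring.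
under eq_bigr => x _ do rewrite !gmx_complete -!mulnb !natrM.
rewrite (bigD1 c) //= big1 ?addr0 => [|x xc]; last first.
  by rewrite [c == x]eq_sym (negbTE xc) mul0r !mulr0.
by rewrite eqxx /=; ring.
Qed.

(** Each of the three indicators is a mean over transposing one of the three matrices, giving eight
    instances of [triple_sum]. *)
Lemma isotropic_pair_sum a b c d e f :
  \sum_u \sum_v ((q u == 0) && (q v == 0) && (q (u + v) == 0))%:R *
    (g u a b * (g v c d * (g u *m g v) e f)) =
  n%:R ^+ 2 / 8 * (dl a e * dl b c * dl d f + dl a f * dl b c * dl d e +
    dl a e * dl b d * dl c f + dl a f * dl b d * dl c e +
    dl b e * dl a c * dl d f + dl b f * dl a c * dl d e +
    dl b e * dl a d * dl c f + dl b f * dl a d * dl c e).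
Proof.
pose C a b c d e f := \sum_u \sum_v g u a b * (g v c d * (g u *m g v) e f).
transitivity (8^-1 * (C a b c d e f + C a b c d f e + C a b d c e f + C a b d c f e +
   C b a c d e f + C b a c d f e + C b a d c e f + C b a d c f e)); last first.
  by rewrite /C !triple_sum; field.
rewrite /C -!big_split mulr_sumr; apply: eq_bigr => u _ /=.
rewrite -!big_split mulr_sumr; apply: eq_bigr => v _ /=.
have sgM x y : sg R (q (u + v)) * (g u *m g v) x y = (g u *m g v) y x.
  by rewrite gmxM [X in _ * X]mxE mulrCA sg_gmx [RHS]mxE.
rewrite -!mulnb !natrM !singular_sg -(sg_gmx u a b) -(sg_gmx v c d) -(sgM e f).
by field.
Qed.

Section Subspace.
Variable S : {vspace F2k2 k}.
Hypotheses (tS : totally_isotropic S) (dS : \dim S = (k - s)%N).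

Let cS : #|S|%:R = w. Proof. by rewrite card_SE dS. Qed.

Let cC : #|characters S|%:R = w. Proof. by rewrite card_characters. Qed.

Let w0 : w != 0. Proof. by rewrite pnatr_eq0 expn_eq0. Qed.

Lemma PrjE psi a b : Prj R S psi a b = w^-1 * \sum_(v in S) ch R psi v * g v a b.
Proof.
rewrite [LHS]mxE summxE cS; congr (_ * _); apply: eq_bigr => v _.
by rewrite [LHS]mxE.
Qed.

Lemma sum_ch2 u v : u \in S -> v \in S ->
  \sum_(psi in characters S) ch R psi u * ch R psi v = w * dl u v.
Proof.
move=> uS vS; transitivity (\sum_(psi in characters S) ch R psi (u + v) * sg R (dotF2 u.2 v.1)).
  by apply: eq_bigr => psi psiS; rewrite (chM R psiS uS vS) -mulrA sg_sqr mulr1.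
rewrite -mulr_suml sum_ch ?memvD // cC addr_eq0 F2_oppv2.
case: eqVneq => [->|_]; last by rewrite !mulr0 mul0r.
by rewrite dotF2C -/(q v) (tiP tS vS) sg0 mulr1.
Qed.

Lemma sum_ch3 u v z : u \in S -> v \in S -> z \in S ->
  \sum_(psi in characters S) ch R psi u * (ch R psi v * ch R psi z) =
  w * dl z (u + v) * sg R (dotF2 u.2 v.1).
Proof.
move=> uS vS zS.
rewrite -[in RHS](eq_sym (u + v)) -sum_ch2 ?memvD // mulr_suml; apply: eq_bigr => psi psiS.
rewrite (chM R psiS uS vS) -!mulrA; congr (_ * (_ * _)).
by rewrite mulrC -mulrA sg_sqr mulr1.
Qed.

Lemma sum_Prj1 a b : \sum_(psi in characters S) Prj R S psi a b = dl a b.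
Proof.
under eq_bigr => psi _ do rewrite PrjE.
rewrite -mulr_sumr exchange_big /=.
under eq_bigr => v vS do rewrite -mulr_suml sum_ch // cC.
rewrite (bigD1 (0 : F2k2 k)) ?mem0v //= eqxx big1 => [|v /andP[_ /negbTE->]]; last first.
  by rewrite mulr0 mul0r.
by rewrite mulr1 addr0 gmx0 mxE mulKf.
Qed.

Lemma sum_Prj2 a b c d :
  \sum_(psi in characters S) Prj R S psi a b * Prj R S psi c d =
  w^-1 * \sum_(v in S) g v a b * g v c d.
Proof.
transitivity (w^-1 * w^-1 * \sum_(u in S) \sum_(v in S)
    (\sum_(psi in characters S) ch R psi u * ch R psi v) * (g u a b * g v c d)).
  transitivity (\sum_(psi in characters S) w^-1 * w^-1 * \sum_(u in S) \sum_(v in S)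
    (ch R psi u * ch R psi v) * (g u a b * g v c d)).
    apply: eq_bigr => psi _; rewrite !PrjE mulrACA big_distrlr; congr (_ * _).
    by apply: eq_bigr => u _; apply: eq_bigr => v _; rewrite mulrACA.
  rewrite -mulr_sumr; congr (_ * _); rewrite exchange_big; apply: eq_bigr => u _ /=.
  by rewrite exchange_big; apply: eq_bigr => v _ /=; rewrite mulr_suml.
rewrite -mulrA; congr (_ * _); rewrite mulr_sumr; apply: eq_bigr => u uS.
rewrite (bigD1 u) //= sum_ch2 // eqxx mulr1 big1 ?addr0 => [|v /andP[vS vu]].
  by rewrite mulKf.
by rewrite sum_ch2 // eq_sym (negbTE vu) mulr0 mul0r.
Qed.

(** Summing over the characters forces z = u + v, and the remaining sign is the one that turns g (u
    + v) into the product of g u and g v. *)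
Lemma sum_Prj3 a b c d e f :
  \sum_(psi in characters S) Prj R S psi a b * (Prj R S psi c d * Prj R S psi e f) =
  w^-1 ^+ 2 * \sum_(u in S) \sum_(v in S) g u a b * (g v c d * (g u *m g v) e f).
Proof.
transitivity (w^-1 ^+ 3 * \sum_(u in S) \sum_(v in S) \sum_(z in S)
    (\sum_(psi in characters S) ch R psi u * (ch R psi v * ch R psi z)) *
    (g u a b * (g v c d * g z e f))).
  transitivity (\sum_(psi in characters S) w^-1 ^+ 3 * \sum_(u in S) \sum_(v in S)
     \sum_(z in S) (ch R psi u * (ch R psi v * ch R psi z)) *
    (g u a b * (g v c d * g z e f))).
    have r3 (x A B C : R) : (x * A) * ((x * B) * (x * C)) = x ^+ 3 * (A * (B * C)).
      by ring.
    apply: eq_bigr => psi _; rewrite !PrjE r3; congr (_ * _).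
    rewrite mulr_suml; apply: eq_bigr => u _; rewrite big_distrlr mulr_sumr.
    by apply: eq_bigr => v _; rewrite mulr_sumr; apply: eq_bigr => z _ /=; ring.
  rewrite -mulr_sumr; congr (_ * _); rewrite exchange_big; apply: eq_bigr => u _ /=.
  rewrite exchange_big; apply: eq_bigr => v _ /=.
  by rewrite exchange_big; apply: eq_bigr => z _ /=; rewrite mulr_suml.
rewrite exprS -mulrA [w^-1 * _]mulrC -mulrA; congr (_ * _).
rewrite mulr_suml; apply: eq_bigr => u uS; rewrite mulr_suml; apply: eq_bigr => v vS.
rewrite (bigD1 (u + v)) ?memvD //= sum_ch3 ?memvD // eqxx mulr1.
rewrite big1 ?addr0 => [|z /andP[zS zuv]].
  have -> : (g u *m g v) e f = sg R (dotF2 u.2 v.1) * g (u + v) e f.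
    by rewrite gmxM [LHS]mxE.
  by rewrite mulrC !mulrA mulVf // mul1r; ring.
by rewrite sum_ch3 // (negbTE zuv) mulr0 !mul0r.
Qed.

End Subspace.

Section Family.
Variable Sigma : {set {vspace F2k2 k}}.
Hypothesis fam : isotropic_family s Sigma.
Let iso S : S \in Sigma -> totally_isotropic S. Proof. by case: fam => _ + _; apply. Qed.
Let dimS S : S \in Sigma -> \dim S = (k - s)%N. Proof. by case: fam => _ _; apply. Qed.

(** For each single S the projections sum to the identity, so the average is a multiple of one
    delta. *)
Lemma isotropic_mean_tensor1 : isotropic_tensor (@mean_tensor R k s Sigma 1).
Proof.
pose z : 'I_1 := ord0.
apply: (@eq_isotropic _ _ _ (fun i => \sum_(x <- [:: (w^-1, [:: ((z, false), (z, true))])])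
   x.1 * deltas R x.2 i)); last by apply: isotropic_comb.
move=> i; rewrite !big_cons !big_nil /deltas big_cons big_nil addr0 mulr1 /=.
rewrite -(avg_const fam (w^-1 * _)) /mean_tensor /avg; congr (_ * _).
apply: eq_bigr => S SS; have tS := iso SS; have dS := dimS SS.
under [RHS]eq_bigr => psi _ do rewrite /tpow big_ord1.
rewrite sum_Prj1 // sumr_const card_characters // card_SE dS -[(_ * _) *+ _]mulr_natl.
by rewrite mulVKf // pnatr_eq0 expn_eq0.
Qed.

End Family.

Section Full.
Local Notation X := (isotropic_subspaces k (k - s)).
Hypothesis X_neq0 : (0 < #|X|)%N.

Lemma full_family : isotropic_family s X.
Proof. by split=> // S; rewrite inE => /andP[tS /eqP dS]. Qed.

Lemma sum_full (G : F2k2 k -> F2k2 k -> R) :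
  \sum_(S in X) \sum_(u in S) \sum_(v in S) G u v =
  \sum_u \sum_v (pair_count (k - s) u v)%:R * G u v.
Proof.
transitivity (\sum_(S in X) \sum_u \sum_v ((u \in S) && (v \in S))%:R * G u v).
  apply: eq_bigr => S _; rewrite big_mkcond; apply: eq_bigr => u _ /=.
  case: (u \in S); last by rewrite big1 // => v _; rewrite mul0r.
  rewrite big_mkcond; apply: eq_bigr => v _ /=.
  by case: (v \in S); rewrite ?mul1r ?mul0r.
rewrite exchange_big; apply: eq_bigr => u _ /=.
rewrite exchange_big; apply: eq_bigr => v _ /=.
by rewrite -mulr_suml natr_sum.
Qed.

Lemma sum_full_line (K : F2k2 k -> R) :
  \sum_(S in X) \sum_(v in S) K v = \sum_v (pair_count (k - s) v v)%:R * K v.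
Proof.
transitivity (\sum_(S in X) \sum_v ((v \in S) && (v \in S))%:R * K v).
  apply: eq_bigr => S _; rewrite big_mkcond; apply: eq_bigr => v _ /=.
  by rewrite andbb; case: (v \in S); rewrite ?mul1r ?mul0r.
by rewrite exchange_big; apply: eq_bigr => v _ /=; rewrite -mulr_suml natr_sum.
Qed.

Lemma sum_delta (K : F2k2 k -> R) : \sum_(v : F2k2 k) (v == 0)%:R * K v = K 0.
Proof.
rewrite (bigD1 (0 : F2k2 k)) //= eqxx mul1r big1 ?addr0 // => v /negbTE->.
by rewrite mul0r.
Qed.

Lemma isotropic_mean_tensor2 : isotropic_tensor (@mean_tensor R k s X 2).
Proof.
have [c0 [c1 [c2 pcE]]] := pair_countE k (k - s) R.
have pc v : (pair_count (k - s) v v)%:R =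
    c1 * (q v == 0)%:R + (c0 - c1) * (v == 0)%:R.
  rewrite pcE F2_addvv2 q0 eqxx andbT andbb /=.
  by case: (eqVneq v 0) => [->|_] /=; rewrite ?q0 ?eqxx /=; ring.
pose a : 'I_2 * bool := (ord0, false); pose b : 'I_2 * bool := (ord0, true).
pose c : 'I_2 * bool := (lift ord0 ord0, false).
pose d : 'I_2 * bool := (lift ord0 ord0, true).
pose N := (#|X|%:R * w)^-1 * w^-1.
(* The first two pairings come from [quadric_sum] over the singular v, the last from v = 0; N joins
   the normalisation of [avg] to the factor of [sum_Prj2]. *)
apply: (@eq_isotropic _ _ _ (fun i => \sum_(x <- [::
    (N * (c1 * (n%:R / 2)), [:: (a, c); (b, d)]);
    (N * (c1 * (n%:R / 2)), [:: (a, d); (b, c)]);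
    (N * (c0 - c1), [:: (a, b); (c, d)])]) x.1 * deltas R x.2 i)); last first.
  exact: isotropic_comb.
move=> i; rewrite !big_cons !big_nil /deltas !big_cons !big_nil /=.
transitivity (N * \sum_v (pair_count (k - s) v v)%:R *
    (g v (i a) (i b) * g v (i c) (i d))).
  rewrite -mulrA.
  under eq_bigr => v _ do rewrite pc mulrDl -!mulrA.
  rewrite big_split /= -!mulr_sumr quadric_sum sum_delta gmx0 !mxE.
  by ring.
rewrite -sum_full_line /mean_tensor /avg /N -!mulrA; congr (_ * _).
rewrite mulr_sumr; apply: eq_bigr => S; rewrite inE => /andP[tS /eqP dS].
rewrite -sum_Prj2 //; apply: eq_bigr => psi _.
by rewrite /tpow big_ord_recl big_ord1.
Qed.

Lemma isotropic_mean_tensor3 : isotropic_tensor (@mean_tensor R k s X 3).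
Proof.
have [c0 [c1 [c2 pcE]]] := pair_countE k (k - s) R.
pose a : 'I_3 * bool := (ord0, false); pose b : 'I_3 * bool := (ord0, true).
pose c : 'I_3 * bool := (lift ord0 ord0, false).
pose d : 'I_3 * bool := (lift ord0 ord0, true).
pose e : 'I_3 * bool := (lift ord0 (lift ord0 ord0), false).
pose f : 'I_3 * bool := (lift ord0 (lift ord0 ord0), true).
pose N := (#|X|%:R * w)^-1 * w^-1 ^+ 2.
pose C := N * (c2 * (n%:R ^+ 2 / 8)).
pose D := N * ((c1 - c2) * (n%:R / 2)).
(* All 15 pairings of six slots. The eight with C join only slots of different factors and come from
   the totally isotropic pairs (u, v); those with D come, two each, from u = 0, v = 0 and u = v; the
   last one comes from u = v = 0. *)
apply: (@eq_isotropic _ _ _ (fun i => \sum_(x <- [::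
    (C, [:: (a, e); (b, c); (d, f)]); (C, [:: (a, f); (b, c); (d, e)]);
    (C, [:: (a, e); (b, d); (c, f)]); (C, [:: (a, f); (b, d); (c, e)]);
    (C, [:: (b, e); (a, c); (d, f)]); (C, [:: (b, f); (a, c); (d, e)]);
    (C, [:: (b, e); (a, d); (c, f)]); (C, [:: (b, f); (a, d); (c, e)]);
    (D, [:: (a, b); (c, e); (d, f)]); (D, [:: (a, b); (c, f); (d, e)]);
    (D, [:: (c, d); (a, e); (b, f)]); (D, [:: (c, d); (a, f); (b, e)]);
    (D, [:: (e, f); (a, c); (b, d)]); (D, [:: (e, f); (a, d); (b, c)]);
    (N * (c0 - 3 * c1 + 2 * c2), [:: (a, b); (c, d); (e, f)])])
    x.1 * deltas R x.2 i)); last first.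
  exact: isotropic_comb.
move=> i; rewrite !big_cons !big_nil /deltas !big_cons !big_nil /=.
pose G u v := g u (i a) (i b) * (g v (i c) (i d) * (g u *m g v) (i e) (i f)).
transitivity (N * \sum_u \sum_v (pair_count (k - s) u v)%:R * G u v); last first.
  rewrite -sum_full /mean_tensor /avg /N -[_ * _ ^+ 2 * _]mulrA; congr (_ * _).
  rewrite mulr_sumr; apply: eq_bigr => S; rewrite inE => /andP[tS /eqP dS].
  rewrite -sum_Prj3 //; apply: eq_bigr => psi _.
  by rewrite /tpow big_ord_recl big_ord_recl big_ord1.
have G0v v : G 0 v = dl (i a) (i b) * (g v (i c) (i d) * g v (i e) (i f)).
  by rewrite /G gmx0 mul1mx mxE.
have Gu0 u : G u 0 = dl (i c) (i d) * (g u (i a) (i b) * g u (i e) (i f)).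
  by rewrite /G gmx0 mulmx1 [(1%:M : 'M[R]_n) _ _]mxE; ring.
have Guu u : (q u == 0)%:R * G u u = dl (i e) (i f) *
    ((q u == 0)%:R * (g u (i a) (i b) * g u (i c) (i d))).
  have -> : G u u = g u (i a) (i b) * (g u (i c) (i d) * (sg R (q u) * dl (i e) (i f))).
    by rewrite /G gmxM F2_addvv2 gmx0 dotF2C -/(q u) scalemx1 [_%:M _ _]mxE mulr_natr.
  by case: (F2P (q u)) => ->; rewrite ?sg0 ?oner_eq0 ?eqxx /=; ring.
have -> : \sum_u \sum_v (pair_count (k - s) u v)%:R * G u v =
   c2 * (\sum_u \sum_v ((q u == 0) && (q v == 0) && (q (u + v) == 0))%:R * G u v) +
   (c1 - c2) * (\sum_v (q v == 0)%:R * G 0 v + \sum_u (q u == 0)%:R * G u 0 +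
                \sum_u (q u == 0)%:R * G u u) +
   (c0 - 3 * c1 + 2 * c2) * G 0 0.
  transitivity (\sum_u (c2 * (\sum_v ((q u == 0) && (q v == 0) && (q (u + v) == 0))%:R * G u v)
     + (c1 - c2) * ((u == 0)%:R * (\sum_v (q v == 0)%:R * G u v) + (q u == 0)%:R * G u 0
        + (q u == 0)%:R * G u u)
     + (c0 - 3 * c1 + 2 * c2) * ((u == 0)%:R * G u 0))); last first.
    by rewrite !big_split /= -!mulr_sumr !big_split /= !sum_delta.
  apply: eq_bigr => u _; rewrite -[G u 0](sum_delta (G u)) -[G u u](_ : \sum_v (u == v)%:R * G u v = _).
    rewrite !mulr_sumr -!big_split !mulr_sumr -!big_split /=.
    by apply: eq_bigr => v _; rewrite pcE; ring.
  rewrite (bigD1 u) //= eqxx mul1r big1 ?addr0 // => v; rewrite eq_sym => /negbTE->.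
  by rewrite mul0r.
under [X in _ + _ * (X + _ + _)]eq_bigr => v _ do rewrite G0v mulrCA.
under [X in _ + _ * (_ + X + _)]eq_bigr => u _ do rewrite Gu0 mulrCA.
under [X in _ + _ * (_ + _ + X)]eq_bigr => u _ do rewrite Guu.
rewrite -!mulr_sumr !quadric_sum isotropic_pair_sum G0v gmx0 !mxE /C /D.
by ring.
Qed.

End Full.

End MeanTensors.

Definition tau (ab : nat * nat) (c : nat) : nat :=
  if c == ab.1 then ab.2 else if c == ab.2 then ab.1 else c.

(** * Young symmetrizers as sums over words of transpositions *)

Section Words.
Variables (R : realType) (n D : nat).
Local Notation d := D.+1.
Local Notation word := (seq (nat * nat)).
Implicit Types (r : nat -> nat) (w : word) (i : {ffun 'I_d -> 'I_n}).

(* Words of transpositions act on index functions from nat, on which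
   polynomial identities in the entries of a matrix are decided by [ring]. *)
Fixpoint act w (f : nat -> 'I_n) : nat -> 'I_n :=
  if w is ab :: w' then fun c => act w' f (tau ab c) else f.

Definition valid r (ab : nat * nat) : bool :=
  [&& (ab.1 < d)%N, (ab.2 < d)%N, ab.1 != ab.2 & r ab.1 == r ab.2].

Definition pw w : 'S_d := (\prod_(ab <- w) tperm (inord ab.1) (inord ab.2))%g.

Definition fn i (c : nat) : 'I_n := i (inord c).

Definition preserving r : {set 'S_d} := [set p : 'S_d | [forall a, r (p a) == r a]].

Lemma preservingP r (p : 'S_d) : reflect (forall a, r (p a) = r a) (p \in preserving r).
Proof. by rewrite inE; apply: (iffP forallP) => h a; apply/eqP. Qed.

Lemma preservingM r (p s : 'S_d) : s \in preserving r ->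
  ((s * p)%g \in preserving r) = (p \in preserving r).
Proof.
move=> /preservingP sr; apply/preservingP/preservingP => h a; last by rewrite permM h sr.
by have := h ((s^-1)%g a); rewrite permM permKV => ->; rewrite -{2}[a](permKV s) sr.
Qed.

Lemma tau_lt ab c : (ab.1 < d)%N -> (ab.2 < d)%N -> (c < d)%N -> (tau ab c < d)%N.
Proof. by rewrite /tau; case: ifP => // _; case: ifP. Qed.

Lemma inord_inj a b : (a < d)%N -> (b < d)%N ->
  ((inord a : 'I_d) == inord b) = (a == b).
Proof. by move=> ad bd; rewrite -val_eqE /= !inordK. Qed.

Lemma tperm_inord ab c : (ab.1 < d)%N -> (ab.2 < d)%N -> (c < d)%N ->
  tperm (inord ab.1) (inord ab.2) (inord c : 'I_d) = inord (tau ab c).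
Proof.
move=> ad bd cd; rewrite permE /= !inord_inj // /tau.
by case: ifP => // _; case: ifP.
Qed.

Lemma fn_pw r w i c : all (valid r) w -> (c < d)%N ->
  fn [ffun a => i (pw w a)] c = act w (fn i) c.
Proof.
rewrite /fn /pw; elim: w c => [c _ _|ab w IHw c /= /andP[/and4P[ad bd _ _] /IHw h] cd].
  by rewrite big_nil ffunE perm1.
rewrite big_cons ffunE permM tperm_inord // -h ?tau_lt //.
by rewrite ffunE.
Qed.

Lemma act_local w f f' c : all (fun ab => (ab.1 < d)%N && (ab.2 < d)%N) w ->
  (forall c, (c < d)%N -> f c = f' c) -> (c < d)%N -> act w f c = act w f' c.
Proof.
move=> + ff'; elim: w c => [|ab w IHw] c /=; first by move=> _; apply: ff'.
by case/andP=> /andP[ad bd] h cd; apply: IHw; rewrite ?tau_lt.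
Qed.

Lemma odd_pw r w : all (valid r) w -> odd_perm (pw w) = odd (size w).
Proof.
rewrite /pw; elim: w => [|ab w IHw] /=; first by rewrite big_nil odd_perm1.
case/andP=> /and4P[ad bd ab' _] /IHw h; rewrite big_cons odd_permM h odd_tperm.
by rewrite inord_inj // ab'.
Qed.

Lemma pw_preserving r w : all (valid r) w -> pw w \in preserving r.
Proof.
rewrite /pw; elim: w => [|ab w IHw] /=.
  by rewrite big_nil => _; apply/preservingP => a; rewrite perm1.
case/andP=> /and4P[ad bd _ /eqP rab] /IHw h; rewrite big_cons preservingM //.
apply/preservingP => a; case: tpermP => [->|->|//]; by rewrite !inordK.
Qed.

(** Induction on the number of moved points: p followed by the transposition of a and p a fixes a
    and every fixed point of p. *)
Lemma transposition_generation r (s : bool) (U : {ffun 'I_d -> 'I_n} -> R) :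
  (forall a b : 'I_d, a != b -> r a = r b -> forall i,
     U [ffun c => i (tperm a b c)] = (-1) ^+ s * U i) ->
  forall p, p \in preserving r -> forall i,
    U [ffun c => i (p c)] = (-1) ^+ (s && odd_perm p) * U i.
Proof.
move=> Usym p; have [N] := ubnP #|[set a | p a != a]|.
elim: N p => // N IHN p /ltnSE-leN pr i.
have [/existsP[a pa]|nofix] := boolP [exists a, p a != a]; last first.
  have -> : p = 1%g.
    apply/permP => a; rewrite perm1; apply/eqP.
    by move: nofix; rewrite negb_exists => /forallP/(_ a); rewrite negbK.
  rewrite odd_perm1 andbF expr0 mul1r; congr U.
  by apply/ffunP => a; rewrite ffunE perm1.
have /preservingP rp := pr.
pose t := tperm a (p a); pose p' := (p * t)%g.
have pE : p = (p' * t)%g by rewrite /p' -mulgA tperm2 mulg1.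
have p'r : p' \in preserving r.
  apply/preservingP => c; rewrite permM /t; case: tpermP => [e|/perm_inj->|_ _].
  - by rewrite rp -[in RHS](rp c) e.
  - by [].
  exact: rp.
have lt : (#|[set c | p' c != c]| < N)%N.
  apply: leq_trans leN; rewrite [X in (_ < X)%N](cardsD1 a) inE pa ltnS.
  apply: subset_leq_card; apply/fintype.subsetP => c; rewrite !inE permM /t.
  have [->|ca] := eqVneq c a; first by rewrite tpermR eqxx.
  apply: contra => /eqP pc; rewrite pc tpermD // 1?eq_sym //.
  by apply: contra ca => /eqP e; rewrite -(inj_eq (@perm_inj _ p)) pc e.
have -> : [ffun c => i (p c)] = [ffun c => [ffun c' => i (t c')] (p' c)].
  by apply/ffunP => c; rewrite !ffunE [in LHS]pE permM.
rewrite (IHN _ lt p'r) /t Usym ?rp 1?eq_sym // mulrA; congr (_ * _).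
rewrite [in RHS]pE odd_permM odd_tperm eq_sym pa addbT.
by case: (s); case: (odd_perm p'); rewrite /= ?expr0 ?expr1 ?mulrNN ?mulr1 ?mul1r.
Qed.

Section Symmetrizer.
Variables (r : nat -> nat) (s : bool) (F : (nat -> 'I_n) -> R) (B : seq word).
Hypothesis Flocal : forall f f', (forall c, (c < d)%N -> f c = f' c) -> F f = F f'.
Hypothesis Bvalid : all (all (valid r)) B.

Definition word_sum (f : nat -> 'I_n) : R :=
  \sum_(w <- B) (-1) ^+ (s && odd (size w)) * F (act w f).

Hypothesis word_sum_sym : forall a b, (a < b)%N -> (b < d)%N -> r a = r b ->
  forall f, word_sum (fun c => f (tau (a, b) c)) = (-1) ^+ s * word_sum f.

Lemma word_sum_local f f' : (forall c, (c < d)%N -> f c = f' c) ->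
  word_sum f = word_sum f'.
Proof.
move=> ff'; rewrite /word_sum big_seq [RHS]big_seq; apply: eq_bigr => w wB.
congr (_ * _); apply: Flocal => c cd; apply: act_local => //.
by apply: sub_all (allP Bvalid w wB) => ab /and4P[-> ->].
Qed.

(** The word sum is already symmetric, or antisymmetric, under the group, so symmetrising it
    multiplies it by the group order. On the other hand each word lies in the group and is absorbed
    by reindexing, which gives [size B] copies of the full sum. Thus B need not be shown to
    represent cosets. *)
Lemma symmetrizer_word_sum i :
  (size B)%:R * \sum_(p in preserving r)
     (-1) ^+ (s && odd_perm p) * F (fn [ffun c => i (p c)]) =
  #|preserving r|%:R * word_sum (fn i).
Proof.
have sgn_sqr (b : bool) : (-1) ^+ b * (-1) ^+ b = 1 :> R by rewrite -expr2 sqrr_sign.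
have Usym (a b : 'I_d) : a != b -> r a = r b -> forall i,
    word_sum (fn [ffun c => i (tperm a b c)]) = (-1) ^+ s * word_sum (fn i).
  wlog ab : a b / (a < b)%N.
    move=> IH ab rab j; case: (ltngtP a b) => [lt|lt|/val_inj e]; first exact: IH.
      by rewrite tpermC IH // eq_sym.
    by rewrite e eqxx in ab.
  move=> _ rab j; rewrite -(word_sum_sym ab (ltn_ord b) rab).
  apply: word_sum_local => c cd; rewrite /fn ffunE; congr (j _).
  by rewrite -{1}[a]inord_val -{1}[b]inord_val (@tperm_inord (val a, val b)) ?ltn_ord.
have Uperm := transposition_generation Usym.
transitivity (\sum_(p in preserving r) (-1) ^+ (s && odd_perm p) *
    word_sum (fn [ffun c => i (p c)])); last first.
  under eq_bigr => p pr do rewrite Uperm // mulrA sgn_sqr mul1r.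
  by rewrite sumr_const -[_ *+ #|_|]mulr_natl.
under [RHS]eq_bigr => p _ do rewrite mulr_sumr.
rewrite [RHS]exchange_big /= big_seq.
under [RHS]eq_bigr => w wB.
  have wv := allP Bvalid w wB.
  rewrite (_ : \sum_(p in preserving r) _ = \sum_(p in preserving r)
     (-1) ^+ (s && odd_perm p) * F (fn [ffun c => i (p c)])).
    over.
  rewrite [RHS](reindex_inj (mulgI (pw w))) /=.
  apply: eq_big => [p|p _]; first by rewrite preservingM ?pw_preserving.
  rewrite mulrA odd_permM (odd_pw wv); congr (_ * _).
    by case: (s) => /=; rewrite ?mulr1 // mulrC -signr_addb.
  apply: Flocal => c cd; rewrite -(fn_pw _ wv cd).
  by rewrite /fn !ffunE permM.
by rewrite -big_seq big_const_seq count_predT iter_addr_0 [LHS]mulr_natl.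
Qed.

End Symmetrizer.

Definition symmetrize r1 r2 (T : {ffun 'I_d -> 'I_n} -> R) i : R :=
  \sum_(p in preserving r1) \sum_(q in preserving r2)
    (-1) ^+ odd_perm q * T [ffun a => i (q (p a))].

Lemma symmetrize_words r1 r2 F A B i :
  (forall f f', (forall c, (c < d)%N -> f c = f' c) -> F f = F f') ->
  all (all (valid r1)) A -> all (all (valid r2)) B ->
  (forall a b, (a < b)%N -> (b < d)%N -> r1 a = r1 b -> forall f,
     word_sum false F A (fun c => f (tau (a, b) c)) = word_sum false F A f) ->
  (forall a b, (a < b)%N -> (b < d)%N -> r2 a = r2 b -> forall f,
     word_sum true (word_sum false F A) B (fun c => f (tau (a, b) c)) =
     - word_sum true (word_sum false F A) B f) ->
  (size A)%:R * (size B)%:R * symmetrize r1 r2 (fun i => F (fn i)) i =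
  #|preserving r1|%:R * #|preserving r2|%:R *
    word_sum true (word_sum false F A) B (fn i).
Proof.
move=> Fl vA vB symA symB.
have symA' a b : (a < b)%N -> (b < d)%N -> r1 a = r1 b -> forall f,
     word_sum false F A (fun c => f (tau (a, b) c)) = (-1) ^+ false * word_sum false F A f.
  by move=> *; rewrite mul1r symA.
have symB' a b : (a < b)%N -> (b < d)%N -> r2 a = r2 b -> forall f,
     word_sum true (word_sum false F A) B (fun c => f (tau (a, b) c)) =
     (-1) ^+ true * word_sum true (word_sum false F A) B f.
  by move=> *; rewrite mulN1r symB.
have eA := symmetrizer_word_sum Fl vA symA'.
have Ul : forall f f', (forall c, (c < d)%N -> f c = f' c) ->
    word_sum false F A f = word_sum false F A f'.
  by move=> f f' ff'; apply: (@word_sum_local r1 false F A Fl vA f f' ff').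
have eB := symmetrizer_word_sum Ul vB symB'.
transitivity (#|preserving r1|%:R * ((size B)%:R * \sum_(q in preserving r2)
    (-1) ^+ (true && odd_perm q) * word_sum false F A (fn [ffun c => i (q c)]))); last first.
  by rewrite eB mulrA.
rewrite [(size A)%:R * _]mulrC -mulrA [RHS]mulrCA; congr (_ * _).
rewrite /symmetrize exchange_big !mulr_sumr; apply: eq_bigr => q _ /=.
rewrite [RHS]mulrCA -eA -mulr_sumr mulrCA; congr (_ * (_ * _)).
apply: eq_bigr => p _; rewrite mul1r; congr (F (fn _)).
by apply/ffunP => c; rewrite !ffunE.
Qed.

End Words.

Section ConcreteSymmetrizers.
Variables (R : realType) (n : nat) (P : 'M[R]_n).
Hypothesis PT : P^T = P.

Lemma symP x y : P x y = P y x.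
Proof. by rewrite -{1}PT mxE. Qed.

Definition pair2 (f : nat -> 'I_n) : R := P (f 0) (f 1) * P (f 2) (f 3).
Definition pair3 (f : nat -> 'I_n) : R := P (f 0) (f 1) * P (f 2) (f 3) * P (f 4) (f 5).

Ltac sortP f := rewrite
  ?(symP (f 1) (f 0)) ?(symP (f 2) (f 0)) ?(symP (f 3) (f 0)) ?(symP (f 4) (f 0))
  ?(symP (f 5) (f 0)) ?(symP (f 2) (f 1)) ?(symP (f 3) (f 1)) ?(symP (f 4) (f 1))
  ?(symP (f 5) (f 1)) ?(symP (f 3) (f 2)) ?(symP (f 4) (f 2)) ?(symP (f 5) (f 2))
  ?(symP (f 4) (f 3)) ?(symP (f 5) (f 3)) ?(symP (f 5) (f 4)).

(* The words in [A_] represent the row group, and those in [B_] the column group,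
   modulo permutations fixing the tensor, so that a sum over the group is a
   multiple of a sum over words. *)
Definition A6 : seq (seq (nat * nat)) :=
  [:: [::]; [:: (1, 2)]; [:: (1, 3)]; [:: (1, 4)]; [:: (1, 5)];
      [:: (3, 4)]; [:: (3, 4); (1, 2)]; [:: (3, 4); (1, 3)]; [:: (3, 4); (1, 4)]; [:: (3, 4); (1, 5)];
      [:: (3, 5)]; [:: (3, 5); (1, 2)]; [:: (3, 5); (1, 3)]; [:: (3, 5); (1, 4)]; [:: (3, 5); (1, 5)]]%N.

Ltac sym_check f := rewrite /word_sum !big_cons !big_nil /= /pair3 /pair2 /tau /=; sortP f; ring.

Ltac all_pairs := let a := fresh in let b := fresh in
  move=> a b; case: b => [|[|[|[|[|[|//]]]]]]; case: a => [|[|[|[|[|//]]]]] //.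

Definition A4 : seq (seq (nat * nat)) := [:: [::]; [:: (1, 2)]; [:: (1, 3)]]%N.
Definition B22 : seq (seq (nat * nat)) := [:: [::]; [:: (0, 2)]]%N.
Definition B42 : seq (seq (nat * nat)) :=
  [:: [::]; [:: (0, 4)]; [:: (1, 5)]; [:: (0, 4); (1, 5)]]%N.
Definition B222 : seq (seq (nat * nat)) :=
  [:: [::]; [:: (0, 2)]; [:: (0, 4)]; [:: (2, 4)]; [:: (0, 2); (2, 4)]; [:: (2, 4); (0, 2)]]%N.
Definition I0 : seq (seq (nat * nat)) := [:: [::]].

Definition young_words F A B := @word_sum R n true (@word_sum R n false F A) B.

Lemma pair2_local f f' : (forall c, (c < 4)%N -> f c = f' c) -> pair2 f = pair2 f'.
Proof. by move=> ff'; rewrite /pair2 !ff'. Qed.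

Lemma pair3_local f f' : (forall c, (c < 6)%N -> f c = f' c) -> pair3 f = pair3 f'.
Proof. by move=> ff'; rewrite /pair3 !ff'. Qed.

Local Notation row_sym r d F A := (forall a b, (a < b)%N -> (b < d)%N -> r a = r b ->
  forall f, @word_sum R n false F A (fun c => f (tau (a, b) c)) = word_sum false F A f).
Local Notation col_antisym r d F A B := (forall a b, (a < b)%N -> (b < d)%N -> r a = r b ->
  forall f, young_words F A B (fun c => f (tau (a, b) c)) = - young_words F A B f).

Lemma row_sym4 : row_sym (reshape_index [:: 4]%N) 4 pair2 A4.
Proof. by all_pairs; move=> _ _ _ f; sym_check f. Qed.

Lemma col_antisym4 : col_antisym (reshape_offset [:: 4]%N) 4 pair2 A4 I0.
Proof. by all_pairs. Qed.

Lemma row_sym22 : row_sym (reshape_index [:: 2; 2]%N) 4 pair2 I0.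
Proof. by all_pairs; move=> _ _ _ f; sym_check f. Qed.

Lemma col_antisym22 : col_antisym (reshape_offset [:: 2; 2]%N) 4 pair2 I0 B22.
Proof. by all_pairs; move=> _ _ _ f; rewrite /young_words; sym_check f. Qed.

Lemma row_sym6 : row_sym (reshape_index [:: 6]%N) 6 pair3 A6.
Proof. by all_pairs; move=> _ _ _ f; sym_check f. Qed.

Lemma col_antisym6 : col_antisym (reshape_offset [:: 6]%N) 6 pair3 A6 I0.
Proof. by all_pairs. Qed.

Lemma row_sym42 : row_sym (reshape_index [:: 4; 2]%N) 6 pair3 A4.
Proof. by all_pairs; move=> _ _ _ f; sym_check f. Qed.

Lemma col_antisym42 : col_antisym (reshape_offset [:: 4; 2]%N) 6 pair3 A4 B42.
Proof. by all_pairs; move=> _ _ _ f; rewrite /young_words; sym_check f. Qed.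

Lemma row_sym222 : row_sym (reshape_index [:: 2; 2; 2]%N) 6 pair3 I0.
Proof. by all_pairs; move=> _ _ _ f; sym_check f. Qed.

Lemma col_antisym222 : col_antisym (reshape_offset [:: 2; 2; 2]%N) 6 pair3 I0 B222.
Proof. by all_pairs; move=> _ _ _ f; rewrite /young_words; sym_check f. Qed.

Local Notation "x :/ y" := (x%:R / y%:R : R) (at level 40).

(* Solutions of the linear system expressing the t-th tensor power of a symmetric
   matrix by translates of its images under the Young symmetrizers of the shapes
   2mu, |mu| = t. *)
Definition L4 : seq (R * seq (nat * nat)) := [:: (1 :/ 3, [::])].
Definition L22 : seq (R * seq (nat * nat)) := [:: (1 :/ 3, [::]); (1 :/ 3, [:: (0, 1)%N])].
Definition L6 : seq (R * seq (nat * nat)) := [:: (1 :/ 15, [::])].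
Definition L42 : seq (R * seq (nat * nat)) :=
  [:: (3 :/ 20, [::]); (1 :/ 20, [:: (0, 1)%N]); (- (1 :/ 20), [:: (0, 3)%N]);
      (- (1 :/ 20), [:: (1, 2)%N]); (- (1 :/ 20), [:: (0, 2); (3, 5)]%N);
      (- (1 :/ 20), [:: (1, 3); (2, 4)]%N); (1 :/ 10, [:: (0, 3); (1, 2)]%N)].
Definition L222 : seq (R * seq (nat * nat)) :=
  [:: (1 :/ 12, [::]); (1 :/ 12, [:: (2, 3)%N]); (1 :/ 12, [:: (0, 1)%N]);
      (1 :/ 12, [:: (4, 5)%N])].

Ltac dec_check f :=
  rewrite /young_words /word_sum !big_cons !big_nil /= /pair3 /pair2 /tau /=; sortP f; field.

Lemma decomposition4 f : pair2 f = \sum_(x <- L4) x.1 * young_words pair2 A4 I0 (act x.2 f) +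
  \sum_(x <- L22) x.1 * young_words pair2 I0 B22 (act x.2 f).
Proof. by dec_check f. Qed.

Lemma decomposition6 f : pair3 f = \sum_(x <- L6) x.1 * young_words pair3 A6 I0 (act x.2 f) +
  \sum_(x <- L42) x.1 * young_words pair3 A4 B42 (act x.2 f) +
  \sum_(x <- L222) x.1 * young_words pair3 I0 B222 (act x.2 f).
Proof. by dec_check f. Qed.

End ConcreteSymmetrizers.

(** * From designs to moments *)

Section ZonalContractions.
Variables (R : realType) (n : nat).
Import numFieldNormedType.Exports.

Lemma continuous_bigsum (V : topologicalType) (J : finType) (F : J -> V -> R) :
  (forall j, continuous (F j)) -> continuous (fun x => \sum_j F j x).
Proof.
move=> Fc x; pose G s y := \sum_(j <- s) F j y.
suff Gc : continuous (G (index_enum J)) by exact: Gc.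
elim: (index_enum J) => [|j s IHs] y.
  by rewrite /G; under eq_fun do rewrite big_nil; apply: cvg_cst.
rewrite /G; under eq_fun do rewrite big_cons.
by apply: continuousD; [apply: Fc|apply: IHs].
Qed.

Lemma continuous_bigprod (V : topologicalType) (J : finType) (F : J -> V -> R) :
  (forall j, continuous (F j)) -> continuous (fun x => \prod_j F j x).
Proof.
move=> Fc x; pose G s y := \prod_(j <- s) F j y.
suff Gc : continuous (G (index_enum J)) by exact: Gc.
elim: (index_enum J) => [|j s IHs] y.
  by rewrite /G; under eq_fun do rewrite big_nil; apply: cvg_cst.
rewrite /G; under eq_fun do rewrite big_cons.
by apply: continuousM; [apply: Fc|apply: IHs].
Qed.

Lemma continuous_ctr d t (phi : 'I_t * bool -> 'I_d) (P : 'M[R]_n) (T : tensor R n d) :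
  continuous (fun g : 'M[R]_n => ctr phi (g *m P *m g^T) T).
Proof.
have cst_c (c : R) : continuous (fun _ : 'M[R]_n => c).
  by move=> x; apply: (@cvg_cst _ c _ _ (nbhs_filter x)).
rewrite /ctr; apply: continuous_bigsum => i g.
apply: continuousM; first exact: cst_c.
move: g; apply: continuous_bigprod => c.
have -> : (fun g : 'M[R]_n => (g *m P *m g^T) (i (phi (c, false))) (i (phi (c, true)))) =
   (fun g => \sum_y (\sum_x g (i (phi (c, false))) x * P x y) * g (i (phi (c, true))) y).
  by apply/funext => g; rewrite mxE; apply: eq_bigr => y _; rewrite !mxE.
apply: continuous_bigsum => y g; apply: continuousM; last exact: coord_continuous.
move: g; apply: continuous_bigsum => x g.
by apply: continuousM; [exact: coord_continuous|exact: cst_c].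
Qed.

(** Supplies the test functions of the converse: the contraction is equivariant in T, and continuous
    because it is polynomial in the entries of g. *)
Lemma H2_of_ctr m mu (phi : 'I_(sumn mu) * bool -> 'I_(sumn (twice mu)))
    (T : tensor R n (sumn (twice mu))) : bijective phi -> weyl_module T ->
  H2 m mu (fun U => ctr phi (projm U) T).
Proof.
move=> phiB TW; exists (fun T U => ctr phi (projm U) T); split; last by exists T.
- move=> T' _ U _.
  apply: (@subspace_eq_continuous _ _ _ (fun g : 'M[R]_n => ctr phi (g *m projm U *m g^T) T')).
    by move=> g; rewrite inE /= => gO; rewrite /from_subspace projm_actG.
  by apply: continuous_subspaceT; apply: continuous_ctr.
- by move=> c T1 T2 _ _ U _; apply: ctr_lin.
move=> g T' gO _ U _; rewrite ctr_actT // projm_actG // !mulmxA gO mul1mx.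
by rewrite -mulmxA gO mulmx1.
Qed.

End ZonalContractions.

(** * Young images of traceless tensors, and shapes with more than m rows *)

Section YoungSymmetry.
Variables (R : realType) (n : nat).

(** Permuting the slots only changes which pair is contracted. The Young image of a traceless tensor
    therefore lies in the Weyl module. *)
Lemma traceless_young_symmetrizer la (T : tensor R n (sumn la)) :
  traceless T -> traceless (young_symmetrizer T).
Proof.
move=> Ttr a b ab i; under eq_bigr => l _ do rewrite ffunE.
rewrite exchange_big big1 // => p _; rewrite exchange_big big1 // => r _ /=.
rewrite -mulr_sumr; pose u := (p * r)%g.
rewrite -[RHS](mulr0 ((-1) ^+ odd_perm r)); congr (_ * _).
have uab : (u^-1)%g a != (u^-1)%g b by rewrite (inj_eq perm_inj).
rewrite -[RHS](tracelessE Ttr uab [ffun c => i (u c)]); apply: eq_bigr => l _.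
congr (T _); apply/ffunP => c; rewrite !ffunE -(permM p r) -/u.
by rewrite -{1}[a](permKV u) -{1}[b](permKV u) !(inj_eq perm_inj).
Qed.

Lemma young_symmetrizer_col la (T : tensor R n (sumn la)) r
    (i : {ffun 'I_(sumn la) -> 'I_n}) : r \in col_group la ->
  young_symmetrizer T [ffun c => i (r c)] = (-1) ^+ odd_perm r * young_symmetrizer T i.
Proof.
move=> rC; rewrite !ffunE mulr_sumr; apply: eq_bigr => p _.
rewrite mulr_sumr (reindex_inj (mulIg (r^-1)%g)) /=.
apply: eq_big => [u|u _].
  rewrite !inE; apply/forallP/forallP => h a.
    have := h a; rewrite permM => /eqP <-; move: rC; rewrite inE => /forallP.
    by move=> /(_ ((r^-1)%g (u a))); rewrite permKV.
  rewrite permM -(eqP (h a)); move: rC; rewrite inE => /forallP.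
  by move=> /(_ ((r^-1)%g (u a))); rewrite permKV eq_sym.
rewrite mulrA odd_permM odd_permV [_ (+) _]addbC signr_addb; congr (_ * T _).
by apply/ffunP => a; rewrite !ffunE permM permKV.
Qed.

(* With P = B B^T, B of width m, antisymmetry in more than m slots forces a
   repeated column of B. *)
Lemma ctr_antisymmetric l m d t (phi : 'I_t * bool -> 'I_d) (h : 'I_l -> 'I_d)
    (U : {vspace 'cV[R]_n}) (Y : tensor R n d) :
  bijective phi -> injective h -> Gr m U -> (m < l)%N ->
  (forall x y : 'I_l, x != y ->
     forall i : {ffun 'I_d -> 'I_n}, Y [ffun c => i (tperm (h x) (h y) c)] = - Y i) ->
  ctr phi (projm U) Y = 0.
Proof.
move=> phiB hI GU ml Yanti; have [B _ ->] := Gr_frame GU.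
have [psi phiK psiK] := phiB.
transitivity (\sum_(i : {ffun 'I_d -> 'I_n}) \sum_(y : {ffun 'I_t -> 'I_m})
    Y i * \prod_a B (i a) (y (psi a).1)).
  apply: eq_bigr => i _; rewrite -mulr_sumr; congr (_ * _).
  under eq_bigr => c _ do rewrite mxE.
  rewrite bigA_distr_bigA; apply: eq_bigr => y _ /=.
  rewrite (prod_matching (fun a => B (i a) (y (psi a).1)) phiB).
  by apply: eq_bigr => c _; rewrite !phiK /= [B^T _ _]mxE.
rewrite exchange_big big1 // => y _ /=; pose z a := y (psi a).1.
have [x [x' [xx' zxx']]] : exists x x', x != x' /\ z (h x) = z (h x').
  have : ~~ injectiveb (z \o h).
    by apply/negP => /injectiveP/leq_card; rewrite !card_ord leqNgt ml.
  by case/injectivePn=> x [x' xx' e]; exists x, x'.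
set G := \sum_i _; suff : G = - G by move/eqP; rewrite -addr_eq0 -mulr2n mulrn_eq0 => /eqP.
pose r := tperm (h x) (h x').
rewrite {1}/G (reindex (fun i : {ffun 'I_d -> 'I_n} => [ffun c => i (r c)])) /=.
  rewrite /G -sumrN; apply: eq_bigr => i _; rewrite Yanti // mulNr; congr (- (_ * _)).
  rewrite (reindex_inj (@perm_inj _ r)); apply: eq_bigr => a _ /=; rewrite ffunE tpermK.
  congr (B _ _); rewrite -!/(z _) /r; case: tpermP => [->|->|//]; by rewrite zxx'.
by apply: onW_bij; exists (fun i : {ffun 'I_d -> 'I_n} => [ffun c => i (r c)]) => i;
   apply/ffunP => a; rewrite !ffunE tpermK.
Qed.

(** [h] lists the boxes of the first column, one in each row; Y is antisymmetric in these more than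
    m slots. *)
Lemma ctr_many_rows m mu t (phi : 'I_t * bool -> 'I_(sumn (twice mu)))
    (U : {vspace 'cV[R]_n}) (Y : tensor R n (sumn (twice mu))) :
  bijective phi -> 0%N \notin mu -> Gr m U -> (m < size mu)%N -> weyl_module Y ->
  ctr phi (projm U) Y = 0.
Proof.
move=> phiB mu0 GU mmu [_ [T YE]]; set la := twice mu in phi phiB Y T YE *.
have la_gt0 (x : 'I_(size mu)) : (0 < nth 0%N la x)%N.
  rewrite (nth_map 0%N) ?ltn_ord // muln_gt0 /= lt0n.
  by apply: contraNneq mu0 => <-; rewrite mem_nth.
pose h (x : 'I_(size mu)) := Ordinal (flatten_indexP (la_gt0 x)).
have hI : injective h.
  move=> x y e; apply: val_inj => /=.
  rewrite -(flatten_indexKl (la_gt0 x)) -(flatten_indexKl (la_gt0 y)).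
  by congr reshape_index; apply: (congr1 val e).
apply: (ctr_antisymmetric phiB hI GU mmu) => x y xy i.
rewrite YE young_symmetrizer_col; first by rewrite odd_tperm (inj_eq hI) xy mulN1r.
rewrite inE; apply/forallP => a; case: tpermP => [->|->|//] /=; apply/eqP.
  by rewrite !flatten_indexKr ?la_gt0.
by rewrite !flatten_indexKr ?la_gt0.
Qed.

End YoungSymmetry.

Section DesignAverages.
Variables (R : realType) (k s : nat).
Hypothesis sk : (s <= k)%N.
Local Notation n := (2 ^ k)%N.
Variable Sigma : {set {vspace F2k2 k}}.
Hypothesis fam : isotropic_family s Sigma.

Lemma avg_eq0 (F : 'M[R]_n -> R) :
  (forall U, Gr (2 ^ s) U -> F (projm U) = 0) -> avg s Sigma F = 0.
Proof.
move=> F0; rewrite -[RHS](avg_const fam); have [_ iso dS] := fam.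
apply: eq_avg => S psi SS psiS; rewrite -projm_Wsp ?iso //; apply: F0.
by apply: (dim_Wsp _ sk); rewrite ?iso ?dS.
Qed.

Lemma design_avg_ctr t mu (phi : 'I_(sumn mu) * bool -> 'I_(sumn (twice mu)))
    (Y : tensor R n (sumn (twice mu))) :
  is_2t_design (2 ^ s) t (DSigma R Sigma) ->
  is_partition mu -> (1 <= sumn mu <= t)%N -> bijective phi -> weyl_module Y ->
  avg s Sigma (fun P => ctr phi P Y) = 0.
Proof.
move=> [_ _ des] mup mut phiB YW; have [le_mu|gt_mu] := leqP (size mu) (2 ^ s).
  have := des mu _ mup le_mu mut (H2_of_ctr (2 ^ s) phiB YW).
  rewrite (sum_DSigma_avg sk fam (F := fun P => ctr phi P Y)) // => /eqP.
  by rewrite mulf_eq0 (negbTE (norm_neq0 R fam)) => /eqP.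
apply: avg_eq0 => U GU; apply: ctr_many_rows GU gt_mu YW => //.
by case/andP: mup.
Qed.

End DesignAverages.

Section DesignConverse.
Variables (R : realType) (k s : nat).
Hypothesis sk : (s <= k)%N.
Local Notation n := (2 ^ k)%N.
Variables Sigma Sigma' : {set {vspace F2k2 k}}.
Hypotheses (fam : isotropic_family s Sigma) (fam' : isotropic_family s Sigma').

Definition gap (F : 'M[R]_n -> R) : R := avg s Sigma F - avg s Sigma' F.

Lemma gap_bigsum (J : Type) (r : seq J) (p : pred J) (c : J -> R) (F : J -> 'M[R]_n -> R) :
  \sum_(j <- r | p j) c j * gap (F j) =
  gap (fun P => \sum_(j <- r | p j) c j * F j P).
Proof.
by rewrite /gap -!avg_sum -sumrB; apply: eq_bigr => j _; rewrite mulrBr.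
Qed.

Lemma gapD (F F' : 'M[R]_n -> R) : gap (fun P => F P + F' P) = gap F + gap F'.
Proof.
have avgD S : avg s S (fun P => F P + F' P) = avg s S F + avg s S F'.
  rewrite /avg -mulrDr -big_split; congr (_ * _); apply: eq_bigr => T _ /=.
  by rewrite -big_split.
by rewrite /gap !avgD; ring.
Qed.

Lemma gapZ c (F : 'M[R]_n -> R) : gap (fun P => c * F P) = c * gap F.
Proof. by rewrite /gap -!avg_mull mulrBr. Qed.

Lemma eq_gap (F F' : 'M[R]_n -> R) : (forall P, P^T = P -> F P = F' P) -> gap F = gap F'.
Proof.
move=> FF'; rewrite /gap; congr (_ - _); apply: eq_avg => S psi SS psiS; apply: FF'.
  by have [] := Prj_props R sk fam SS psiS.
by have [] := Prj_props R sk fam' SS psiS.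
Qed.

Section Level.
Variables (t D : nat) (kappa : 'I_t.+1 * bool -> 'I_D.+1).
Hypothesis kappaB : bijective kappa.
Variable F : 'M[R]_n -> (nat -> 'I_n) -> R.
Hypothesis Flocal : forall P f f', (forall c, (c < D.+1)%N -> f c = f' c) -> F P f = F P f'.
Hypothesis FE : forall P (i : {ffun 'I_D.+1 -> 'I_n}), F P (fn i) = tpow P [ffun a => i (kappa a)].

Definition gap_tensor : tensor R n D.+1 := [ffun i => gap (fun P => F P (fn i))].

Lemma gap_tensorE i : gap_tensor i =
  mean_tensor R s Sigma [ffun a => i (kappa a)] -
  mean_tensor R s Sigma' [ffun a => i (kappa a)].
Proof. by rewrite ffunE; congr (_ - _); apply: eq_avg => S psi _ _; rewrite FE. Qed.

Lemma gap_tensor_traceless :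
  (forall i : {ffun 'I_t * bool -> 'I_n}, mean_tensor R s Sigma i = mean_tensor R s Sigma' i) ->
  traceless gap_tensor.
Proof.
move=> e a b ab i; have [kappa' kappaK kappaK'] := kappaB.
have kab : kappa' a != kappa' b by rewrite (can_eq kappaK').
rewrite -[RHS](mean_tensor_traceless sk [ffun c => i (kappa c)] fam fam' e kab).
apply: eq_bigr => l _; rewrite gap_tensorE.
suff -> : [ffun c => upd2 a b i l (kappa c)] =
   upd2 (kappa' a) (kappa' b) [ffun c => i (kappa c)] l by [].
by apply/ffunP => c; rewrite !ffunE -!(can2_eq kappaK kappaK').
Qed.

(** For H = F this is the scalar product of the difference of the two mean tensors with the mean
    tensor of Sigma. *)
Definition pairing (H : 'M[R]_n -> (nat -> 'I_n) -> R) : R :=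
  \sum_(i : {ffun 'I_D.+1 -> 'I_n})
    gap (fun P => H P (fn i)) * avg s Sigma (fun P => F P (fn i)).

Lemma eq_pairing H H' : (forall P, P^T = P -> forall f, H P f = H' P f) ->
  pairing H = pairing H'.
Proof.
by move=> HH'; apply: eq_bigr => i _; congr (_ * _); apply: eq_gap => P PT; apply: HH'.
Qed.

Lemma pairingD H H' : pairing (fun P f => H P f + H' P f) = pairing H + pairing H'.
Proof. by rewrite /pairing -big_split; apply: eq_bigr => i _; rewrite gapD mulrDl. Qed.

Lemma pairing_eq0 (J : eqType) (L : seq J) (c : J -> R) H :
  {in L, forall x, pairing (H x) = 0} ->
  pairing (fun P f => \sum_(x <- L) c x * H x P f) = 0.
Proof.
move=> H0; transitivity (\sum_(x <- L) c x * pairing (H x)); last first.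
  by rewrite big_seq big1 // => x xL; rewrite H0 ?mulr0.
under [RHS]eq_bigr => x _ do rewrite mulr_sumr.
rewrite exchange_big; apply: eq_bigr => i _ /=; rewrite -gap_bigsum mulr_suml.
by apply: eq_bigr => x _; rewrite mulrA.
Qed.

(** The gap of the translated word sum is, up to the constant C, the Young image of the gap tensor
    with its slots permuted by [pw D w]. Moving this permutation to the other side of the pairing
    turns it into a contraction along another matching, which the design hypothesis kills. *)
Lemma pairing_words r1 r2 A B (L : seq (R * seq (nat * nat))) :
  all (all (valid D r1)) A -> all (all (valid D r2)) B ->
  (forall P, P^T = P -> forall a b, (a < b)%N -> (b < D.+1)%N -> r1 a = r1 b -> forall f,
     word_sum false (F P) A (fun c => f (tau (a, b) c)) = word_sum false (F P) A f) ->
  (forall P, P^T = P -> forall a b, (a < b)%N -> (b < D.+1)%N -> r2 a = r2 b -> forall f,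
     young_words (F P) A B (fun c => f (tau (a, b) c)) = - young_words (F P) A B f) ->
  (forall phi : 'I_t.+1 * bool -> 'I_D.+1, bijective phi ->
     avg s Sigma (fun P => ctr phi P (symmetrize r1 r2 gap_tensor)) = 0) ->
  all (fun x => all (valid D (fun=> 0%N)) x.2) L ->
  pairing (fun P f => \sum_(x <- L) x.1 * young_words (F P) A B (act x.2 f)) = 0.
Proof.
move=> vA vB symA symB kills vL.
have := @pairing_eq0 _ L fst (fun x P f => young_words (F P) A B (act x.2 f)).
apply=> -[_ w] /(allP vL) /= vw.
have pr_neq0 r : #|preserving D r|%:R != 0 :> R.
  rewrite pnatr_eq0 -lt0n card_gt0; apply/set0Pn; exists 1%g.
  by apply/preservingP => a; rewrite perm1.
pose C : R := (#|preserving D r1|%:R * #|preserving D r2|%:R)^-1 *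
  ((size A)%:R * (size B)%:R).
have youngE (i : {ffun 'I_D.+1 -> 'I_n}) : gap (fun P => young_words (F P) A B (act w (fn i))) =
    C * symmetrize r1 r2 gap_tensor [ffun a => i (pw D w a)].
  set j := [ffun a => i (pw D w a)].
  transitivity (gap (fun P => C * symmetrize r1 r2 (fun i => F P (fn i)) j)).
    apply: eq_gap => P PT; rewrite /C -mulrA.
    rewrite (symmetrize_words _ (Flocal P) vA vB (symA P PT) (symB P PT)).
    rewrite mulKf ?mulf_neq0 //.
    have Al := @word_sum_local R n D r1 false (F P) A (Flocal P) vA.
    apply: (@word_sum_local R n D r2 true _ B Al vB) => c cd.
    by rewrite /j (fn_pw _ vw).
  rewrite gapZ; congr (_ * _); rewrite /symmetrize.
  transitivity (\sum_(p in preserving D r1) 1 * gap (fun P =>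
      \sum_(q in preserving D r2) (-1) ^+ odd_perm q * F P (fn [ffun a => j (q (p a))]))).
    by rewrite gap_bigsum; apply: eq_gap => P _; apply: eq_bigr => p _; rewrite mul1r.
  apply: eq_bigr => p _; rewrite mul1r -gap_bigsum.
  by apply: eq_bigr => q _; rewrite ffunE.
pose S := symmetrize r1 r2 gap_tensor.
transitivity (C * avg s Sigma (fun P => ctr ((pw D w)^-1%g \o kappa) P S)); last first.
  rewrite kills ?mulr0 //; apply: bij_comp => //.
  by exists (pw D w); [exact: permKV|exact: permK].
rewrite /pairing; under eq_bigr => i _ do rewrite youngE -mulrA.
rewrite -mulr_sumr; congr (_ * _); rewrite avg_sum; apply: eq_avg => T psi _ _.
rewrite -(ctr_reindex _ _ _ (permKV (pw D w)) (permK (pw D w))).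
by apply: eq_bigr => i _; rewrite FE; congr (_ * _); apply: eq_bigr => c _; rewrite !ffunE.
Qed.

Lemma gap_tensor_eq0 : traceless gap_tensor -> pairing F = 0 ->
  isotropic_tensor (mean_tensor R s Sigma' (t := t.+1)) ->
  forall i : {ffun 'I_t.+1 * bool -> 'I_n}, mean_tensor R s Sigma i = mean_tensor R s Sigma' i.
Proof.
move=> tr p0 iso; have [kappa' kappaK kappaK'] := kappaB.
pose T (i : {ffun 'I_t.+1 * bool -> 'I_n}) :=
  mean_tensor R s Sigma i - mean_tensor R s Sigma' i.
have TE i : T i = gap_tensor [ffun a => i (kappa' a)].
  by rewrite gap_tensorE; congr (_ - _); congr mean_tensor;
     apply/ffunP => a; rewrite !ffunE kappaK.
have T1 : \sum_i T i * mean_tensor R s Sigma i = 0.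
  rewrite -[RHS]p0 /pairing.
  rewrite (reindex (fun i : {ffun 'I_D.+1 -> 'I_n} => [ffun a => i (kappa a)])) /=.
    apply: eq_bigr => i _; rewrite -[gap _](ffunE (fun i => gap (fun P => F P (fn i)))).
    rewrite -/gap_tensor gap_tensorE; congr (_ * _); apply: eq_avg => S psi _ _.
    by rewrite FE.
  apply: onW_bij; exists (fun i : {ffun 'I_t.+1 * bool -> 'I_n} => [ffun a => i (kappa' a)]) => i;
    by apply/ffunP => a; rewrite !ffunE ?kappaK ?kappaK'.
have T2 : \sum_i T i * mean_tensor R s Sigma' i = 0.
  apply: iso => phi phiB.
  have -> : ctr phi 1%:M T = ctr phi 1%:M (fun i => gap_tensor [ffun a => i (kappa' a)]).
    by apply: eq_bigr => i _; rewrite TE.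
  rewrite (ctr_reindex _ _ _ kappaK kappaK'); apply: ctr_traceless => //.
  exact: bij_comp.
have TT : \sum_i T i ^+ 2 = 0.
  transitivity (\sum_i (T i * mean_tensor R s Sigma i - T i * mean_tensor R s Sigma' i)).
    by apply: eq_bigr => i _; rewrite /T; ring.
  by rewrite sumrB T1 T2 subrr.
move=> i; apply/eqP; rewrite -subr_eq0 -/(T i) -sqrf_eq0; apply/eqP.
by apply: (psumr_eq0P _ TT) => // j _; apply: sqr_ge0.
Qed.

End Level.

End DesignConverse.

Section ConverseLevels.
Variables (R : realType) (k s : nat).
Hypothesis sk : (s <= k)%N.
Local Notation n := (2 ^ k)%N.
Variables Sigma Sigma' : {set {vspace F2k2 k}}.
Hypotheses (fam : isotropic_family s Sigma) (fam' : isotropic_family s Sigma').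

(* The c-th pair occupies the boxes 2c and 2c + 1. *)
Definition slot t D (a : 'I_t * bool) : 'I_D.+1 := inord (a.1.*2 + a.2).

Lemma slot_bij t D : (t * 2 = D.+1)%N -> bijective (@slot t D).
Proof.
move=> tD; apply: inj_card_bij; last by rewrite card_prod card_bool !card_ord tD.
have lt (a : 'I_t * bool) : (a.1.*2 + a.2 < D.+1)%N.
  by rewrite -tD muln2; case: a => c b /=; have := ltn_ord c; case: b; lia.
move=> [c b] [c' b'] /(congr1 val); rewrite /= !inordK ?lt //= => e.
suff [-> ->] : c = c' /\ b = b' by [].
by split; [apply: ord_inj|]; case: b e; case: b' => /=; lia.
Qed.

Lemma pair2_slot (P : 'M[R]_n) (i : {ffun 'I_4 -> 'I_n}) :
  pair2 P (fn i) = tpow P [ffun a => i (@slot 2 3 a)].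
Proof. by rewrite /tpow !big_ord_recl big_ord0 mulr1 !ffunE. Qed.

Lemma pair3_slot (P : 'M[R]_n) (i : {ffun 'I_6 -> 'I_n}) :
  pair3 P (fn i) = tpow P [ffun a => i (@slot 3 5 a)].
Proof. by rewrite /tpow !big_ord_recl big_ord0 mulr1 !ffunE mulrA. Qed.

Lemma design_avg_young t mu (phi : 'I_(sumn mu) * bool -> 'I_(sumn (twice mu)))
    (T : tensor R n (sumn (twice mu))) :
  is_2t_design (2 ^ s) t (DSigma R Sigma) -> traceless T ->
  is_partition mu -> (1 <= sumn mu <= t)%N -> bijective phi ->
  avg s Sigma (fun P => ctr phi P (fun i =>
    \sum_(p in row_group (twice mu)) \sum_(r in col_group (twice mu))
      (-1) ^+ odd_perm r * T [ffun a => i (r (p a))])) = 0.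
Proof.
move=> des trT mup mut phiB; rewrite -[RHS](design_avg_ctr sk fam des mup mut phiB
  (conj (traceless_young_symmetrizer trT) (ex_intro _ T erefl))).
by apply: eq_avg => S psi _ _; apply: eq_bigr => i _; rewrite ffunE.
Qed.

Lemma design_mean_tensor2 : is_2t_design (2 ^ s) 2 (DSigma R Sigma) ->
  (forall i : {ffun 'I_1 * bool -> 'I_n}, mean_tensor R s Sigma i = mean_tensor R s Sigma' i) ->
  isotropic_tensor (mean_tensor R s Sigma' (t := 2)) ->
  forall i : {ffun 'I_2 * bool -> 'I_n}, mean_tensor R s Sigma i = mean_tensor R s Sigma' i.
Proof.
move=> des e1 iso.
have kB : bijective (@slot 2 3) by apply: slot_bij.
have tr := gap_tensor_traceless sk fam fam' kB pair2_slot e1.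
apply: (gap_tensor_eq0 kB pair2_slot tr _ iso).
have local P := @pair2_local R n P.
have kills4 phi := @design_avg_young 2 [:: 2]%N phi _ des tr isT isT.
have kills22 phi := @design_avg_young 2 [:: 1; 1]%N phi _ des tr isT isT.
rewrite (eq_pairing sk fam fam' _ _ (fun P PT f => decomposition4 PT f)) pairingD.
rewrite (pairing_words sk fam fam' kB local pair2_slot _ _
  (fun P PT => row_sym4 PT) (fun P PT => @col_antisym4 R n P) kills4) //.
rewrite (pairing_words sk fam fam' kB local pair2_slot _ _
  (fun P PT => row_sym22 PT) (fun P PT => col_antisym22 PT) kills22) ?addr0 //.
Qed.

Lemma design_mean_tensor3 : is_2t_design (2 ^ s) 3 (DSigma R Sigma) ->
  (forall i : {ffun 'I_2 * bool -> 'I_n}, mean_tensor R s Sigma i = mean_tensor R s Sigma' i) ->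
  isotropic_tensor (mean_tensor R s Sigma' (t := 3)) ->
  forall i : {ffun 'I_3 * bool -> 'I_n}, mean_tensor R s Sigma i = mean_tensor R s Sigma' i.
Proof.
move=> des e2 iso.
have kB : bijective (@slot 3 5) by apply: slot_bij.
have tr := gap_tensor_traceless sk fam fam' kB pair3_slot e2.
apply: (gap_tensor_eq0 kB pair3_slot tr _ iso).
have local P := @pair3_local R n P.
have kills6 phi := @design_avg_young 3 [:: 3]%N phi _ des tr isT isT.
have kills42 phi := @design_avg_young 3 [:: 2; 1]%N phi _ des tr isT isT.
have kills222 phi := @design_avg_young 3 [:: 1; 1; 1]%N phi _ des tr isT isT.
rewrite (eq_pairing sk fam fam' _ _ (fun P PT f => decomposition6 PT f)) !pairingD.
rewrite (pairing_words sk fam fam' kB local pair3_slot _ _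
  (fun P PT => row_sym6 PT) (fun P PT => @col_antisym6 R n P) kills6) //.
rewrite (pairing_words sk fam fam' kB local pair3_slot _ _
  (fun P PT => row_sym42 PT) (fun P PT => col_antisym42 PT) kills42) //.
rewrite (pairing_words sk fam fam' kB local pair3_slot _ _
  (fun P PT => row_sym222 PT) (fun P PT => col_antisym222 PT) kills222) ?addr0 //.
Qed.

End ConverseLevels.

Lemma design_weaken (R : realType) (n m t t' : nat) (D : set {vspace 'cV[R]_n}) :
  (t' <= t)%N -> is_2t_design m t D -> is_2t_design m t' D.
Proof.
move=> tt' [DG Df des]; split=> // mu f mup mum /andP[mu0 mut].
by apply: des => //; rewrite mu0 (leq_trans mut).
Qed.

Theorem theorem8 (R : realType) (k s : nat) (Sigma : {set {vspace F2k2 k}})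
    (k_ge1 : (1 <= k)%N) (lt_sk : (s < k)%N)
    (Sigma_neq0 : (0 < #|Sigma|)%N)
    (Sigma_iso : forall S, S \in Sigma -> totally_isotropic S)
    (Sigma_dim : forall S, S \in Sigma -> \dim S = (k - s)%N) :
  is_2t_design (2 ^ s) 1 (DSigma R Sigma) /\
  (forall t : nat, t = 2%N \/ t = 3%N ->
     (is_2t_design (2 ^ s) t (DSigma R Sigma) <->
      (#|Sigma|%:R ^+ 2)^-1 *
        (\sum_(S in Sigma) \sum_(S' in Sigma) (card_capv S S')%:R ^+ (t - 1))
      = dwk k R (k - s) (t - 1))).
Proof.
have sk : (s <= k)%N := ltnW lt_sk.
have fam : isotropic_family s Sigma by [].
have X_neq0 : (0 < #|isotropic_subspaces k (k - s)|)%N.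
  have /card_gt0P[S SS] := Sigma_neq0.
  by apply/card_gt0P; exists S; rewrite inE Sigma_iso ?Sigma_dim /=.
have famX := full_family X_neq0.
set X := isotropic_subspaces k (k - s) in X_neq0 famX *.
have iso1 : isotropic_tensor (mean_tensor R s Sigma (t := 1)) by apply: isotropic_mean_tensor1.
have isoX2 : isotropic_tensor (mean_tensor R s X (t := 2)) by apply: isotropic_mean_tensor2.
have isoX3 : isotropic_tensor (mean_tensor R s X (t := 3)) by apply: isotropic_mean_tensor3.
(* The moment of order 0 is 1 for every nonempty family, so level 1 carries no condition on
   Sigma. *)
have e1 : forall i : {ffun 'I_1 * bool -> 'I_(2 ^ k)},
    mean_tensor R s Sigma i = mean_tensor R s X i.
  apply/(moment_eqP sk fam famX); first exact: isotropic_mean_tensor1.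
  have moment0 (S : {set {vspace F2k2 k}}) : (0 < #|S|)%N -> @intersection_moment k R S 0 = 1.
    move=> S0; rewrite /intersection_moment.
    rewrite (eq_bigr (fun=> #|S|%:R)) => [|T _]; last by rewrite sumr_const.
    by rewrite sumr_const -[X in _ * X]mulr_natl -expr2 mulVf // expf_neq0 // pnatr_eq0 -lt0n.
  by rewrite !moment0.
split; first by apply: (design_of_isotropic sk) => // -[|[|t]].
move=> t t23; rewrite -/(intersection_moment R Sigma (t - 1)) /dwk -/X.
have e2_iso : (forall i : {ffun 'I_2 * bool -> 'I_(2 ^ k)},
    mean_tensor R s Sigma i = mean_tensor R s X i) ->
    isotropic_tensor (mean_tensor R s Sigma (t := 2)).
  by move=> e2; apply: eq_isotropic isoX2.
have e3_iso : (forall i : {ffun 'I_3 * bool -> 'I_(2 ^ k)},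
    mean_tensor R s Sigma i = mean_tensor R s X i) ->
    isotropic_tensor (mean_tensor R s Sigma (t := 3)).
  by move=> e3; apply: eq_isotropic isoX3.
case: t23 => ->; split=> [des|/(moment_eqP sk fam famX) e].
- by apply/(moment_eqP sk fam famX) => //; apply: design_mean_tensor2.
- have e2 := e isoX2; apply: (design_of_isotropic sk) => // -[|[|[|t']]] // _.
  exact: e2_iso.
- apply/(moment_eqP sk fam famX) => //; apply: design_mean_tensor3 => //.
  by apply: design_mean_tensor2 => //; apply: design_weaken des.
(* Only the moment of order 2 is assumed here; agreement at level 2, needed for the partitions of 2,
   follows by contracting level 3. *)
have e3 := e isoX3; have e2 := mean_tensor_contract sk fam famX e3.
apply: (design_of_isotropic sk) => // -[|[|[|[|t']]]] // _; first exact: e2_iso.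
exact: e3_iso.
Qed.
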